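(* There exists a randomized $O\!\left(\frac{\log^3 n}{\log\log n}\right)$-competitive online algorithm for directed Steiner tree with deadlines, which runs in quasi-polynomial time, where $n$ is the number of vertices of the input graph.
   Context: Directed Steiner tree with deadlines: given in advance a simple directed graph $G=(V,E)$ with $|V|=n$, edge costs $c:E\to\mathbb{R}^+$ and a root $\rho\in V$. Requests arrive over time; each request $q$ is a vertex $v\in V$, released at time $r_q$ with a deadline $d_q$ revealed at release. At any time the algorithm may transmit a set of directed edges $E'\subseteq E$ at cost $\sum_{e\in E'}c(e)$; this serves every pending request $v$ such that $(V,E')$ contains a directed path from $\rho$ to $v$. Each request must be served at some time in $[r_q,d_q]$. The cost is the total transmission cost. A randomized online algorithm is $\alpha$-competitive if on every input its expected cost is at most $\alpha$ times the optimal offline cost. *)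

(* Defs.v *)
From HB Require Import structures.
From mathcomp Require Import all_boot all_order all_algebra.
From mathcomp Require Import all_classical all_reals all_analysis.
Set Implicit Arguments.
Unset Strict Implicit.
Unset Printing Implicit Defensive.
Import Order.TTheory GRing.Theory Num.Theory numFieldNormedType.Exports.
Local Open Scope classical_set_scope.
Local Open Scope ring_scope.

(* Simple digraph: no loops, and no parallel edges since [edge] is a relation;
   antiparallel edges are allowed. The values of [ecost] on pairs that are not
   edges are never used. *)
Record network (R : realType) := Network {
  nv : nat;
  edge : rel 'I_nv;
  edge_irr : irreflexive edge;
  ecost : 'I_nv * 'I_nv -> R;
  ecost_gt0 : forall e, edge e.1 e.2 -> 0 < ecost e;
  rho : 'I_nv }.

Definition request (R : realType) (n : nat) : Type := ('I_n * (R * R))%type.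
Definition rvertex R n (q : request R n) : 'I_n := q.1.
Definition release R n (q : request R n) : R := q.2.1.
Definition deadline R n (q : request R n) : R := q.2.2.

Section Schedules.
Variables (R : realType) (G : network R).
Local Notation V := 'I_(nv G).

(* The transmissions performed, each with its time. *)
Definition schedule : Type := seq (R * {set V * V}).

Definition schedule_cost (S : schedule) : R :=
  \sum_(tr <- S) \sum_(e in tr.2) ecost e.

Definition served (S : schedule) (q : request R (nv G)) : Prop :=
  exists t E', [/\ (t, E') \in S, release q <= t, t <= deadline q
    & connect [rel x y | (x, y) \in E'] (rho G) (rvertex q)].

Definition feasible (rs : seq (request R (nv G))) (S : schedule) : Prop :=
  (forall t E' e, (t, E') \in S -> e \in E' -> edge e.1 e.2) /\
  (forall q, q \in rs -> served S q).

Definition opt (rs : seq (request R (nv G))) : R :=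
  inf [set schedule_cost S | S in feasible rs].

(* Reachability of the requested vertices is what makes an input solvable. *)
Definition valid_input (rs : seq (request R (nv G))) : Prop :=
  [/\ sorted (fun q q' => release q <= release q') rs,
      forall q, q \in rs -> release q <= deadline q
    & forall q, q \in rs -> connect (@edge R G) (rho G) (rvertex q)].

End Schedules.

(* Online algorithms are programs of a probabilistic real RAM.  The memory is
   made of arrays of naturals and arrays of reals, indexed by naturals
   ([NGet a i] and [RGet a i] read entry [i] of array number [a]).  Real
   arithmetic is exact; there is no rounding, no conversion from reals to
   naturals and no real constant other than the images of naturals.  Naturals
   have no multiplication, so that their bit length stays linear
   in the number of steps, as is required for a unit-cost model. *)
Inductive nexp :=
| NLit of nat
| NGet of nat & nexp
| NAdd of nexp & nexp
| NSub of nexp & nexp.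

Inductive rexp :=
| ROfNat of nexp
| RGet of nat & nexp
| RAdd of rexp & rexp
| RSub of rexp & rexp
| RMul of rexp & rexp
| RDiv of rexp & rexp.

Inductive bexp :=
| BNLe of nexp & nexp
| BRLe of rexp & rexp
| BNot of bexp.

Inductive cmd :=
| CSkip
| CSeq of cmd & cmd
| CIf of bexp & cmd & cmd
| CWhile of bexp & cmd
| CNSet of nat & nexp & nexp
| CRSet of nat & nexp & rexp
| CFlip of nat & nexp      (* stores a fresh fair coin, 0 or 1 *)
| CMark of nexp            (* adds the edge of this number to the marked set *)
| CTransmit                (* transmits the marked set now, then unmarks it *)
| CAlarm of rexp.          (* (re)sets the unique alarm clock *)

(* An algorithm only acts when a request is released or when its alarm rings. *)
Record algorithm := Algorithm { on_request : cmd; on_alarm : cmd }.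

Section Semantics.
Variables (R : realType) (G : network R) (A : algorithm).
Local Notation V := 'I_(nv G).

Definition edges : seq (V * V) := enum [pred e : V * V | edge e.1 e.2].

Record config := Config {
  nmem : nat -> nat -> nat;
  rmem : nat -> nat -> R;
  ncoins : nat;
  todo : seq cmd;
  now : R;
  alarm : option R;
  upcoming : seq (request R (nv G));
  marked : {set V * V};
  sent : schedule G }.

Definition set_nmem m c := Config m (rmem c) (ncoins c) (todo c) (now c)
  (alarm c) (upcoming c) (marked c) (sent c).
Definition set_rmem m c := Config (nmem c) m (ncoins c) (todo c) (now c)
  (alarm c) (upcoming c) (marked c) (sent c).
Definition set_ncoins k c := Config (nmem c) (rmem c) k (todo c) (now c)
  (alarm c) (upcoming c) (marked c) (sent c).
Definition set_todo s c := Config (nmem c) (rmem c) (ncoins c) s (now c)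
  (alarm c) (upcoming c) (marked c) (sent c).
Definition set_now t c := Config (nmem c) (rmem c) (ncoins c) (todo c) t
  (alarm c) (upcoming c) (marked c) (sent c).
Definition set_alarm o c := Config (nmem c) (rmem c) (ncoins c) (todo c) (now c)
  o (upcoming c) (marked c) (sent c).
Definition set_upcoming rs c := Config (nmem c) (rmem c) (ncoins c) (todo c)
  (now c) (alarm c) rs (marked c) (sent c).
Definition set_marked E' c := Config (nmem c) (rmem c) (ncoins c) (todo c)
  (now c) (alarm c) (upcoming c) E' (sent c).
Definition set_sent S c := Config (nmem c) (rmem c) (ncoins c) (todo c) (now c)
  (alarm c) (upcoming c) (marked c) S.

Definition update T (m : nat -> nat -> T) (a i : nat) (v : T) : nat -> nat -> T :=
  fun b j => if (b == a) && (j == i) then v else m b j.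

Fixpoint neval (c : config) (e : nexp) : nat :=
  match e with
  | NLit k => k
  | NGet a i => nmem c a (neval c i)
  | NAdd e1 e2 => (neval c e1 + neval c e2)%N
  | NSub e1 e2 => (neval c e1 - neval c e2)%N
  end.

Fixpoint reval (c : config) (e : rexp) : R :=
  match e with
  | ROfNat e1 => (neval c e1)%:R
  | RGet a i => rmem c a (neval c i)
  | RAdd e1 e2 => reval c e1 + reval c e2
  | RSub e1 e2 => reval c e1 - reval c e2
  | RMul e1 e2 => reval c e1 * reval c e2
  | RDiv e1 e2 => reval c e1 / reval c e2
  end.

Fixpoint beval (c : config) (b : bexp) : bool :=
  match b with
  | BNLe e1 e2 => (neval c e1 <= neval c e2)%N
  | BRLe e1 e2 => reval c e1 <= reval c e2
  | BNot b1 => ~~ beval c b1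
  end.

(* One step of the command [p], the rest of the program being [todo c]. *)
Definition exec (tape : nat -> bool) (p : cmd) (c : config) : config :=
  match p with
  | CSkip => c
  | CSeq p1 p2 => set_todo [:: p1, p2 & todo c] c
  | CIf b p1 p2 => set_todo ((if beval c b then p1 else p2) :: todo c) c
  | CWhile b p1 => if beval c b then set_todo [:: p1, p & todo c] c else c
  | CNSet a i e => set_nmem (update (nmem c) a (neval c i) (neval c e)) c
  | CRSet a i e => set_rmem (update (rmem c) a (neval c i) (reval c e)) c
  | CFlip a i => set_ncoins (ncoins c).+1
      (set_nmem (update (nmem c) a (neval c i) (tape (ncoins c) : nat)) c)
  | CMark e => if onth edges (neval c e) is Some e'
               then set_marked (e' |: marked c)%SET c else c
  | CTransmit => set_marked finset.set0
      (set_sent (rcons (sent c) (now c, marked c)) c)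
  | CAlarm e => set_alarm (Some (reval c e)) c
  end.

(* Entry 3 of natural array 0 holds the vertex of the last released request;
   real array 1 holds the current time (entry 0) and the deadline of the last
   released request (entry 1). *)
Definition arrive (q : request R (nv G)) rs (c : config) : config :=
  set_todo [:: on_request A] (set_upcoming rs (set_now (release q)
    (set_nmem (update (nmem c) 0 3 (val (rvertex q)))
    (set_rmem (update (update (rmem c) 1 0 (release q)) 1 1 (deadline q)) c)))).

Definition ring_alarm (t : R) (c : config) : config :=
  set_todo [:: on_alarm A] (set_alarm None (set_now t
    (set_rmem (update (rmem c) 1 0 t) c))).

(* An alarm set to a past time rings now; simultaneous releases come first. *)
Definition next_event (c : config) : config :=
  match upcoming c, alarm c with
  | q :: rs, Some t => let t' := Order.max (now c) t in
      if release q <= t' then arrive q rs c else ring_alarm t' c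
  | q :: rs, None => arrive q rs c
  | [::], Some t => ring_alarm (Order.max (now c) t) c
  | [::], None => c
  end.

Definition step (tape : nat -> bool) (c : config) : config :=
  if todo c is p :: s then exec tape p (set_todo s c) else next_event c.

Definition halted (c : config) : bool :=
  [&& nilp (todo c), nilp (upcoming c) & ~~ isSome (alarm c)].

(* Natural array 0 starts with n, the root and |E|; natural arrays 1 and 2 hold
   the tails and heads of the edges, and real array 0 their costs.  Everything
   else is 0. *)
Definition init_nmem (a i : nat) : nat :=
  match a with
  | 0 => nth 0%N [:: nv G; val (rho G); size edges] i
  | 1 => nth 0%N [seq val e.1 | e <- edges] i
  | 2 => nth 0%N [seq val e.2 | e <- edges] i
  | _ => 0%N
  end.

Definition init_rmem (a i : nat) : R :=
  if a is 0 then nth 0 [seq ecost e | e <- edges] i else 0.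

Definition init (rs : seq (request R (nv G))) : config :=
  Config init_nmem init_rmem 0 [::] 0 None rs finset.set0 [::].

Definition run (rs : seq (request R (nv G))) (tape : nat -> bool) (k : nat) :=
  iter k (step tape) (init rs).

Definition halts_within rs (k : nat) : Prop :=
  forall tape, halted (run rs tape k).

(* Meaningful when [halts_within rs k]: a run then reads at most [k] coins, so
   that the uniform average over [k]-bit tapes is the expectation over an
   infinite sequence of fair coins. *)
Definition expected_cost rs (k : nat) : R :=
  (\sum_(w : k.-tuple bool) schedule_cost (sent (run rs (nth false w) k)))
  / 2 ^+ k.

End Semantics.

Definition competitive (R : realType) (A : algorithm) (alpha : nat -> R) : Prop :=
  forall (G : network R) (rs : seq (request R (nv G))), valid_input rs ->
  exists k, [/\ halts_within A rs k,
    forall tape, feasible rs (sent (run A rs tape k))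
    & expected_cost A rs k <= alpha (nv G) * opt rs].

(* 2 ^ polylog(N), with N the size of the input up to a polynomial. *)
Definition quasipolynomial (R : realType) (T : nat -> nat) : Prop :=
  exists d : nat, (fun N => ln (T N)%:R : R^o) =O_\oo (fun N => ln N%:R ^+ d : R^o).

Definition quasipolynomial_time (R : realType) (A : algorithm) : Prop :=
  exists2 T : nat -> nat, quasipolynomial R T &
  forall (G : network R) (rs : seq (request R (nv G))), valid_input rs ->
    halts_within A rs (T (nv G + size rs)%N).

(* Main.v *)
Require Import Defs.
From mathcomp Require Import all_boot all_order all_algebra.
From mathcomp Require Import all_classical all_reals all_analysis.
From mathcomp Require Import zify ring lra.

(* The algorithm is deterministic.  Every pending request has a level, 0 at its
   release.  When the least deadline of the pending requests is reached, that
   request is served at level [x], the larger one of its level and of an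
   approximate price of reaching it.  For O(x log^2 n / log log n) more, the
   service covers the pending requests of level at most [2 x], by increasing
   deadlines, as far as the oracle below succeeds; those left out are raised to
   level [4 x].  Failure of the oracle on the requests up to some deadline means
   that no tree of cost [x] reaches them all, so that a raised level bounds from
   below what the offline solution pays for these requests.  The levels of the
   services that see the same offline transmission more than double from one to
   the next, so that each of its edges is charged O(log n) times its cost.

   The oracle repeats a recursive greedy search.  A tree on [n] vertices splits
   recursively, in depth O(log n), into single edges, where each piece hands
   over to the later ones a single vertex.  Merging log log n consecutive levels
   of the splitting into one level with O(log n) pieces leaves
   D = O(log n / log log n) levels.  Trying all targets and integer budgets at
   each step, the search reaches at least a fraction 1 / (D + 1) of the terminals
   of the tree at no more than its cost, and O(D log n) repetitions reach all of
   them.  The recursion has depth O(log^2 n) and O(n^2) branches, hence runs in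
   quasi-polynomial time. *)

Set Implicit Arguments.
Unset Strict Implicit.
Unset Printing Implicit Defensive.
Import Order.TTheory GRing.Theory Num.Theory numFieldNormedType.Exports.

(** * Splitting trees *)

(** One offline edge may count towards many services, whose levels spread over arbitrarily many
    scales. The [weight] of an edge removes this obstacle: for a tree of cost about x, the edges
    below x / (8 n) are negligible together, and an edge above x need not count for more than x. Its
    full cost is then paid at O(log n) scales only. Eligibility up to 2 x and the raise to 4 x fit
    this: after a service of level x every request still pending, raised or not, has a level above 2
    x.

    With L = [logn2 n] and D = [paramD n], a service of level x buys two oracle solutions of cost 2
    L (D + 1) x each, the charging loses 8 (L + 5), and the ratio is the product.

    The other obstacle is the machine, which has neither procedures nor products of naturals. The
    search is therefore specified as a relation that leaves ties open, and run on an explicit stack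
    with states in a heap that only grows. Programs are written in a language of bounded loops,
    where results and running times are derived without following machine steps. *)

Section Trees.
Variable V : eqType.

(* Left-child right-sibling encoding of an arborescence: below a vertex [u],
   [Node v t t'] is the edge [(u, v)] with [t] hanging below [v] and the
   remaining children of [u] in [t']. *)
Inductive tree := Nil | Node of V & tree & tree.

Fixpoint tedges (u : V) (t : tree) : seq (V * V) :=
  if t is Node v t1 t2 then (u, v) :: tedges v t1 ++ tedges u t2 else [::].

Fixpoint tsize (t : tree) : nat :=
  if t is Node _ t1 t2 then (tsize t1 + tsize t2).+1 else 0.

Lemma size_tedges u t : size (tedges u t) = tsize t.
Proof. by elim: t u => //= v t1 IH1 t2 IH2 u; rewrite size_cat IH1 IH2. Qed.

(* A tree with a hole: the flag tells whether the hole is below the new vertex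
   or among the remaining children. *)
Definition context := seq (bool * V * tree).

Fixpoint cedges (u : V) (C : context) : seq (V * V) :=
  match C with
  | (true, v, t) :: C' => (u, v) :: tedges u t ++ cedges v C'
  | (false, v, t) :: C' => (u, v) :: tedges v t ++ cedges u C'
  | [::] => [::]
  end.

Fixpoint hole (u : V) (C : context) : V :=
  match C with
  | (true, v, _) :: C' => hole v C'
  | (false, _, _) :: C' => hole u C'
  | [::] => u
  end.

Definition csize (C : context) : nat := sumn [seq (tsize f.2).+1 | f <- C].

Lemma hole_cat u C1 C2 : hole u (C1 ++ C2) = hole (hole u C1) C2.
Proof. by elim: C1 u => [//|[[[] v] t] C1 IH] u /=; rewrite IH. Qed.

Lemma cedges_cat u C1 C2 :
  cedges u (C1 ++ C2) = cedges u C1 ++ cedges (hole u C1) C2.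
Proof.
by elim: C1 u => [//|[[[] v] t] C1 IH] u /=; rewrite IH catA.
Qed.

Lemma csize_cat C1 C2 : csize (C1 ++ C2) = csize C1 + csize C2.
Proof. by rewrite /csize map_cat sumn_cat. Qed.

Lemma perm_cons_swap (T : eqType) (a b : T) s t :
  perm_eq s (b :: t) -> perm_eq (a :: s) (b :: a :: t).
Proof.
move=> st; apply: (@perm_trans _ (a :: b :: t)); first by rewrite perm_cons.
exact/permPl/(perm_catCA [:: a] [:: b]).
Qed.

(** The new leaf becomes the first child of [x], which changes the order of the edge list only. *)
Lemma tree_insert t u x y : x \in u :: map snd (tedges u t) ->
  exists t', perm_eq (tedges u t') ((x, y) :: tedges u t).
Proof.
elim: t u => [|v t1 IH1 t2 IH2] u.
  by rewrite /= inE => /eqP->; exists (Node y Nil Nil).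
rewrite /= map_cat !inE mem_cat => /or4P[/eqP->|/eqP->|x1|x2].
- by exists (Node y Nil (Node v t1 t2)).
- by exists (Node v (Node y Nil t1) t2); apply: perm_cons_swap.
- have [|t' t'E] := IH1 v; first by rewrite inE x1 orbT.
  exists (Node v t' t2); apply: perm_cons_swap.
  by rewrite -cat_cons perm_cat2r.
- have [|t' t'E] := IH2 u; first by rewrite inE x2 orbT.
  exists (Node v t1 t'); apply: perm_cons_swap.
  apply: (@perm_trans _ (tedges v t1 ++ (x, y) :: tedges u t2)).
    by rewrite perm_cat2l.
  exact/permPl/(perm_catCA _ [:: _]).
Qed.

(* [decomp k S w F]: processing the edges [F], attached to the vertices [S],
   so as to reach [w], splits recursively in depth [k] into single edges; each
   piece hands over to the later ones only one reached vertex. *)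
Fixpoint decomp (k : nat) (S : seq V) (w : V) (F : seq (V * V)) : Prop :=
  if k is k'.+1 then
    exists w1 F1 F2, [/\ perm_eq F (F1 ++ F2), decomp k' S w1 F1
      & decomp k' (w1 :: S) w F2]
  else (F = [::] /\ w \in S) \/ exists2 u, u \in S & F = [:: (u, w)].

Lemma decomp_sub k S S' w F : {subset S <= S'} -> decomp k S w F ->
  decomp k S' w F.
Proof.
elim: k S S' w F => [|k IH] S S' w F sub /=.
  by case=> [[-> wS]|[u uS ->]]; [left; split; auto | right; exists u; auto].
case=> w1 [F1 [F2 [pF d1 d2]]]; exists w1, F1, F2; split; eauto.
by apply: IH d2 => x; rewrite !inE => /orP[->//|/sub->]; rewrite orbT.
Qed.

Lemma decomp_nil k (S : seq V) (w : V) : w \in S -> decomp k S w [::].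
Proof.
elim: k S => [|k IH] S wS /=; first by left.
by exists w, [::], [::]; split; auto; apply: IH; rewrite inE wS orbT.
Qed.

Lemma decompS k S w F : decomp k S w F -> decomp k.+1 S w F.
Proof.
move=> d; exists w, F, [::]; split; rewrite ?cats0//.
by apply: decomp_nil; rewrite inE eqxx.
Qed.

Lemma decomp_leq k k' S w F : k <= k' -> decomp k S w F -> decomp k' S w F.
Proof. by move/subnK<-; elim: (k' - k) => // j IH /IH; exact: decompS. Qed.

Lemma decomp_perm k S w F F' : perm_eq F F' -> decomp k S w F -> decomp k S w F'.
Proof.
case: k => [|k] /=.
  move=> pF [[F0 wS]|[u uS F1]]; subst F.
    by left; split=> //; apply/perm_nilP; rewrite perm_sym.
  by right; exists u => //; apply: perm_small_eq; rewrite // perm_sym.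
move=> pF [w1 [F1 [F2 [pF' d1 d2]]]]; exists w1, F1, F2; split=> //.
by apply: perm_trans pF'; rewrite perm_sym.
Qed.

Lemma decomp_cat k S w w1 F1 F2 : decomp k S w1 F1 -> decomp k (w1 :: S) w F2 ->
  decomp k.+1 S w (F1 ++ F2).
Proof. by move=> d1 d2; exists w1, F1, F2. Qed.

Lemma decomp_edge k (S : seq V) (u w : V) : u \in S -> decomp k S w [:: (u, w)].
Proof. by move=> uS; apply: (@decomp_leq 0) => //; right; exists u. Qed.

(* Follow the child of size at least [2 ^ k] as long as there is one. *)
Lemma tree_split k t u : 2 ^ k <= tsize t < 2 ^ k.+1 ->
  exists C v t1 t2, [/\ csize C < 2 ^ k, tsize t1 < 2 ^ k, tsize t2 < 2 ^ k
    & perm_eq (tedges u t) (cedges u C ++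
       (hole u C, v) :: tedges v t1 ++ tedges (hole u C) t2)].
Proof.
move=> /andP[lo hi].
suff [C [v [t1 [t2 [szE lo' h1 h2 pE]]]]] : exists C v t1 t2,
    [/\ csize C + (tsize t1 + tsize t2).+1 = tsize t,
    2 ^ k <= (tsize t1 + tsize t2).+1, tsize t1 < 2 ^ k, tsize t2 < 2 ^ k
    & perm_eq (tedges u t) (cedges u C ++
       (hole u C, v) :: tedges v t1 ++ tedges (hole u C) t2)].
  exists C, v, t1, t2; split=> //.
  by move: hi lo'; rewrite -szE expnS; lia.
elim: t u lo {hi} => [|v t1 IH1 t2 IH2] u /= lo.
  by move: lo; rewrite leqNgt expn_gt0.
have [lo1|hi1] := leqP (2 ^ k) (tsize t1).
  have [C [v' [t1' [t2' [szE lo' h1 h2 pE]]]]] := IH1 v lo1.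
  exists ((true, v, t2) :: C), v', t1', t2'; split=> //.
    by rewrite /csize /= -/(csize C); lia.
  by rewrite /= perm_cons -catA perm_catC perm_cat2l.
have [lo2|hi2] := leqP (2 ^ k) (tsize t2).
  have [C [v' [t1' [t2' [szE lo' h1 h2 pE]]]]] := IH2 u lo2.
  exists ((false, v, t1) :: C), v', t1', t2'; split=> //.
    by rewrite /csize /= -/(csize C); lia.
  by rewrite /= perm_cons -catA perm_cat2l.
by exists [::], v, t1, t2.
Qed.

(** [f] is the frame at which the accumulated size first reaches [2 ^ k], so that what precedes it
    and what follows it are both small. *)
Lemma context_split k C : 2 ^ k <= csize C < 2 ^ k.+1 ->
  exists C1 f C2, [/\ C = C1 ++ f :: C2, csize C1 < 2 ^ k, csize C2 < 2 ^ k
    & tsize f.2 < 2 ^ k.+1].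
Proof.
move=> /andP[lo hi].
suff [C1 [f [C2 [CE h1 lo1]]]] : exists C1 f C2, [/\ C = C1 ++ f :: C2,
    csize C1 < 2 ^ k & 2 ^ k <= csize (rcons C1 f)].
  exists C1, f, C2; move: hi lo1.
  rewrite CE -cats1 !csize_cat /csize /= expnS -!/(csize _) => hi lo1.
  by split=> //; lia.
elim/last_ind: C lo {hi} => [|C f IH] lo; first by move: lo; rewrite leqNgt expn_gt0.
have [lo'|hi] := leqP (2 ^ k) (csize C).
  have [C1 [f' [C2 [-> h1 lo1]]]] := IH lo'.
  by exists C1, f', (rcons C2 f); rewrite rcons_cat.
by exists C, f, [::]; rewrite cats1.
Qed.

(** Trees and contexts are halved together, at four levels per halving. A tree splits into a
    context, an edge and two small subtrees. A context splits at one frame into two small contexts,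
    but the subtree of that frame may keep nearly the full size: it falls under the claim for trees
    at [k.+1], proved before, and contexts are granted three more levels. A tree hands over a vertex
    already known, a context its hole. *)
Lemma decomp_balanced k :
  (forall t u (S : seq V) w, tsize t < 2 ^ k -> u \in S -> w \in S ->
     decomp (4 * k) S w (tedges u t)) /\
  (forall C u (S : seq V), csize C < 2 ^ k -> u \in S ->
     decomp (4 * k + 3) S (hole u C) (cedges u C)).
Proof.
elim: k => [|k [IHt IHc]].
  split=> [[|v t1 t2]//= u S w _ uS wS|]; first by left.
  by case=> [|f C]// u S _ uS; apply: decomp_nil.
have Ht t u (S : seq V) w : tsize t < 2 ^ k.+1 -> u \in S -> w \in S ->
     decomp (4 * k.+1) S w (tedges u t).
  move=> sz uS wS; have [lo|hi] := leqP (2 ^ k) (tsize t); last first.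
    by apply: (@decomp_leq (4 * k)); [lia | apply: IHt].
  have [|C [v [t1 [t2 [h0 h1 h2 pE]]]]] := @tree_split k t u; first by rewrite lo.
  rewrite perm_sym in pE; apply: (decomp_perm pE).
  rewrite (_ : 4 * k.+1 = (4 * k + 3).+1); last by lia.
  apply: decomp_cat; first exact: IHc.
  have pE2 : perm_eq (tedges (hole u C) t2 ++ (hole u C, v) :: tedges v t1)
     ((hole u C, v) :: tedges v t1 ++ tedges (hole u C) t2).
    by rewrite perm_catC.
  apply: (decomp_perm pE2).
  rewrite addn3; apply: (@decomp_cat _ _ _ (hole u C)).
    by apply: (@decomp_leq (4 * k)); [lia | apply: IHt; rewrite // inE eqxx].
  rewrite -(cat1s (_, v)); apply: (@decomp_cat _ _ _ v).
    by apply: decomp_edge; rewrite !inE eqxx.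
  by apply: (@decomp_leq (4 * k)); [lia | apply: IHt; rewrite // !inE ?eqxx ?wS ?orbT].
split=> // C u S sz uS; have [lo|hi] := leqP (2 ^ k) (csize C); last first.
  by apply: (@decomp_leq (4 * k + 3)); [lia | apply: IHc].
have [|C1 [[[b v] t] [C2 [-> h1 h2 h3]]]] := @context_split k C; first by rewrite lo.
rewrite cedges_cat hole_cat (_ : 4 * k.+1 + 3 = (4 * k + 6).+1); last by lia.
apply: (@decomp_cat _ _ _ (hole u C1)).
  by apply: (@decomp_leq (4 * k + 3)); [lia | apply: IHc].
set y := hole u C1; rewrite (_ : 4 * k + 6 = (4 * k + 4).+2); last by lia.
case: b h3 => h3; rewrite [hole y _]/= [cedges y _]/=.
  apply: (@decomp_perm _ _ _ (tedges y t ++ ((y, v) :: cedges v C2))).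
    exact/permPl/(perm_catCA _ [:: _]).
  apply: (@decomp_cat _ _ _ y).
    apply: decompS; rewrite -[_ + 4]/(4 * k + 4 * 1) -mulnDr addn1.
    by apply: Ht; rewrite // inE eqxx.
  rewrite -(cat1s (_, v)); apply: (@decomp_cat _ _ _ v).
    by apply: decomp_edge; rewrite !inE eqxx.
  by apply: (@decomp_leq (4 * k + 3)); [lia | apply: IHc; rewrite // inE eqxx].
rewrite -cat_cons; apply: (@decomp_cat _ _ _ y).
  rewrite -(cat1s (_, v)); apply: (@decomp_cat _ _ _ v).
    by apply: decomp_edge; rewrite !inE eqxx.
  rewrite -[_ + 4]/(4 * k + 4 * 1) -mulnDr addn1.
  by apply: Ht; rewrite // !inE eqxx ?orbT.
by apply: (@decomp_leq (4 * k + 3)); [lia | apply: IHc; rewrite // inE eqxx].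
Qed.

(** The top levels of a decomposition, flattened into [j] consecutive pieces of depth [k]; each
    piece may start from the vertices that the earlier ones handed over. *)
Fixpoint chain (k j : nat) (S : seq V) (w : V) (F : seq (V * V)) : Prop :=
  if j is j'.+1 then
    exists w1 F1 F2, [/\ perm_eq F (F1 ++ F2), decomp k S w1 F1
      & chain k j' (w1 :: S) w F2]
  else F = [::] /\ w \in S.

Lemma chain_sub k j S S' w F : {subset S <= S'} -> chain k j S w F ->
  chain k j S' w F.
Proof.
elim: j S S' w F => [|j IH] S S' w F sub /=; first by case=> -> /sub.
case=> w1 [F1 [F2 [pF d1 d2]]]; exists w1, F1, F2; split=> //.
  exact: decomp_sub d1.
by apply: IH d2 => x; rewrite !inE => /orP[->//|/sub->]; rewrite orbT.
Qed.

Lemma chain_cat k j j' S w w1 F F1 F2 : perm_eq F (F1 ++ F2) ->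
  chain k j S w1 F1 -> chain k j' (w1 :: S) w F2 -> chain k (j + j') S w F.
Proof.
elim: j S w1 F F1 => [|j IH] S w1 F F1 pF /=.
  case=> F10 w1S c2; subst F1; rewrite add0n.
  have c2' : chain k j' S w F2.
    by apply: chain_sub c2 => x; rewrite inE => /orP[/eqP->|].
  case: j' {c2} c2' => [|j'] /= => [[F20 wS]|[w2 [F3 [F4 [pF2 d3 d4]]]]].
    by subst F2; split=> //; apply/perm_nilP.
  by exists w2, F3, F4; split=> //; apply: perm_trans pF2.
case=> w2 [F3 [F4 [pF1 d3 d4]]] c2.
exists w2, F3, (F4 ++ F2); split=> //.
  by apply: (perm_trans pF); rewrite catA perm_cat2r.
apply: IH d4 _ => //; apply: chain_sub c2 => x.
by rewrite !inE => /orP[->//|->]; rewrite !orbT.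
Qed.

Lemma decomp_chain h k S w F : decomp (h + k) S w F -> chain k (2 ^ h) S w F.
Proof.
elim: h S w F => [|h IH] S w F.
  by move=> d; exists w, F, [::]; rewrite cats0; split=> //; split; rewrite ?inE ?eqxx.
rewrite addSn => -[w1 [F1 [F2 [pF d1 d2]]]].
by rewrite expnS mul2n -addnn; apply: (chain_cat pF); apply: IH; eassumption.
Qed.

End Trees.
Arguments Nil {V}.

(** * Spanning arborescence of the vertices reachable from the root *)

Section SpanningTree.
Variable V : finType.

(** As long as an edge of [F] leaves the tree, it is added; the vertices of a tree that no edge
    leaves are closed under reachability. The induction is on the number of vertices not yet
    used. *)
Lemma spanning_tree (rho : V) (F : {set V * V}) :
  exists t : tree V,
    [/\ uniq (rho :: map snd (tedges rho t)),
        {subset tedges rho t <= F}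
      & forall v, connect [rel x y | (x, y) \in F] rho v ->
          v \in rho :: map snd (tedges rho t)].
Proof.
pose good k := exists t : tree V, [/\ uniq (rho :: map snd (tedges rho t)),
  {subset tedges rho t <= F} & tsize t = k].
have good_lt k : good k -> k < #|V|.
  case=> t [u _ <-]; rewrite -(size_tedges rho) -(size_map snd).
  by rewrite -[_.+1]/(size (rho :: _)) -(card_uniqP u) max_card.
suff H d k : #|V| - k <= d -> good k -> exists t : tree V,
    [/\ uniq (rho :: map snd (tedges rho t)),
        {subset tedges rho t <= F}
      & forall v, connect [rel x y | (x, y) \in F] rho v ->
          v \in rho :: map snd (tedges rho t)] by apply: (H #|V| 0);
  [rewrite leq_subr | exists Nil].
elim: d k => [|d IH] k kd gk.
  by have := good_lt _ gk; rewrite -subn_gt0 ltnNge kd.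
have [t [ut st sz]] := gk; set A := rho :: _ in ut *.
have [/exists_inP[e eF /andP[e1 e2]]|no] :=
  boolP [exists e in F, (e.1 \in A) && (e.2 \notin A)].
  have [t' pt'] := tree_insert e.2 e1.
  apply: (IH k.+1); first by have := good_lt _ gk; lia.
  exists t'; split; last by rewrite -sz -!(size_tedges rho) (perm_size pt').
    have pA : perm_eq (rho :: map snd (tedges rho t')) (e.2 :: A).
      by apply: perm_cons_swap; exact: (perm_map snd pt').
    by rewrite (perm_uniq pA) /= e2.
  move=> x; rewrite (perm_mem pt') inE => /orP[/eqP->|/st//].
  by case: e eF {e1 e2 pt'}.
exists t; split=> // v /connectP[p pth ->].
have clos x y : x \in A -> (x, y) \in F -> y \in A.
  move=> xA xyF; apply: contraNT no => yA.
  by apply/exists_inP; exists (x, y); rewrite //= xA.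
suff H x : path [rel x y | (x, y) \in F] x p -> x \in A -> last x p \in A.
  by apply: H pth _; rewrite inE eqxx.
elim: p x {pth} => [|y p IHp] x //= /andP[xy pth] xA.
by apply: IHp pth _; apply: clos xy.
Qed.

End SpanningTree.

(** * Recursive greedy search *)

Section RecursiveGreedy.
Variables (V : finType) (rho : V) (es : seq (V * V)) (ce : V * V -> nat).
Variable T : {set V}.

(* The vertices reached so far and the edges bought for that. *)
Definition gstate := ({set V} * {set V * V})%type.
Implicit Types s : gstate.

(* Reaching the target [w] counts more than any number of terminals. *)
Definition gvalue (w : V) s := #|s.1 :&: T| + (w \in s.1) * #|V|.+1.

(** When [w] is missing, any affordable edge into it may be chosen, which leaves the tie-breaking of
    the program open; doing nothing is allowed only if there is none. *)
Definition attach (w : V) (b : nat) s s' : Prop :=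
  if w \in s.1 then s' = s else
  (exists e, [/\ e \in es, e.2 = w, e.1 \in s.1, ce e <= b
     & s' = (w |: s.1, e |: s.2)%SET]) \/
  (s' = s /\ forall e, e \in es -> e.2 = w -> e.1 \in s.1 -> ~~ (ce e <= b)).

(* The outcomes of the recursive greedy search of depth [k] that extends [s] at
   cost at most [b], with target [w]. *)
Fixpoint greedy (k : nat) (w : V) (b : nat) s s' : Prop :=
  if k is k'.+1 then
    [/\ s' = s \/ exists w1 b1 s1, [/\ b1 <= b, greedy k' w1 b1 s s1
                    & greedy k' w (b - b1) s1 s'],
        gvalue w s <= gvalue w s'
      & forall w1 b1, b1 <= b -> exists s1 s2,
          [/\ greedy k' w1 b1 s s1, greedy k' w (b - b1) s1 s2
            & gvalue w s2 <= gvalue w s']]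
  else attach w b s s'.

Lemma gvalue_leq w s s' : w \in s.1 -> gvalue w s <= gvalue w s' ->
  w \in s'.1 /\ #|s.1 :&: T| <= #|s'.1 :&: T|.
Proof.
rewrite /gvalue => ->; rewrite mul1n; case: (w \in s'.1) => /=.
  by rewrite mul1n leq_add2r.
by have := max_card (mem (s'.1 :&: T)); rewrite cardE -cardE /=; lia.
Qed.

Lemma greedy_mono k w b s s' : greedy k w b s s' -> s.1 \subset s'.1.
Proof.
elim: k w b s s' => [|k IH] w b s s' /=.
  rewrite /attach; case: ifP => _; first by move->.
  by case=> [[e [_ _ _ _ ->]]|[-> _]]//; apply: finset.subsetUr.
case=> -[->//|[w1 [b1 [s1 [_ g1 g2]]]]] _ _.
exact: fintype.subset_trans (IH _ _ _ _ g1) (IH _ _ _ _ g2).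
Qed.

(** The bound on single edges makes rounded costs meaningful: they are cut off just above the
    budget, so that a cost within the budget has not been cut off. *)
Definition sound B s :=
  [/\ rho \in s.1,
      forall v, v \in s.1 -> connect [rel x y | (x, y) \in s.2] rho v
    & forall e, e \in s.2 -> e \in es /\ ce e <= B].

Lemma greedy_sound B k w b s s' : b <= B -> greedy k w b s s' ->
  sound B s -> sound B s'.
Proof.
elim: k w b s s' => [|k IH] w b s s' bB /=; last first.
  case=> -[->//|[w1 [b1 [s1 [b1b g1 g2]]]]] _ _ ss.
  apply: (IH _ _ _ _ _ g2); first by lia.
  by apply: (IH _ _ _ _ _ g1 ss); lia.
rewrite /attach; case: ifP => _; first by move->.
case=> [[e [ein <- e1 eb ->]]|[-> _]]// [sr sc se]; split=> /=.
- by rewrite inE sr orbT.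
- have sub x y : connect [rel x y | (x, y) \in s.2] x y ->
      connect [rel x y | (x, y) \in e |: s.2] x y.
    by apply: connect_sub => a c /= ac; apply: connect1; rewrite /= inE ac orbT.
  move=> v; rewrite !inE => /orP[/eqP->|/sc/sub//].
  apply: connect_trans (sub _ _ (sc _ e1)) (connect1 _).
  by rewrite /= !inE -surjective_pairing eqxx.
- move=> e'; rewrite !inE => /orP[/eqP->|/se//].
  by split=> //; apply: leq_trans bB.
Qed.

Lemma greedy_cost k w b s s' : greedy k w b s s' ->
  \sum_(e in s'.2) ce e <= \sum_(e in s.2) ce e + b.
Proof.
elim: k w b s s' => [|k IH] w b s s' /=; last first.
  case=> -[->//|[w1 [b1 [s1 [b1b g1 g2]]]]] _ _; first by rewrite leq_addr.
  apply: leq_trans (IH _ _ _ _ g2) _; rewrite -(subnKC b1b) addKn addnA leq_add2r.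
  exact: IH g1.
rewrite /attach; case: ifP => _; first by move->; rewrite leq_addr.
case=> [[e [ein _ e1 eb ->]]|[-> _]]/=; last by rewrite leq_addr.
rewrite addnC; have [es2|es2] := boolP (e \in s.2).
  by rewrite (finset.setUidPr _) ?finset.sub1set// leq_addl.
by rewrite big_setU1 //= leq_add2r.
Qed.

Definition pcost (F : seq (V * V)) := \sum_(e <- F) ce e.
Definition heads (F : seq (V * V)) : {set V} := [set v in map snd F].

(** The step from [s] to [s'] collects at least [1 / c] times as many terminals as [F] has outside
    [s], written without subtraction. *)
Definition gains c w F s s' := w \in s'.1 /\
  #|(heads F :&: T) :\: s.1| + c * #|s.1 :&: T| <= c * #|s'.1 :&: T|.

Lemma heads0 : heads [::] = finset.set0.
Proof. by apply/setP => v; rewrite !inE. Qed.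

Lemma greedy_nil k w b s s' c : w \in s.1 -> greedy k w b s s' -> gains c w [::] s s'.
Proof.
move=> ws g; have m := greedy_mono g; split.
  exact: (fintype.subsetP m).
by rewrite heads0 finset.set0I finset.set0D finset.cards0 leq_mul2l subset_leq_card ?orbT// finset.setSI.
Qed.

Lemma gains_leq c w F s s1 s2 : gains c w F s s1 -> gvalue w s1 <= gvalue w s2 ->
  gains c w F s s2.
Proof.
case=> ws1 le /(gvalue_leq ws1)[ws2 le2]; split=> //.
by apply: leq_trans le _; rewrite leq_mul2l le2 orbT.
Qed.

(** A deeper search does no worse on a single edge: among its attempts is the pair [(w, b)], whose
    first half reaches [w] already, and the second half loses nothing. *)
Lemma greedy_edge k (S : seq V) w (F : seq (V * V)) b s s' : {subset S <= s.1} -> {subset F <= es} ->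
  decomp 0 S w F -> pcost F <= b -> greedy k w b s s' -> gains 1 w F s s'.
Proof.
move=> Ss Fe /= [[-> wS] _|[u uS FE]]; first exact/greedy_nil/Ss.
subst F.
rewrite /pcost big_seq1 => cb.
elim: k b s s' Ss cb => [|k IH] b s s' Ss cb /=; last first.
  case=> _ _ /(_ w b (leqnn b)) [s1 [s2 [g1 g2 v2]]].
  have [ws1 h1] := IH _ _ _ Ss cb g1.
  apply: gains_leq v2; have [ws2 h2] := greedy_nil 1 ws1 g2; split=> //.
  by apply: leq_trans h1 _; move: h2; rewrite heads0 finset.set0I finset.set0D finset.cards0.
have hE : heads [:: (u, w)] = [set w]%SET by apply/setP => v; rewrite !inE.
rewrite /attach /gains hE; case: ifP => ws.
  move->; split=> //; rewrite (_ : _ :\: _ = finset.set0) ?finset.cards0// .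
  by apply/setP => v; rewrite !inE; case: eqP => [->|]; rewrite ?ws ?andbF.
case=> [[e [_ _ _ _ ->]]|[_ /(_ (u, w))]] /=.
  split; first by rewrite !inE eqxx.
  rewrite !mul1n -cardsUI [X in _ + X](_ : _ = 0) ?addn0; last first.
    by apply/eqP; rewrite cards_eq0; apply/eqP/setP => v; rewrite !inE;
    case: (v \in s.1); rewrite /= ?andbF.
  apply: subset_leq_card; apply/fintype.subsetP => v; rewrite !inE.
  by case: (v \in s.1); case: (v == w); case: (v \in T).
have uwe : (u, w) \in es by apply: Fe; rewrite inE.
by move=> /(_ uwe erefl (Ss _ uS)); rewrite cb.
Qed.

Lemma pcost_perm F F1 F2 : perm_eq F (F1 ++ F2) -> pcost F = pcost F1 + pcost F2.
Proof. by move=> p; rewrite /pcost (perm_big _ p) big_cat. Qed.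

Lemma heads_perm F F1 F2 : perm_eq F (F1 ++ F2) -> heads F = heads F1 :|: heads F2.
Proof.
move=> p; apply/setP => v.
by rewrite !inE (perm_mem (perm_map snd p)) map_cat mem_cat.
Qed.

(* The first recursive call, on one piece, loses one more unit of the ratio
   than the piece itself; the second call, on the remaining pieces, loses
   nothing. Hence the ratio is the nesting depth of pieces and not the depth of
   the recursion. *)
Lemma greedy_guarantee h i k (S : seq V) w (F : seq (V * V)) b s s' : i * 2 ^ h <= k ->
  {subset S <= s.1} -> {subset F <= es} -> decomp (h * i) S w F -> pcost F <= b ->
  greedy k w b s s' -> gains i.+1 w F s s'.
Proof.
elim: i k S w F b s s' => [|i IHi] k S w F b s s'.
  by rewrite muln0 => _; apply: greedy_edge.
(* Each of the [j] pieces left takes one level of the search, on top of the [i * 2 ^ h] levels for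
   the inside of a piece. *)
suff H j : i * 2 ^ h + j <= k -> {subset S <= s.1} -> {subset F <= es} ->
    chain (h * i) j S w F -> pcost F <= b -> greedy k w b s s' ->
    gains i.+2 w F s s'.
  by rewrite mulnS mulSn addnC => kle Ss Fe /decomp_chain; apply: H.
elim: j k S F b s s' => [|j IHj] k S F b s s' kle Ss Fe /=.
  by case=> -> wS _; apply/greedy_nil/Ss.
case=> w1 [F1 [F2 [pF d1 d2]]]; rewrite (pcost_perm pF) => cb.
case: k kle => [|k] kle; first by rewrite addnS in kle.
have sub1 : {subset F1 <= es}.
  by move=> x x1; apply: Fe; rewrite (perm_mem pF) mem_cat x1.
have sub2 : {subset F2 <= es}.
  by move=> x x2; apply: Fe; rewrite (perm_mem pF) mem_cat x2 orbT.
(* Among the attempts is the vertex that the first piece hands over, with the exact cost of that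
   piece as budget. *)
case=> _ _ /(_ w1 (pcost F1)) [|s1 [s2 [g1 g2 v2]]]; first by lia.
apply: gains_leq v2.
have [w1s h1] : gains i.+1 w1 F1 s s1.
  by apply: (IHi k S w1 F1 _ s s1 _ Ss sub1 d1 (leqnn _) g1); lia.
have m1 := greedy_mono g1.
have [ws2 h2] : gains i.+2 w F2 s1 s2.
  apply: (IHj k (w1 :: S) F2 _ s1 s2 _ _ sub2 d2 _ g2); [by lia | | by lia].
  by move=> x; rewrite inE => /orP[/eqP->//|/Ss]; apply: (fintype.subsetP m1).
split=> //; rewrite (heads_perm pF).
(* Terminals of [F2] that [s] misses and [s1] has were gained by the first call: that gain is
   counted once more here, which is the additional unit of the ratio. *)
have : #|(heads F1 :|: heads F2) :&: T :\: s.1| + #|s.1 :&: T| <=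
   #|heads F1 :&: T :\: s.1| + #|heads F2 :&: T :\: s1.1| + #|s1.1 :&: T|.
  set X := _ :&: T :\: s.1; set Y := heads F1 :&: _ :\: _.
  set Z := heads F2 :&: _ :\: _.
  have sX : X \subset Y :|: (Z :|: (s1.1 :&: T :\: s.1)).
    apply/fintype.subsetP => v; rewrite !inE.
    by do 5?case: (_ \in _).
  have := subset_leq_card sX.
  have := finset.cardsU Y (Z :|: (s1.1 :&: T :\: s.1)); have := finset.cardsU Z (s1.1 :&: T :\: s.1).
  have : #|s1.1 :&: T :\: s.1| + #|s.1 :&: T| = #|s1.1 :&: T|.
    rewrite -[RHS](cardsID s.1) addnC; congr (_ + _).
    apply: eq_card => v; rewrite !inE; case: (boolP (v \in s.1)); rewrite ?andbF//.
    by move/(fintype.subsetP m1)->; rewrite andbT.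
  by lia.
by move: h1 h2; rewrite !mulSn; lia.
Qed.

Fixpoint rounds (k : nat) (B r : nat) s s' : Prop :=
  if r is r'.+1 then exists2 s1, rounds k B r' s s1 & greedy k rho B s1 s'
  else s' = s.

Lemma rounds_cat k B r1 r2 s s' : rounds k B (r1 + r2) s s' ->
  exists2 s1, rounds k B r1 s s1 & rounds k B r2 s1 s'.
Proof.
elim: r2 s' => [|r2 IH] s'; first by rewrite addn0; exists s'.
by rewrite addnS => -[s2 /IH[s1 ? ?] ?]; exists s1 => //; exists s2.
Qed.

Lemma rounds_mono k B r s s' : rounds k B r s s' -> s.1 \subset s'.1.
Proof.
elim: r s' => [|r IH] s' /=; first by move->.
by case=> s1 /IH h /greedy_mono; apply: fintype.subset_trans.
Qed.

Lemma rounds_sound k B r s s' : rounds k B r s s' -> sound B s -> sound B s'.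
Proof.
elim: r s' => [|r IH] s' /=; first by move->.
by case=> s1 /IH h g /h; apply: greedy_sound g.
Qed.

Lemma rounds_cost k B r s s' : rounds k B r s s' ->
  \sum_(e in s'.2) ce e <= \sum_(e in s.2) ce e + r * B.
Proof.
elim: r s' => [|r IH] s' /=; first by move->; rewrite leq_addr.
case=> s1 /IH h /greedy_cost/leq_trans; apply.
by rewrite mulSn addnCA addnC leq_add2l.
Qed.

(** * Repeating the search until all terminals are reached *)

Section Cover.
Variables (h D L B : nat) (t : tree V).
Hypothesis tE : {subset tedges rho t <= es}.
Hypothesis tB : pcost (tedges rho t) <= B.
Hypothesis tT : T \subset rho |: heads (tedges rho t).
Hypothesis tsz : tsize t < 2 ^ L.
Hypothesis LD : 4 * L <= h * D.

Lemma greedy_progress s s' : rho \in s.1 -> greedy (D * 2 ^ h) rho B s s' ->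
  #|T :\: s.1| + D.+1 * #|T :\: s'.1| <= D.+1 * #|T :\: s.1|.
Proof.
move=> rs g.
have d : decomp (h * D) [:: rho] rho (tedges rho t).
  by apply: (decomp_leq LD); apply: (decomp_balanced _ L).1; rewrite ?inE ?eqxx.
have [|_] := greedy_guarantee (leqnn _) _ tE d tB g.
  by move=> x; rewrite inE => /eqP->.
have -> : heads (tedges rho t) :&: T :\: s.1 = T :\: s.1.
  apply/setP => v; rewrite !inE; case: (boolP (v \in s.1)) => //= vs.
  case: (boolP (v \in T)) => vT; rewrite ?andbF// andbT.
  move/fintype.subsetP: tT => /(_ v vT); rewrite !inE => /orP[/eqP vr|//].
  by rewrite vr rs in vs.
have := cardsID s.1 T; have := cardsID s'.1 T; rewrite !(finset.setIC T) => <- e.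
have : D.+1 * (#|s'.1 :&: T| + #|T :\: s'.1|) = D.+1 * (#|s.1 :&: T| + #|T :\: s.1|).
  by rewrite e.
by rewrite !mulnDr; lia.
Qed.

(** Each of the [D.+1] rounds reaches at least a share [1 / D.+1] of the terminals that are still
    missing at the very end. *)
Lemma rounds_halve s s' : rho \in s.1 -> rounds (D * 2 ^ h) B D.+1 s s' ->
  2 * #|T :\: s'.1| <= #|T :\: s.1|.
Proof.
move=> rs rd.
suff H r s1 s2 : r <= D.+1 -> rho \in s1.1 -> rounds (D * 2 ^ h) B r s1 s2 ->
    r * #|T :\: s2.1| + D.+1 * #|T :\: s2.1| <= D.+1 * #|T :\: s1.1|.
  have := H _ _ _ (leqnn _) rs rd.
  by rewrite addnn -muln2 -mulnA leq_pmul2l// mulnC.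
elim: r s2 => [|r IH] s2 rD rs1 /=; first by move->.
case=> s3 r13 g23; have := IH s3 (ltnW rD) rs1 r13.
have rs3 := fintype.subsetP (rounds_mono r13) _ rs1.
have := greedy_progress rs3 g23.
have : #|T :\: s2.1| <= #|T :\: s3.1|.
  by apply: subset_leq_card; apply: finset.setDS; apply: greedy_mono g23.
by rewrite mulSn => le; have := leq_mul (leqnn r) le; lia.
Qed.

Lemma rounds_cover s s' : #|V| < 2 ^ L -> rho \in s.1 ->
  rounds (D * 2 ^ h) B (L * D.+1) s s' -> T \subset s'.1.
Proof.
move=> VL rs rd.
suff H r s2 : rounds (D * 2 ^ h) B (r * D.+1) s s2 ->
    2 ^ r * #|T :\: s2.1| <= #|T :\: s.1|.
  have := H _ _ rd; rewrite -finset.setD_eq0 -cards_eq0.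
  case: #|T :\: s'.1| => // u le; have := leq_trans le (max_card _).
  by rewrite leqNgt (leq_trans VL) // leq_pmulr.
elim: r s2 {rd s'} => [|r IH] s2; first by move=> /= ->; rewrite mul1n.
rewrite mulSn addnC => /rounds_cat[s1 r1 r2].
have := rounds_halve (fintype.subsetP (rounds_mono r1) _ rs) r2.
move=> le; apply: leq_trans (IH _ r1).
by rewrite expnSr -mulnA leq_pmul2l ?expn_gt0.
Qed.

End Cover.
End RecursiveGreedy.

Local Open Scope nat_scope.

(** * Programs with bounded loops *)

(* Programs without unbounded loops: [LFor i e p] runs [p] for as many rounds
   as the value of [e] at the start, counting in entry 0 of array [i]. *)
Inductive lp :=
| LSkip
| LN of nat & nexp & nexp
| LR of nat & nexp & rexp
| LMark of nexp
| LTransmit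
| LAlarm of rexp
| LSeq of lp & lp
| LIf of bexp & lp & lp
| LFor of nat & nexp & lp.

Definition vN (a : nat) := NGet a (NLit 0).
Definition vR (a : nat) := RGet a (NLit 0).

Fixpoint compile (p : lp) : cmd :=
  match p with
  | LSkip => CSkip
  | LN a i e => CNSet a i e
  | LR a i e => CRSet a i e
  | LMark e => CMark e
  | LTransmit => CTransmit
  | LAlarm e => CAlarm e
  | LSeq p q => CSeq (compile p) (compile q)
  | LIf b p q => CIf b (compile p) (compile q)
  | LFor i e p => CSeq (CNSet i (NLit 0) (NLit 0))
      (CWhile (BNot (BNLe e (vN i)))
         (CSeq (compile p) (CNSet i (NLit 0) (NAdd (vN i) (NLit 1)))))
  end.

Fixpoint reads (e : nexp) : seq nat :=
  match e with
  | NLit _ => [::]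
  | NGet a i => a :: reads i
  | NAdd e1 e2 | NSub e1 e2 => reads e1 ++ reads e2
  end.

Fixpoint readsR (e : rexp) : seq nat :=
  match e with
  | ROfNat e => reads e
  | RGet _ i => reads i
  | RAdd e1 e2 | RSub e1 e2 | RMul e1 e2 | RDiv e1 e2 => readsR e1 ++ readsR e2
  end.

Fixpoint readsB (b : bexp) : seq nat :=
  match b with
  | BNLe e1 e2 => reads e1 ++ reads e2
  | BRLe e1 e2 => readsR e1 ++ readsR e2
  | BNot b => readsB b
  end.

Fixpoint readsP (p : lp) : seq nat :=
  match p with
  | LSkip | LTransmit => [::]
  | LN _ i e => reads i ++ reads e
  | LR _ i e => reads i ++ readsR e
  | LMark e => reads e
  | LAlarm e => readsR e
  | LSeq p q => readsP p ++ readsP q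
  | LIf b p q => readsB b ++ readsP p ++ readsP q
  | LFor i e p => i :: reads e ++ readsP p
  end.

Fixpoint writesN (p : lp) : seq nat :=
  match p with
  | LN a _ _ => [:: a]
  | LSeq p q | LIf _ p q => writesN p ++ writesN q
  | LFor i _ p => i :: writesN p
  | _ => [::]
  end.

Fixpoint writesR (p : lp) : seq nat :=
  match p with
  | LR a _ _ => [:: a]
  | LSeq p q | LIf _ p q => writesR p ++ writesR q
  | LFor _ _ p => writesR p
  | _ => [::]
  end.

Fixpoint pure (p : lp) : bool :=
  match p with
  | LMark _ | LTransmit | LAlarm _ => false
  | LSeq p q | LIf _ p q => pure p && pure q
  | LFor _ _ p => pure p
  | _ => true
  end.

(** The compiled [CWhile] evaluates the bound anew in every round; a body that touches neither the
    counter nor the arrays read by the bound makes it run as often as announced. *)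
Fixpoint loops_ok (p : lp) : bool :=
  match p with
  | LSeq p q | LIf _ p q => loops_ok p && loops_ok q
  | LFor i e p => [&& i \notin writesN p,
      all [pred a | (a != i) && (a \notin writesN p)] (reads e) & loops_ok p]
  | _ => true
  end.

Fixpoint bounds (p : lp) : seq nexp :=
  match p with
  | LSeq p q | LIf _ p q => bounds p ++ bounds q
  | LFor _ e p => e :: bounds p
  | _ => [::]
  end.

Fixpoint lsize (p : lp) : nat :=
  match p with
  | LSeq p q | LIf _ p q => (lsize p + lsize q).+1
  | LFor _ _ p => (lsize p).+4.+2
  | _ => 1
  end.

Fixpoint depth (p : lp) : nat :=
  match p with
  | LSeq p q | LIf _ p q => maxn (depth p) (depth q)
  | LFor _ _ p => (depth p).+1
  | _ => 0
  end.

(** * Denotational semantics, step counts and their link to the machine *)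

Section Den.
Variables (R : realType) (G : network R).
Implicit Types (c : config G) (p q : lp).

Definition setN (a i v : nat) c := set_nmem (update (nmem c) a i v) c.
Definition setR (a i : nat) (v : R) c := set_rmem (update (rmem c) a i v) c.
Definition bump (i : nat) c := setN i 0 (nmem c i 0 + 1) c.

Fixpoint den p c : config G :=
  match p with
  | LSkip => c
  | LN a i e => setN a (neval c i) (neval c e) c
  | LR a i e => setR a (neval c i) (reval c e) c
  | LMark e => if onth (edges G) (neval c e) is Some e'
               then set_marked (e' |: marked c)%SET c else c
  | LTransmit => set_marked finset.set0
      (set_sent (rcons (sent c) (now c, marked c)) c)
  | LAlarm e => set_alarm (Some (reval c e)) c
  | LSeq p q => den q (den p c)
  | LIf b p q => if beval c b then den p c else den q c
  | LFor i e p => iter (neval c e) (fun c' => bump i (den p c')) (setN i 0 0 c)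
  end.

(** A loop takes three steps outside its rounds (splitting the sequence, clearing the counter, the
    last test) and three per round besides the body (test, splitting, increment). *)
Fixpoint tm p c : nat :=
  match p with
  | LSeq p q => (tm p c + tm q (den p c)).+1
  | LIf b p q => (if beval c b then tm p c else tm q c).+1
  | LFor i e p => 3 + \sum_(j < neval c e)
      (3 + tm p (iter j (fun c' => bump i (den p c')) (setN i 0 0 c)))
  | _ => 1
  end.

Lemma den_seq p q c : den (LSeq p q) c = den q (den p c). Proof. by []. Qed.

Lemma den_if b p q c : den (LIf b p q) c = if beval c b then den p c else den q c.
Proof. by []. Qed.

Lemma evalE c : (forall k, neval c (NLit k) = k) *
  (forall a i, neval c (NGet a i) = nmem c a (neval c i)) *
  (forall a, neval c (vN a) = nmem c a 0) *
  (forall e1 e2, neval c (NAdd e1 e2) = neval c e1 + neval c e2) *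
  (forall e1 e2, neval c (NSub e1 e2) = neval c e1 - neval c e2) *
  (forall e, reval c (ROfNat e) = ((neval c e)%:R)%R) *
  (forall a i, reval c (RGet a i) = rmem c a (neval c i)) *
  (forall a, reval c (vR a) = rmem c a 0) *
  (forall e1 e2, reval c (RAdd e1 e2) = (reval c e1 + reval c e2)%R) *
  (forall e1 e2, reval c (RMul e1 e2) = (reval c e1 * reval c e2)%R) *
  (forall e1 e2, beval c (BNLe e1 e2) = (neval c e1 <= neval c e2)) *
  (forall e1 e2, beval c (BRLe e1 e2) = (reval c e1 <= reval c e2)%R) *
  (forall b, beval c (BNot b) = ~~ beval c b).
Proof. by []. Qed.

Lemma neval_reads c c' e :
  (forall a, a \in reads e -> nmem c a = nmem c' a) -> neval c e = neval c' e.
Proof.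
elim: e => [k|a i IH|e1 IH1 e2 IH2|e1 IH1 e2 IH2] //= H.
- by rewrite IH ?H ?inE ?eqxx// => b bi; apply: H; rewrite inE bi orbT.
- by rewrite IH1 ?IH2// => b bi; apply: H; rewrite mem_cat bi ?orbT.
- by rewrite IH1 ?IH2// => b bi; apply: H; rewrite mem_cat bi ?orbT.
Qed.

Lemma update_neq T (m : nat -> nat -> T) a i v b : b != a -> update m a i v b = m b.
Proof. by move=> ba; apply/funext => j; rewrite /update (negbTE ba). Qed.

Lemma nmem_den p c a : a \notin writesN p -> nmem (den p c) a = nmem c a.
Proof.
elim: p c => [|b i e|b i e|e||e|p IHp q IHq|b p IHp q IHq|i e p IHp] c //=.
- by rewrite inE => ab; rewrite update_neq.
- by move=> _; case: (onth _ _).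
- by rewrite mem_cat negb_or => /andP[ap aq]; rewrite IHq ?IHp.
- by rewrite mem_cat negb_or => /andP[ap aq]; case: ifP => _; rewrite ?IHq ?IHp.
- rewrite inE negb_or => /andP[ai ap].
  by elim: (neval c e) => [|k IH] /=; rewrite update_neq // IHp.
Qed.

Lemma rmem_den p c a : a \notin writesR p -> rmem (den p c) a = rmem c a.
Proof.
elim: p c => [|b i e|b i e|e||e|p IHp q IHq|b p IHp q IHq|i e p IHp] c //=.
- by rewrite inE => ab; rewrite update_neq.
- by move=> _; case: (onth _ _).
- by rewrite mem_cat negb_or => /andP[ap aq]; rewrite IHq ?IHp.
- by rewrite mem_cat negb_or => /andP[ap aq]; case: ifP => _; rewrite ?IHq ?IHp.
- by move=> ap; elim: (neval c e) => [|k IH] //=; rewrite IHp.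
Qed.

Definition clock c := (now c, upcoming c).

Lemma clock_den p c : clock (den p c) = clock c.
Proof.
elim: p c => [|b i e|b i e|e||e|p IHp q IHq|b p IHp q IHq|i e p IHp] c //=.
- by case: (onth _ _).
- by rewrite IHq IHp.
- by case: ifP.
- by elim: (neval c e) => [|k IH] //=; rewrite -IH -[RHS]IHp.
Qed.

Definition outputs c := (alarm c, marked c, sent c).

Lemma outputs_den p c : pure p -> outputs (den p c) = outputs c.
Proof.
elim: p c => [|b i e|b i e|e||e|p IHp q IHq|b p IHp q IHq|i e p IHp] c //=.
- by case/andP => pp pq; rewrite IHq ?IHp.
- by case/andP => pp pq; case: ifP => _; rewrite ?IHq ?IHp.
- by move=> pp; elim: (neval c e) => [|k IH] //=; rewrite -IH -[RHS]IHp.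
Qed.

Lemma neval_todo s c e : neval (set_todo s c) e = neval c e.
Proof. exact: neval_reads. Qed.

Lemma reval_todo s c e : reval (set_todo s c) e = reval c e.
Proof.
by elim: e => [e|a i|e1 IH1 e2 IH2|e1 IH1 e2 IH2|e1 IH1 e2 IH2|e1 IH1 e2 IH2] /=;
  rewrite ?IH1 ?IH2 ?neval_todo.
Qed.

Lemma beval_todo s c b : beval (set_todo s c) b = beval c b.
Proof. by elim: b => [e1 e2|e1 e2|b IH] /=; rewrite ?IH ?neval_todo ?reval_todo. Qed.

Lemma den_todo p s c : den p (set_todo s c) = set_todo s (den p c).
Proof.
elim: p c => [|b i e|b i e|e||e|p IHp q IHq|b p IHp q IHq|i e p IHp] c //=;
  rewrite ?neval_todo ?reval_todo ?beval_todo //.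
- by case: (onth _ _).
- by rewrite IHp IHq.
- by rewrite IHp IHq; case: ifP.
- by elim: (neval c e) => [|k IH] //=; rewrite IH IHp.
Qed.

Lemma iter_nmem p i a k c : a != i -> a \notin writesN p ->
  nmem (iter k (fun c' => bump i (den p c')) c) a = nmem c a.
Proof. by move=> ai ap; elim: k => [|k IH] //=; rewrite update_neq // nmem_den. Qed.

Lemma iter_counter p i k c : i \notin writesN p ->
  nmem (iter k (fun c' => bump i (den p c')) (setN i 0 0 c)) i 0 = k.
Proof.
move=> ip; elim: k => [|k IH] /=; first by rewrite /update !eqxx.
by rewrite /update !eqxx nmem_den // IH addn1.
Qed.

Lemma den_for (I : nat -> config G -> Prop) i e p c :
  i \notin writesN p -> I 0 (setN i 0 0 c) ->
  (forall j c', j < neval c e -> nmem c' i 0 = j ->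
    (forall a, a \notin i :: writesN p -> nmem c' a = nmem c a) ->
    (forall a, a \notin writesR p -> rmem c' a = rmem c a) ->
    I j c' -> I j.+1 (bump i (den p c'))) ->
  I (neval c e) (den (LFor i e p) c).
Proof.
move=> ip I0 IS; rewrite [den _ _]/(iter (neval c e) _ _).
have : neval c e <= neval c e by [].
elim: {1 3 4}(neval c e) => [|k IH] // kn; apply: IS => //.
- exact: iter_counter.
- move=> a; rewrite inE negb_or => /andP[ai ap].
  by rewrite iter_nmem //= update_neq.
- move=> a ap; elim: (k) => [|j IHj] //=.
  by rewrite rmem_den.
- by apply: IH; apply: ltnW.
Qed.

Lemma neval_setN a v c e : a \notin reads e -> neval (setN a 0 v c) e = neval c e.
Proof.
move=> ae; apply: neval_reads => b be; rewrite /= update_neq //.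
by apply: contraNneq ae => <-.
Qed.

Lemma reval_setN a v c e : a \notin readsR e -> reval (setN a 0 v c) e = reval c e.
Proof.
elim: e => [e|b i|e1 IH1 e2 IH2|e1 IH1 e2 IH2|e1 IH1 e2 IH2|e1 IH1 e2 IH2] /=.
1,2: by move=> ?; rewrite neval_setN.
all: by rewrite mem_cat negb_or => /andP[? ?]; rewrite IH1 // IH2.
Qed.

Lemma beval_setN a v c b : a \notin readsB b -> beval (setN a 0 v c) b = beval c b.
Proof.
elim: b => [e1 e2|e1 e2|b IH] /=; rewrite ?mem_cat ?negb_or.
- by case/andP => ? ?; rewrite !neval_setN.
- by case/andP => ? ?; rewrite !reval_setN.
- by move/IH->.
Qed.

Lemma setN_setN a i v b j w c : a != b ->
  setN a i v (setN b j w c) = setN b j w (setN a i v c).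
Proof.
move=> ab; rewrite /setN /set_nmem /=; congr Config.
apply/funext => x; apply/funext => y; rewrite /update.
by case: (eqVneq x a) => [->|xa] /=; rewrite ?(negbTE ab) //=; case: ifP.
Qed.

Lemma setN_idem a i v w c : setN a i v (setN a i w c) = setN a i v c.
Proof.
rewrite /setN /set_nmem /=; congr Config.
by apply/funext => x; apply/funext => y; rewrite /update; case: ifP => // ->.
Qed.

Lemma den_setN a v p c : a \notin writesN p -> a \notin readsP p ->
  den p (setN a 0 v c) = setN a 0 v (den p c).
Proof.
elim: p c => [|b i e|b i e|e||e|p IHp q IHq|b p IHp q IHq|i e p IHp] c //=.
- rewrite inE mem_cat negb_or => ab /andP[? ?].
  by rewrite !neval_setN // setN_setN // eq_sym.
- by rewrite mem_cat negb_or => _ /andP[? ?]; rewrite neval_setN // reval_setN.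
- by move=> _ ?; rewrite neval_setN //; case: (onth _ _).
- by move=> _ ?; rewrite reval_setN.
- by rewrite !mem_cat !negb_or => /andP[? ?] /andP[? ?]; rewrite IHp // IHq.
- rewrite !mem_cat !negb_or => /andP[? ?] /and3P[? ? ?].
  by rewrite beval_setN // IHp // IHq //; case: ifP.
rewrite !inE mem_cat !negb_or => /andP[ai ap] /and3P[_ ae ap'].
rewrite neval_setN //; elim: (neval c e) => [|k IH] /=.
  by rewrite setN_setN // eq_sym.
by rewrite IH IHp // /bump /= update_neq 1?eq_sym // setN_setN // eq_sym.
Qed.

(** Updates of a counter that the body ignores commute with the body, and only the last one remains.
    The search loop thus becomes a plain iteration of its step. *)
Lemma iter_bump i p k c : i \notin writesN p -> i \notin readsP p ->
  exists v, iter k (fun c' => bump i (den p c')) c = setN i 0 v (iter k (den p) c).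
Proof.
move=> wi ri; elim: k => [|k [v IH]] /=.
  exists (nmem c i 0); rewrite /setN /set_nmem; case: c => ? ? ? ? ? ? ? ? ? /=.
  congr Config; apply/funext => x; apply/funext => y; rewrite /update.
  by case: ifP => // /andP[/eqP-> /eqP->].
by rewrite IH den_setN // /bump setN_idem; eexists.
Qed.

Section Exec.
Variables (A : algorithm) (tape : nat -> bool).
Local Notation step := (@step R G A tape).

Lemma iter_trans t1 t2 (c1 c2 c3 : config G) : iter t1 step c1 = c2 ->
  iter t2 step c2 = c3 -> iter (t1 + t2) step c1 = c3.
Proof. by move=> <- <-; rewrite addnC iterD. Qed.

Lemma step_while b (q : cmd) s c : step (set_todo (CWhile b q :: s) c) =
  if beval c b then set_todo [:: q, CWhile b q & s] c else set_todo s c.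
Proof.
rewrite [LHS](_ : _ = if beval (set_todo s c) b
  then set_todo [:: q, CWhile b q & s] c else set_todo s c) //.
by rewrite beval_todo.
Qed.

(** Links programs to the step machine with an exact number of steps. No construct of [lp] flips a
    coin, so the equation holds for every tape. *)
Lemma exec_compile p s c : loops_ok p ->
  iter (tm p c) step (set_todo (compile p :: s) c) = set_todo s (den p c).
Proof.
elim: p s c => [|a i e|a i e|e||e|p IHp q IHq|b p IHp q IHq|i e p IHp] s c.
- by [].
- by rewrite /= /step /= !neval_todo.
- by rewrite /= /step /= !neval_todo !reval_todo.
- by rewrite /= /step /= !neval_todo; case: (onth _ _).
- by [].
- by rewrite /= /step /= !reval_todo.
- case/andP => pp pq; rewrite [tm _ _]/= -add1n.
  apply: (@iter_trans 1 _ _ (set_todo (compile p :: compile q :: s) c)) => //.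
  exact: (iter_trans (IHp _ _ pp) (IHq _ _ pq)).
- case/andP => pp pq; rewrite [tm _ _]/= -add1n.
  apply: (@iter_trans 1 _ _ _ _ erefl); rewrite /= /step /= !beval_todo.
  by case: ifP => _; [exact: IHp | exact: IHq].
case/and3P => ip /allP er pp; rewrite [tm _ _]/= [compile _]/=.
set W := CWhile _ _; set f := fun c' => _; set c0 := setN i 0 0 c.
set S := \sum_(_ < _) _; rewrite (_ : 3 + S = 1 + (1 + (S + 1))); last by lia.
apply: (@iter_trans 1 _ _ (set_todo [:: CNSet i (NLit 0) (NLit 0), W & s] c)) => //.
apply: (@iter_trans 1 _ _ (set_todo (W :: s) c0)) => //.
have test k : beval (iter k f c0) (BNot (BNLe e (vN i))) = (k < neval c e).
  rewrite /= -ltnNge iter_counter //; congr (_ < _); apply: neval_reads => a ae.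
  have /andP[ai ap] := er _ ae.
  by rewrite iter_nmem //= update_neq.
apply: (@iter_trans _ 1 _ (set_todo (W :: s) (iter (neval c e) f c0))); last first.
  by rewrite [LHS]step_while test ltnn.
suff H k : k <= neval c e -> iter (\sum_(j < k) (3 + tm p (iter j f c0))) step
    (set_todo (W :: s) c0) = set_todo (W :: s) (iter k f c0) by exact: H.
elim: k => [|k IH] kn; first by rewrite big_ord0.
rewrite big_ord_recr; apply: (iter_trans (IH (ltnW kn))); rewrite -/f.
set ck := iter k f c0.
rewrite (_ : 3 + tm p ck = 1 + (1 + (tm p ck + 1))); last by lia.
apply: (@iter_trans 1 _ _
  (set_todo [:: CSeq (compile p) (CNSet i (NLit 0) (NAdd (vN i) (NLit 1))), W & s] ck)).
  by rewrite [LHS]step_while test kn.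
apply: (@iter_trans 1 _ _
  (set_todo [:: compile p, CNSet i (NLit 0) (NAdd (vN i) (NLit 1)), W & s] ck)) => //.
exact: (iter_trans (IHp _ _ pp)).
Qed.

End Exec.

Fixpoint tbound (K : nat) (p : lp) : nat :=
  match p with
  | LSeq p q | LIf _ p q => (tbound K p + tbound K q).+1
  | LFor _ _ p => 3 + K * (3 + tbound K p)
  | _ => 1
  end.

(** No loop bound reads an array that the program writes, so the bounds keep their initial values
    wherever the loop sits, and [K] caps the rounds of every loop. *)
Lemma tm_tbound K p c : all (fun a => a \notin writesN p) (flatten (map reads (bounds p))) ->
  all (fun e => neval c e <= K) (bounds p) -> tm p c <= tbound K p.
Proof.
suff H (W : seq nat) q c' : {subset writesN q <= W} ->
    all (fun a => a \notin W) (flatten (map reads (bounds q))) ->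
    all (fun e => neval c e <= K) (bounds q) ->
    (forall a, a \notin W -> nmem c' a = nmem c a) -> tm q c' <= tbound K q.
  by move=> rW bK; apply: (H (writesN p)).
elim: q c' => [|a i e|a i e|e||e|q IHq r IHr|b q IHq r IHr|i e q IHq] c' //=;
  rewrite ?map_cat ?flatten_cat ?all_cat.
- move=> sW /andP[rq rr] /andP[bq br] nE; rewrite ltnS leq_add //.
    by apply: IHq => // a aq; apply: sW; rewrite mem_cat aq.
  apply: IHr => // a ap; first by apply: sW; rewrite mem_cat ap orbT.
  by rewrite nmem_den ?nE//; apply: contra ap => aq; apply: sW; rewrite mem_cat aq.
- move=> sW /andP[rq rr] /andP[bq br] nE.
  have q1 : tm q c' <= tbound K q.
    by apply: IHq => // a aq; apply: sW; rewrite mem_cat aq.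
  have r1 : tm r c' <= tbound K r.
    by apply: IHr => // a ap; apply: sW; rewrite mem_cat ap orbT.
  by case: ifP => _; lia.
move=> sW /andP[/allP re rq] /andP[eK bq] nE.
rewrite (@neval_reads _ c) => [|a ae]; last by apply: nE; apply: re.
rewrite leq_add2l; apply: (@leq_trans (\sum_(j < neval c e) (3 + tbound K q))).
  apply: leq_sum => j _; rewrite leq_add2l; apply: IHq => // [a aq|a ap].
    by apply: sW; rewrite inE aq orbT.
  have [ai aq] : a != i /\ a \notin writesN q.
    split; first by apply: contra ap => /eqP->; apply: sW; rewrite inE eqxx.
    by apply: contra ap => aq; apply: sW; rewrite inE aq orbT.
  by rewrite iter_nmem //= update_neq // nE.
by rewrite sum_nat_const card_ord leq_mul2r eK orbT.
Qed.

Lemma tbound_leq K p : tbound K p <= lsize p * K.+1 ^ depth p.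
Proof.
elim: p => [|a i e|a i e|e||e|q IHq r IHr|b q IHq r IHr|i e q IHq] //=.
1,2: rewrite mulSn mulnDl; set m := maxn _ _;
  have q1 : lsize q * K.+1 ^ depth q <= lsize q * K.+1 ^ m
    by [rewrite leq_mul2l leq_pexp2l ?leq_maxl ?orbT];
  have r1 : lsize r * K.+1 ^ depth r <= lsize r * K.+1 ^ m
    by [rewrite leq_mul2l leq_pexp2l ?leq_maxr ?orbT];
  have : 0 < K.+1 ^ m by [rewrite expn_gt0];
  by lia.
rewrite expnS; have : 0 < K.+1 ^ depth q by rewrite expn_gt0.
by move: (K.+1 ^ depth q) IHq => X; nia.
Qed.

End Den.

Arguments den : simpl never.


(** * The algorithm *)

(* Arrays of naturals. *)
Notation aVert := 10 (only parsing).   (* vertices of the requests *)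
Notation aPend := 11 (only parsing).   (* 1 for the pending requests *)
Notation aCnt := 12 (only parsing).    (* number of requests *)
Notation aNext := 13 (only parsing).   (* 1 + the pending request of least deadline *)
Notation aL := 20 (only parsing).
Notation aP2 := 21 (only parsing).
Notation aA := 22 (only parsing).
Notation aH := 23 (only parsing).
Notation aD := 24 (only parsing).
Notation aSum := 25 (only parsing).
Notation aKT := 26 (only parsing).
Notation aQ := 27 (only parsing).
Notation aBig := 28 (only parsing).
Notation aTmp := 29 (only parsing).
Notation aZ := 30 (only parsing).      (* heap: reached vertices *)
Notation aS := 31 (only parsing).      (* heap: bought edges *)
Notation aHP := 32 (only parsing).     (* first free heap address *)
Notation aCE := 33 (only parsing).     (* rounded edge costs *)
Notation aTerm := 34 (only parsing).   (* terminals *)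
Notation aVP := 35 (only parsing).
Notation aVW := 36 (only parsing).
Notation aVO := 37 (only parsing).
Notation aKP := 40 (only parsing).
Notation aPH := 41 (only parsing).
Notation aRet := 42 (only parsing).
Notation fW := 43 (only parsing).
Notation fB := 44 (only parsing).
Notation fS := 45 (only parsing).
Notation fW1 := 46 (only parsing).
Notation fB1 := 47 (only parsing).
Notation fBest := 48 (only parsing).
Notation fSt := 49 (only parsing).
Notation aState := 50 (only parsing).
Notation aOK := 51 (only parsing).
Notation aFE := 52 (only parsing).
Notation aV1 := 53 (only parsing).
Notation aFOK := 55 (only parsing).
Notation aFS := 56 (only parsing).
Notation aQOK := 57 (only parsing).
Notation aQS := 58 (only parsing).
(* Arrays of reals. *)
Notation rDl := 2 (only parsing).      (* deadlines of the requests *)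
Notation rLv := 3 (only parsing).      (* levels of the requests *)
Notation rX := 4 (only parsing).
Notation rFX := 5 (only parsing).
Notation rX2 := 6 (only parsing).
Notation rTh := 7 (only parsing).

Definition nN := NGet 0 (NLit 0).
Definition nRho := NGet 0 (NLit 1).
Definition nM := NGet 0 (NLit 2).
Definition BLt e1 e2 := BNot (BNLe e2 e1).
Definition When b p := LIf b p LSkip.
Definition WhenEq e1 e2 p := When (BNLe e1 e2) (When (BNLe e2 e1) p).
Definition Set0 a e := LN a (NLit 0) e.
Definition SetR0 a e := LR a (NLit 0) e.
Definition Incr a e := Set0 a (NAdd (vN a) e).
Fixpoint LSeqs (ps : seq lp) : lp :=
  match ps with [::] => LSkip | [:: p] => p | p :: ps' => LSeq p (LSeqs ps') end.

Definition valueP := LSeqs [::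
  Set0 aVO (NLit 0);
  LFor 60 nN (When (BNLe (NLit 1) (NGet aTerm (vN 60)))
     (Incr aVO (NGet aZ (NAdd (vN aVP) (vN 60)))));
  When (BNLe (NLit 1) (NGet aZ (NAdd (vN aVP) (vN aVW))))
     (Incr aVO (NAdd nN (NLit 1)))].

(** A state is an address [p]: its vertices are marked in [aZ] and its edges in [aS], from [p] on.
    It is only ever extended in a fresh copy and never freed, so that stack frames can share it. *)
Definition allocP := Incr aHP (NAdd nN nM).

Definition copyP := LSeq
  (LFor 63 nN (LN aZ (NAdd (vN aHP) (vN 63)) (NGet aZ (NAdd (vN aVP) (vN 63)))))
  (LFor 64 nM (LN aS (NAdd (vN aHP) (vN 64)) (NGet aS (NAdd (vN aVP) (vN 64))))).

(** [aFE] is one more than the number of an edge, 0 standing for none. *)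
Definition findP := LSeq (Set0 aFE (NLit 0))
  (LFor 62 nM (WhenEq (NGet 2 (vN 62)) (vN aVW)
    (When (BNLe (NLit 1) (NGet aZ (NAdd (vN aVP) (NGet 1 (vN 62)))))
      (When (BNLe (NGet aCE (vN 62)) (NGet fB (vN aKP)))
        (Set0 aFE (NAdd (vN 62) (NLit 1))))))).

(** Calling convention of the search: [aKP] is the remaining depth of the active frame, [aPH] is 0
    on entry and 1 on return, [aRet] is the returned state, and [fSt] tells which of its two
    subcalls a frame awaits. Returning increments [aKP]; a value above [aKT] means that the search
    is over. *)
Definition baseP := LSeqs [::
  Set0 aVP (NGet fS (vN aKP));
  Set0 aVW (NGet fW (vN aKP));
  Set0 aRet (vN aVP);
  LIf (BNLe (NLit 1) (NGet aZ (NAdd (vN aVP) (vN aVW)))) LSkip (LSeq findP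
    (When (BNLe (NLit 1) (vN aFE)) (LSeqs [::
       copyP;
       LN aZ (NAdd (vN aHP) (vN aVW)) (NLit 1);
       LN aS (NAdd (vN aHP) (NSub (vN aFE) (NLit 1))) (NLit 1);
       Set0 aRet (vN aHP);
       allocP])));
  Set0 aPH (NLit 1);
  Incr aKP (NLit 1)].

Definition below := NSub (vN aKP) (NLit 1).

Definition push1P := LSeqs [::
  LN fSt (vN aKP) (NLit 0);
  LN fW below (NGet fW1 (vN aKP));
  LN fB below (NGet fB1 (vN aKP));
  LN fS below (NGet fS (vN aKP));
  Set0 aKP below;
  Set0 aPH (NLit 0)].

Definition openP := LSeqs [::
  LN fW1 (vN aKP) (NLit 0);
  LN fB1 (vN aKP) (NLit 0);
  LN fBest (vN aKP) (NGet fS (vN aKP));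
  push1P].

Definition push2P := LSeqs [::
  LN fSt (vN aKP) (NLit 1);
  LN fW below (NGet fW (vN aKP));
  LN fB below (NSub (NGet fB (vN aKP)) (NGet fB1 (vN aKP)));
  LN fS below (vN aRet);
  Set0 aKP below;
  Set0 aPH (NLit 0)].

Definition compareP := LSeqs [::
  Set0 aVW (NGet fW (vN aKP));
  Set0 aVP (NGet fBest (vN aKP));
  valueP;
  Set0 aV1 (vN aVO);
  Set0 aVP (vN aRet);
  valueP;
  When (BLt (vN aV1) (vN aVO)) (LN fBest (vN aKP) (vN aRet))].

Definition nextP := LSeq
  (LN fB1 (vN aKP) (NAdd (NGet fB1 (vN aKP)) (NLit 1)))
  (LIf (BNLe (NGet fB1 (vN aKP)) (NGet fB (vN aKP))) push1P (LSeqs [::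
     LN fB1 (vN aKP) (NLit 0);
     LN fW1 (vN aKP) (NAdd (NGet fW1 (vN aKP)) (NLit 1));
     LIf (BLt (NGet fW1 (vN aKP)) nN) push1P (LSeq
       (Set0 aRet (NGet fBest (vN aKP)))
       (Incr aKP (NLit 1)))])).

(* One step of the recursive greedy search.  The recursion stack consists of
   the arrays [fW], ..., [fSt], indexed by the remaining depth. *)
Definition mstepP := When (BNLe (vN aKP) (vN aKT))
  (LIf (BNLe (vN aPH) (NLit 0))
     (LIf (BNLe (NLit 1) (vN aKP)) openP baseP)
     (LIf (BNLe (NGet fSt (vN aKP)) (NLit 0)) push2P (LSeq compareP nextP))).

(** Reals cannot be converted into naturals, so the rounded cost is counted up, at most to
    [2 * n + 1]. *)
Definition roundP := LFor 65 nM (LSeq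
  (LN aCE (vN 65) (NLit 0))
  (LFor 66 (NAdd (NAdd nN nN) (NLit 1))
    (LIf (BRLe (RMul (ROfNat nN) (RGet 0 (vN 65)))
               (RMul (ROfNat (NGet aCE (vN 65))) (vR rX)))
       LSkip (LN aCE (vN 65) (NAdd (NGet aCE (vN 65)) (NLit 1)))))).

Definition startP := LSeqs [::
  LFor 67 nN (LN aZ (NAdd (vN aHP) (vN 67)) (NLit 0));
  LFor 68 nM (LN aS (NAdd (vN aHP) (vN 68)) (NLit 0));
  LN aZ (NAdd (vN aHP) nRho) (NLit 1);
  Set0 aState (vN aHP);
  allocP].

(** The number of rounds is fixed in advance by the worst case; once the search is over, [mstepP]
    does nothing. *)
Definition callP := LSeqs [::
  Set0 aKP (vN aKT);
  Set0 aPH (NLit 0);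
  LN fW (vN aKT) nRho;
  LN fB (vN aKT) (NAdd nN nN);
  LN fS (vN aKT) (vN aState);
  LFor 71 (vN aBig) mstepP;
  Set0 aState (vN aRet)].

Definition testP := LSeq (Set0 aOK (NLit 1))
  (LFor 72 nN (When (BNLe (NLit 1) (NGet aTerm (vN 72)))
     (When (BNLe (NGet aZ (NAdd (vN aState) (vN 72))) (NLit 0))
       (Set0 aOK (NLit 0))))).

(* Tries to reach the vertices marked in [aTerm] at cost O(log^2 n/log log n)
   times the value of [rX]. *)
Definition oracleP := LSeqs [:: roundP; startP;
  LFor 69 (vN aL) (LFor 70 (NAdd (vN aD) (NLit 1)) callP); testP].

Definition clearP := LFor 73 nN (LN aTerm (vN 73) (NLit 0)).

Definition kstar := NSub (vN aNext) (NLit 1).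

Definition saveFP := LSeqs [:: Set0 aFOK (NLit 1); SetR0 rFX (vR rX);
  Set0 aFS (vN aState)].

(** Edge costs are arbitrary reals, so that doubling a price could take any number of rounds.
    Instead the first [n] multiples of every edge cost are tried and the least successful one is
    kept. *)
Definition freshP := LSeqs [::
  Set0 aFOK (NLit 0);
  clearP;
  LN aTerm (NGet aVert kstar) (NLit 1);
  LFor 74 nM (LSeq (SetR0 rX (ROfNat (NLit 0)))
    (LFor 75 nN (LSeqs [::
      SetR0 rX (RAdd (vR rX) (RGet 0 (vN 74)));
      oracleP;
      When (BNLe (NLit 1) (vN aOK))
        (LIf (BNLe (vN aFOK) (NLit 0)) saveFP
           (When (BRLe (vR rX) (vR rFX)) saveFP))])))].

Definition saveQP := LSeqs [:: Set0 aQOK (NLit 1); SetR0 rTh (RGet rDl (vN 76));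
  Set0 aQS (vN aState)].

Definition termsP := LSeq clearP
  (LFor 77 (vN aCnt) (When (BNLe (NLit 1) (NGet aPend (vN 77)))
    (When (BRLe (RGet rLv (vN 77)) (vR rX2))
      (When (BRLe (RGet rDl (vN 77)) (RGet rDl (vN 76)))
        (LN aTerm (NGet aVert (vN 77)) (NLit 1)))))).

(** Success of the oracle need not be monotone in the deadline: all deadlines are tried and the
    latest success is kept. A failure below it does no harm, as the requests concerned are covered
    by the later success. *)
Definition serveP := LSeqs [::
  SetR0 rX (vR rFX);
  When (BRLe (vR rX) (RGet rLv kstar)) (SetR0 rX (RGet rLv kstar));
  SetR0 rX2 (RAdd (vR rX) (vR rX));
  Set0 aQOK (NLit 0);
  LFor 76 (vN aCnt) (When (BNLe (NLit 1) (NGet aPend (vN 76)))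
    (When (BRLe (RGet rLv (vN 76)) (vR rX2)) (LSeqs [::
       termsP;
       oracleP;
       When (BNLe (NLit 1) (vN aOK))
         (LIf (BNLe (vN aQOK) (NLit 0)) saveQP
            (When (BRLe (vR rTh) (RGet rDl (vN 76))) saveQP))])))].

Definition markP := LFor 78 nM (LSeq
  (When (BNLe (NLit 1) (NGet aS (NAdd (vN aFS) (vN 78)))) (LMark (vN 78)))
  (When (BNLe (NLit 1) (vN aQOK))
    (When (BNLe (NLit 1) (NGet aS (NAdd (vN aQS) (vN 78)))) (LMark (vN 78))))).

(** The request at its deadline is removed on its own: the solution bought for it alone reaches it,
    even if all the other oracle calls fail. *)
Definition updateP := LSeq
  (LFor 79 (vN aCnt) (When (BNLe (NLit 1) (NGet aPend (vN 79)))
    (When (BRLe (RGet rLv (vN 79)) (vR rX2)) (LSeq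
      (LR rLv (vN 79) (RAdd (vR rX2) (vR rX2)))
      (When (BNLe (NLit 1) (vN aQOK))
        (When (BRLe (RGet rDl (vN 79)) (vR rTh))
          (LN aPend (vN 79) (NLit 0))))))))
  (LN aPend kstar (NLit 0)).

Definition setNextP := Set0 aNext (NAdd (vN 80) (NLit 1)).

Definition alarmP := LSeqs [::
  Set0 aNext (NLit 0);
  LFor 80 (vN aCnt) (When (BNLe (NLit 1) (NGet aPend (vN 80)))
    (LIf (BNLe (vN aNext) (NLit 0)) setNextP
      (When (BRLe (RGet rDl (vN 80)) (RGet rDl kstar)) setNextP)));
  When (BNLe (NLit 1) (vN aNext)) (LAlarm (RGet rDl kstar))].

(** For lack of multiplication, powers of two come from doubling, products and quotients from
    repeated addition. *)
Definition params1P := LSeqs [::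
  Set0 aP2 (NLit 1); Set0 aL (NLit 0);
  LFor 81 nN (When (BNLe (vN aP2) nN) (LSeq (Incr aP2 (vN aP2)) (Incr aL (NLit 1))))].
Definition params2P := LSeqs [::
  Set0 aA (NLit 1); Set0 aH (NLit 0);
  LFor 82 (vN aL) (When (BNLe (vN aA) (vN aL)) (LSeq (Incr aA (vN aA)) (Incr aH (NLit 1))))].
Definition fourL := NAdd (NAdd (vN aL) (vN aL)) (NAdd (vN aL) (vN aL)).
Definition params3P := LSeqs [::
  Set0 aD (NLit 0); Set0 aSum (NLit 0);
  LFor 83 fourL (When (BLt (vN aSum) fourL) (LSeq (Incr aSum (vN aH)) (Incr aD (NLit 1))))].
Definition params4P := LSeq
  (Set0 aKT (NLit 0)) (LFor 84 (vN aD) (Incr aKT (vN aA))).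
Definition params5P := LSeq
  (Set0 aQ (NLit 1)) (LFor 85 nN (LFor 86 nN (Incr aQ (NLit 12)))).
Definition params6P := LSeq
  (Set0 aBig (NLit 1)) (LFor 87 (vN aKT) (LSeqs [:: Set0 aTmp (NLit 0);
    LFor 88 (vN aQ) (Incr aTmp (vN aBig)); Set0 aBig (vN aTmp)])).

Definition mainP := LSeqs [:: freshP; serveP; markP; LTransmit; updateP; alarmP].

(** The stages before [mainP] compute bounds of later loops. Kept apart, each stage only reads the
    bounds of its own loops, as the estimate of the running time demands. *)
Definition on_alarmP := LSeqs [:: params1P; params2P; params3P; params4P; params5P;
  params6P; mainP].

(* The empty transmission serves a request at the root. *)
Definition storeP := LSeqs [::
  LN aVert (vN aCnt) (NGet 0 (NLit 3));
  LR rDl (vN aCnt) (RGet 1 (NLit 1));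
  LR rLv (vN aCnt) (ROfNat (NLit 0));
  LN aPend (vN aCnt) (NLit 1);
  WhenEq (NGet 0 (NLit 3)) nRho (LN aPend (vN aCnt) (NLit 0));
  Incr aCnt (NLit 1);
  LTransmit].

Definition on_requestP := LSeq storeP alarmP.

Definition dst_algorithm :=
  Algorithm (compile on_requestP) (compile on_alarmP).

Definition bounds_ok p := all (fun a => a \notin writesN p) (flatten (map reads (bounds p))).

Section DenE.
Variables (R : realType) (G : network R).

Lemma denE (c : config G) : (den LSkip c = c) *
  (forall a i e, den (LN a i e) c = setN a (neval c i) (neval c e) c) *
  (forall a i e, den (LR a i e) c = setR a (neval c i) (reval c e) c) *
  (forall a e, den (Set0 a e) c = setN a 0 (neval c e) c) *
  (forall a e, den (SetR0 a e) c = setR a 0 (reval c e) c) *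
  (forall a e, den (Incr a e) c = setN a 0 (nmem c a 0 + neval c e) c) *
  (forall b p, den (When b p) c = if beval c b then den p c else c) *
  (forall b p q, den (LIf b p q) c = if beval c b then den p c else den q c) *
  (forall p q, den (LSeq p q) c = den q (den p c)).
Proof. by []. Qed.

Lemma den_eq e1 e2 p (c : config G) :
  den (WhenEq e1 e2 p) c = if neval c e1 == neval c e2 then den p c else c.
Proof. by rewrite !denE !evalE eqn_leq; case: ifP. Qed.

Lemma den_whenT b p (c : config G) : beval c b -> den (When b p) c = den p c.
Proof. by rewrite denE => ->. Qed.

Lemma den_whenF b p (c : config G) : ~~ beval c b -> den (When b p) c = c.
Proof. by rewrite denE => /negbTE->. Qed.

Lemma den_ifT b p q (c : config G) : beval c b -> den (LIf b p q) c = den p c.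
Proof. by rewrite denE => ->. Qed.

Lemma den_ifF b p q (c : config G) : ~~ beval c b -> den (LIf b p q) c = den q c.
Proof. by rewrite denE => /negbTE->. Qed.

Lemma den_when2 b1 b2 p (c : config G) :
  den (When b1 (When b2 p)) c = if beval c b1 && beval c b2 then den p c else c.
Proof. by rewrite !denE; case: ifP. Qed.

End DenE.

Lemma loops_checks : loops_ok on_requestP && loops_ok on_alarmP.
Proof. by vm_compute. Qed.

Lemma bounds_checks : [&& bounds_ok params1P, bounds_ok params2P, bounds_ok params3P,
  bounds_ok params4P, bounds_ok params5P, bounds_ok params6P, bounds_ok mainP & bounds_ok alarmP].
Proof. by vm_compute. Qed.


(** * Correctness of the search *)

Section Machine.
Variables (R : realType) (G : network R).
Local Notation V := 'I_(nv G).
Local Notation n := (nv G).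
Local Notation es := (edges G).
Local Notation m := (size (edges G)).
Implicit Types (c : config G) (s : gstate V) (T : {set V}) (ce : V * V -> nat).

Definition edge_at (j : nat) : V * V := nth (rho G, rho G) es j.

Definition graph_ok c := [/\ nmem c 0 0 = n, nmem c 0 1 = rho G, nmem c 0 2 = m,
  forall j, j < m -> nmem c 1 j = (edge_at j).1 /\ nmem c 2 j = (edge_at j).2
  & forall j, j < m -> rmem c 0 j = ecost (edge_at j)].

Definition term_ok c T := forall v : V, nmem c aTerm v = (v \in T).
Definition cost_ok c ce := forall j, j < m -> nmem c aCE j = ce (edge_at j).

Definition repr c p s := [/\ p + (n + m) <= nmem c aHP 0,
  forall v : V, nmem c aZ (p + v) = (v \in s.1)
  & forall j, j < m -> nmem c aS (p + j) = (edge_at j \in s.2)].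

Definition heap_ext c c' := nmem c aHP 0 <= nmem c' aHP 0 /\
  forall i, i < nmem c aHP 0 -> nmem c' aZ i = nmem c aZ i /\ nmem c' aS i = nmem c aS i.

Lemma heap_ext_trans c1 c2 c3 : heap_ext c1 c2 -> heap_ext c2 c3 -> heap_ext c1 c3.
Proof.
move=> [l12 e12] [l23 e23]; split=> [|i il]; first exact: leq_trans l23.
by have [<- <-] := e12 i il; apply: e23; apply: leq_trans l12.
Qed.

Lemma repr_ext c c' p s : heap_ext c c' -> repr c p s -> repr c' p s.
Proof.
move=> [le e] [pl zE sE]; split; first exact: leq_trans le.
- move=> v; rewrite -zE; apply: (e _ _).1; apply: leq_trans pl.
  by rewrite -addnS leq_add2l; have := ltn_ord v; lia.
- move=> j jm; rewrite -sE//; apply: (e _ _).2; apply: leq_trans pl.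
  by rewrite -addnS leq_add2l; lia.
Qed.

Lemma heap_ext_eq c c' : nmem c' aHP = nmem c aHP -> nmem c' aZ = nmem c aZ ->
  nmem c' aS = nmem c aS -> heap_ext c c'.
Proof. by move=> eH eZ eS; split; rewrite ?eH // eZ eS. Qed.

Lemma graph_ok_den p c : [&& 0 \notin writesN p, 1 \notin writesN p,
  2 \notin writesN p & 0 \notin writesR p] -> graph_ok c -> graph_ok (den p c).
Proof. by case/and4P => ? ? ? ?; rewrite /graph_ok !nmem_den// rmem_den. Qed.

Lemma value_spec c T s (w : V) : graph_ok c -> term_ok c T ->
  repr c (nmem c aVP 0) s -> nmem c aVW 0 = w -> 
  nmem (den valueP c) aVO 0 = gvalue T w s.
Proof.
move=> gok tok [_ zE _] wE; rewrite /valueP /LSeqs !den_seq.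
set F := LFor _ _ _; set L := When _ _; set c1 := den _ c.
have nE : neval c1 nN = n by case: gok.
pose f i := if 1 <= nmem c aTerm i then nmem c aZ (nmem c aVP 0 + i) else 0.
have FE : nmem (den F c1) aVO 0 = \sum_(i < n) f i.
  have := @den_for _ _ (fun j c' => nmem c' aVO 0 = \sum_(i < j) f i) 60 nN
    (When (BNLe (NLit 1) (NGet aTerm (vN 60)))
     (Incr aVO (NGet aZ (NAdd (vN aVP) (vN 60))))) c1; rewrite nE; apply=> //.
    by rewrite big_ord0.
  move=> j c' jn jE fr _ IH; rewrite big_ord_recr /= -IH /f.
  rewrite denE !evalE jE (fr aTerm erefl) /= /update /=.
  case: ifP => _ /=; rewrite ?denE /= /update /= ?addn0 // jE.
  by rewrite (fr aZ erefl) (fr aVP erefl).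
have zF : nmem (den F c1) aZ (nmem (den F c1) aVP 0 + nmem (den F c1) aVW 0) = (w \in s.1).
  by rewrite !nmem_den // -zE -wE.
have nF : nmem (den F c1) 0 0 = n by rewrite nmem_den //; case: gok.
have fE : \sum_(i < n) f i = #|s.1 :&: T|.
  rewrite -sum1_card [RHS]big_mkcond; apply: eq_bigr => v _.
  by rewrite /f tok zE !inE; case: (v \in T); case: (v \in s.1).
move: (den F c1) zF nF FE => c2 zF nF FE; rewrite /L denE !evalE zF /gvalue card_ord -fE.
case: (w \in s.1) => /=; last by rewrite mul0n addn0.
by rewrite ?denE /= /update /= FE nF addn1 mul1n.
Qed.

Lemma copy_spec c s : graph_ok c -> repr c (nmem c aVP 0) s ->
  let c' := den copyP c in let p := nmem c aHP 0 in
  [/\ heap_ext c c', forall v : V, nmem c' aZ (p + v) = (v \in s.1)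
  & forall j, j < m -> nmem c' aS (p + j) = (edge_at j \in s.2)].
Proof.
move=> gok [pl zE sE] c' p; rewrite {}/c' /copyP den_seq.
set F2 := LFor _ _ _; set F1 := LFor _ _ _; set c1 := den F1 c.
have nE : neval c nN = n by case: gok.
have mE : neval c1 nM = m by rewrite /= nmem_den //; case: gok.
have [old1 new1] : (forall i, i < p -> nmem c1 aZ i = nmem c aZ i) /\
    forall i, i < n -> nmem c1 aZ (p + i) = nmem c aZ (nmem c aVP 0 + i).
  have := @den_for _ _ (fun j c' => (forall i, i < p -> nmem c' aZ i = nmem c aZ i) /\
    forall i, i < j -> nmem c' aZ (p + i) = nmem c aZ (nmem c aVP 0 + i)) 63 nN
    (LN aZ (NAdd (vN aHP) (vN 63)) (NGet aZ (NAdd (vN aVP) (vN 63)))) c.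
  rewrite nE; apply=> // j c' jn jE fr _ [IHo IHn].
  split=> i il; rewrite ?denE /= /update /= jE (fr aHP erefl) (fr aVP erefl) -/p.
    by rewrite ifN ?IHo//; apply: contraTN il => /eqP->; rewrite -leqNgt leq_addr.
  move: il; rewrite eqn_add2l ltnS leq_eqVlt; case: eqP => /= [->|_] il; last exact: IHn.
  by apply: IHo; apply: leq_trans pl; rewrite -addnS leq_add2l; lia.
have [old2 new2] : (forall i, i < p -> nmem (den F2 c1) aS i = nmem c aS i) /\
    forall i, i < m -> nmem (den F2 c1) aS (p + i) = nmem c aS (nmem c aVP 0 + i).
  have := @den_for _ _ (fun j c' => (forall i, i < p -> nmem c' aS i = nmem c aS i) /\
    forall i, i < j -> nmem c' aS (p + i) = nmem c aS (nmem c aVP 0 + i)) 64 nM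
    (LN aS (NAdd (vN aHP) (vN 64)) (NGet aS (NAdd (vN aVP) (vN 64)))) c1.
  rewrite mE; apply=> //; first by split=> // i _; rewrite -[LHS]/(nmem c1 aS i) nmem_den.
  move=> j c' jn jE fr _ [IHo IHn].
  have hE : nmem c' aHP 0 = p by rewrite fr // nmem_den.
  have vE : nmem c' aVP 0 = nmem c aVP 0 by rewrite fr // nmem_den.
  split=> i il; rewrite ?denE /= /update /= jE hE vE.
    by rewrite ifN ?IHo//; apply: contraTN il => /eqP->; rewrite -leqNgt leq_addr.
  move: il; rewrite eqn_add2l ltnS leq_eqVlt; case: eqP => /= [->|_] il; last exact: IHn.
  by apply: IHo; apply: leq_trans pl; rewrite -addnS leq_add2l; lia.
have zc i : nmem (den F2 c1) aZ i = nmem c1 aZ i by rewrite nmem_den.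
split=> [|v|j jm].
- split=> [|i il]; first by rewrite !nmem_den.
  by rewrite zc old1 // old2.
- by rewrite zc new1 ?zE.
- by rewrite new2 ?sE.
Qed.

Definition attachable ce s (w : V) b j :=
  [&& (edge_at j).2 == w, (edge_at j).1 \in s.1 & ce (edge_at j) <= b].

Lemma find_spec c ce s (w : V) b : graph_ok c -> cost_ok c ce ->
  repr c (nmem c aVP 0) s -> nmem c aVW 0 = w -> nmem c fB (nmem c aKP 0) = b ->
  if nmem (den findP c) aFE 0 is j.+1 then j < m /\ attachable ce s w b j
  else forall j, j < m -> ~~ attachable ce s w b j.
Proof.
move=> gok cok [pl zE sE] wE bE.
pose I j (c' : config G) := if nmem c' aFE 0 is i.+1 then i < j /\ attachable ce s w b i
  else forall i, i < j -> ~~ attachable ce s w b i.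
rewrite /findP den_seq; set c1 := den _ c.
have mE : neval c1 nM = m by case: gok.
have := @den_for _ _ I 62 nM (WhenEq (NGet 2 (vN 62)) (vN aVW)
    (When (BNLe (NLit 1) (NGet aZ (NAdd (vN aVP) (NGet 1 (vN 62)))))
      (When (BNLe (NGet aCE (vN 62)) (NGet fB (vN aKP)))
        (Set0 aFE (NAdd (vN 62) (NLit 1)))))) c1.
rewrite mE; apply=> // j c' jm jE fr _ Ij.
have [_ _ _ /(_ j jm) [t1 t2] _] := gok.
have f a : a \notin [:: aFE] -> a != 62 -> nmem c' a = nmem c a.
  by move=> a1 a2; rewrite fr ?nmem_den// inE negb_or a2 !mem_cat /= !orbF.
rewrite den_eq !denE !evalE jE (f 1) // (f 2) // (f aVW) // (f aZ) // (f aCE) //.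
rewrite (f fB) // (f aKP) // (f aVP) // t1 t2 wE zE cok // bE.
rewrite val_eqE lt0b -!if_and -andbA -/(attachable ce s w b j).
rewrite /I; case: ifP => gj; rewrite /= /update /=.
  by rewrite addn1.
move: Ij; rewrite /I; case: (nmem c' aFE 0) => [|i].
  by move=> H i; rewrite ltnS leq_eqVlt => /orP[/eqP->|/H//]; rewrite gj.
by case=> ij gi; split=> //; apply: leqW.
Qed.

Lemma edge_at_mem j : j < m -> edge_at j \in es.
Proof. by move=> jm; rewrite mem_nth. Qed.

Lemma edge_at_inj i j : i < m -> j < m -> (edge_at i == edge_at j) = (i == j).
Proof. by move=> im jm; rewrite nth_uniq // enum_uniq. Qed.

Lemma edge_atP e : e \in es -> exists2 j, j < m & edge_at j = e.
Proof. by move=> ein; exists (index e es); rewrite ?index_mem // /edge_at nth_index. Qed.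

Definition frame_arrays := [:: fW; fB; fS; fW1; fB1; fBest; fSt].

Lemma base_spec c ce s (w : V) b k : graph_ok c -> cost_ok c ce ->
  nmem c aKP 0 = k -> repr c (nmem c fS k) s -> nmem c fW k = w -> nmem c fB k = b ->
  let c' := den baseP c in exists s',
  [/\ attach es ce w b s s', repr c' (nmem c' aRet 0) s', heap_ext c c',
      nmem c' aPH 0 = 1 & nmem c' aKP 0 = k.+1].
Proof.
move=> gok cok kE sR wE bE.
rewrite /baseP /LSeqs !den_seq.
set I := LIf _ _ _; set c1 := den _ (den _ (den _ c)).
suff [s' [at' r' h']] : exists s', [/\ attach es ce w b s s',
    repr (den I c1) (nmem (den I c1) aRet 0) s' & heap_ext c1 (den I c1)].
  have kI : nmem (den I c1) aKP 0 = k by rewrite nmem_den.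
  move: (den I c1) r' h' kI => c2 r' h' kI.
  by exists s'; split=> //; rewrite ?denE /= /update /= kI addn1.
have vp : nmem c1 aVP 0 = nmem c fS k by rewrite /c1 !denE /= /update /= kE.
have vw : nmem c1 aVW 0 = w by rewrite /c1 !denE /= /update /= kE.
have ret : nmem c1 aRet 0 = nmem c fS k by rewrite /c1 !denE /= /update /= kE.
have sR1 : repr c1 (nmem c1 aVP 0) s by rewrite vp; exact: sR.
have zw : beval c1 (BNLe (NLit 1) (NGet aZ (NAdd (vN aVP) (vN aVW)))) = (w \in s.1).
  by have [_ zE _] := sR1; rewrite !evalE vw zE; case: (w \in s.1).
have fb : nmem c1 fB (nmem c1 aKP 0) = b by rewrite /c1 !denE /= /update /= kE.
have g1 : graph_ok c1 by [].
have co1 : cost_ok c1 ce by [].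
rewrite {}/I den_if zw /attach; case: ifP => ws.
  by exists s; split=> //; rewrite /= ret -vp.
rewrite den_seq; set W := When _ _.
have {fb} := find_spec g1 co1 sR1 vw fb.
have e2 : heap_ext c1 (den findP c1) by apply: heap_ext_eq; rewrite nmem_den.
have g2 : graph_ok (den findP c1) by apply: graph_ok_den.
have vp2 : nmem (den findP c1) aVP 0 = nmem c1 aVP 0 by rewrite nmem_den.
have ret2 : nmem (den findP c1) aRet 0 = nmem c fS k by rewrite nmem_den.
have vw2 : nmem (den findP c1) aVW 0 = w by rewrite nmem_den.
have sR2 := repr_ext e2 sR1.
move: (den findP c1) vp2 sR2 e2 g2 ret2 vw2 => c2 vp2 sR2 e2 g2 ret2 vw2.
case fE: (nmem c2 aFE 0) => [|j] fsp.
  rewrite {}/W denE !evalE fE /=.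
  exists s; split=> //; last by rewrite ret2 -vp.
  right; split=> // e /edge_atP[j jm <-] ew e1; have := fsp j jm.
  by rewrite /attachable ew eqxx e1.
case: fsp => jm /and3P[/eqP ew ej eb].
rewrite {}/W denE !evalE fE /= den_seq.
rewrite -vp2 in sR2; have [[h3 o3] z3 s3] := copy_spec g2 sR2.
have hp3 : nmem (den copyP c2) aHP 0 = nmem c2 aHP 0 by rewrite nmem_den.
have vw3 : nmem (den copyP c2) aVW 0 = w by rewrite nmem_den.
have fe3 : nmem (den copyP c2) aFE 0 = j.+1 by rewrite nmem_den.
have n3 : nmem (den copyP c2) 0 0 = n by rewrite nmem_den //; case: g2.
have m3 : nmem (den copyP c2) 0 2 = m by rewrite nmem_den //; case: g2.
move: (den copyP c2) h3 o3 z3 s3 hp3 vw3 fe3 n3 m3 => c3 h3 o3 z3 s3 hp3 vw3 fe3 n3 m3.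
rewrite !denE; exists (w |: s.1, edge_at j |: s.2)%SET; split.
- by left; exists (edge_at j); split=> //; apply: edge_at_mem.
- rewrite ?denE /= /update /= hp3 ?vw3 ?fe3 ?n3 ?m3 ?subn1 /=; split.
  + by rewrite /= /update /=.
  + move=> v; rewrite /= /update /= z3 eqn_add2l val_eqE !inE.
    by case: (v == w).
  + move=> i im; rewrite /= /update /= eqn_add2l !inE edge_at_inj //.
    by rewrite s3 //; case: (i == j).
apply: (heap_ext_trans e2); split; rewrite ?denE /= /update /= hp3 ?n3 ?m3 ?leq_addr // => i il.
rewrite fe3 vw3 !ifN; first by apply: o3.
  by apply: contraTN il => /eqP->; rewrite -leqNgt leq_addr.
by apply: contraTN il => /eqP->; rewrite -leqNgt leq_addr.
Qed.

End Machine.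


(** * The recursion stack and the number of steps of the search *)

Section Search.
Variables (R : realType) (G : network R).
Local Notation V := 'I_(nv G).
Local Notation n := (nv G).
Local Notation es := (edges G).
Local Notation m := (size (edges G)).
Variables (T : {set V}) (ce : V * V -> nat).
Implicit Types (c : config G) (s : gstate V).

Definition env c := [/\ graph_ok c, term_ok c T & cost_ok c ce].

Lemma env_den p c : [&& 0 \notin writesN p, 1 \notin writesN p,
  2 \notin writesN p, 0 \notin writesR p, aTerm \notin writesN p & aCE \notin writesN p] ->
  env c -> env (den p c).
Proof.
case/and5P => w0 w1 w2 w3 /andP[w4 w5] [gok tok cok]; split.
- by apply: graph_ok_den; rewrite // w0 w1 w2.
- by move=> v; rewrite nmem_den.
- by move=> j jm; rewrite nmem_den // cok.
Qed.

Local Notation mstep := (den mstepP).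

Lemma env_iter t c : env c -> env (iter t mstep c).
Proof. by move=> e; elim: t => [|t IH] //=; apply: env_den IH; vm_compute. Qed.

Lemma KT_iter t c : nmem (iter t mstep c) aKT = nmem c aKT.
Proof. by elim: t => [|t IH] //=; rewrite nmem_den. Qed.

(** The entries above [k] are the frames of the callers, which must find their local data intact. *)
Definition returns k c c' s' := [/\ nmem c' aKP 0 = k.+1, nmem c' aPH 0 = 1,
  repr c' (nmem c' aRet 0) s', heap_ext c c'
  & forall a i, a \in frame_arrays -> k < i -> nmem c' a i = nmem c a i].

Definition calls k (w : V) b s c := [/\ nmem c aKP 0 = k, nmem c aPH 0 = 0,
  nmem c fW k = w, nmem c fB k = b & repr c (nmem c fS k) s].

Lemma compare_spec c k (w : V) s s' : env c -> nmem c aKP 0 = k -> nmem c fW k = w ->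
  repr c (nmem c fBest k) s -> repr c (nmem c aRet 0) s' ->
  let c' := den compareP c in
  nmem c' fBest k = (if gvalue T w s < gvalue T w s' then nmem c aRet 0 else nmem c fBest k)
  /\ forall i, i != k -> nmem c' fBest i = nmem c fBest i.
Proof.
move=> [gok tok cok] kE wE sR sR'; rewrite /compareP /LSeqs !(den_seq (Set0 _ _)).
set c1 := den (Set0 aVP _) _; rewrite den_seq.
have v1 : nmem (den valueP c1) aVO 0 = gvalue T w s.
  apply: value_spec => //; rewrite /c1 !denE /= /update /= kE //.
have f1 a : a \notin writesN valueP -> a != aVW -> a != aVP -> nmem (den valueP c1) a = nmem c a.
  by move=> a1 a2 a3; rewrite nmem_den // /c1 !denE /= !update_neq.
have vw1 : nmem (den valueP c1) aVW 0 = w.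
  by rewrite nmem_den // /c1 !denE /= /update /= kE.
have g1 : graph_ok (den valueP c1) by apply: graph_ok_den.
move: (den valueP c1) v1 f1 vw1 g1 => c2 v1 f1 vw1 g1 {c1}.
rewrite !(den_seq (Set0 _ _)).
set c3 := den (Set0 aVP _) _; rewrite den_seq.
have {v1} v3 : nmem (den valueP c3) aV1 0 = gvalue T w s.
  by rewrite nmem_den // /c3 !denE /= /update /= v1.
have e3 a : a \notin writesN valueP -> a != aVW -> a != aVP -> a != aV1 ->
    nmem c3 a = nmem c a.
  by move=> a1 a2 a3 a4; rewrite /c3 !denE /= !update_neq // f1.
have p3 : nmem c3 aVP 0 = nmem c aRet 0.
  by rewrite /c3 !denE /= /update /= f1.
have v4 : nmem (den valueP c3) aVO 0 = gvalue T w s'.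
  apply: value_spec => //.
    by move=> v; rewrite e3 // tok.
  by case: sR' => pl zE sE; rewrite p3; split=> *; rewrite !e3 // ?zE ?sE.
have f3 a : a \notin writesN valueP -> a != aVW -> a != aVP -> a != aV1 ->
    nmem (den valueP c3) a = nmem c a.
  by move=> a1 a2 a3 a4; rewrite nmem_den // e3.
move: (den valueP c3) v3 v4 f3 => c4 v3 v4 f3.
rewrite denE !evalE v3 v4 -ltnNge; case: ifP => _; last by rewrite f3.
rewrite denE /= /update /= !f3 // kE eqxx; split=> // i ik.
by rewrite (negbTE ik).
Qed.

Lemma mstep_call c k : nmem c aKP 0 = k -> k <= nmem c aKT 0 -> nmem c aPH 0 = 0 ->
  mstep c = if k is 0 then den baseP c else den openP c.
Proof.
move=> kE kKT ph; rewrite /mstepP den_whenT ?evalE ?kE //.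
rewrite den_ifT ?evalE ?ph //; case: k kE {kKT} => [|k] kE.
  by rewrite den_ifF ?evalE ?kE.
by rewrite den_ifT ?evalE ?kE.
Qed.

Lemma mstep_return c k : nmem c aKP 0 = k -> k <= nmem c aKT 0 -> nmem c aPH 0 = 1 ->
  mstep c = if nmem c fSt k is 0 then den push2P c else den nextP (den compareP c).
Proof.
move=> kE kKT ph; rewrite /mstepP den_whenT ?evalE ?kE //.
rewrite den_ifF ?evalE ?ph //; case st: (nmem c fSt k) => [|j].
  by rewrite den_ifT ?evalE ?kE ?st.
by rewrite den_ifF ?den_seq ?evalE ?kE ?st.
Qed.

Lemma mstep_done c : nmem c aKT 0 < nmem c aKP 0 -> mstep c = c.
Proof. by move=> h; rewrite den_whenF // !evalE -ltnNge. Qed.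

Lemma push1_spec c k (w : V) b s : nmem c aKP 0 = k.+1 -> nmem c fW1 k.+1 = w ->
  nmem c fB1 k.+1 = b -> repr c (nmem c fS k.+1) s ->
  let c' := den push1P c in
  [/\ calls k w b s c', heap_ext c c', nmem c' fSt k.+1 = 0,
    forall a, a \notin writesN push1P -> nmem c' a = nmem c a
  & forall a i, a \in frame_arrays -> k < i -> (i != k.+1) || (a != fSt) ->
      nmem c' a i = nmem c a i].
Proof.
move=> kE wE bE sR; split.
- by rewrite /push1P /LSeqs !denE; split; rewrite /= /update /= ?kE ?subn1 /= ?wE ?bE ?eqxx.
- by apply: heap_ext_eq; rewrite nmem_den.
- by rewrite /push1P /LSeqs !denE /= /update /= kE eqxx.
- by move=> a aN; rewrite nmem_den.
- move=> a i aF ki h; have ik : (i == k) = false by rewrite gtn_eqF.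
  rewrite /push1P /LSeqs !denE /= /update /= kE subn1 /= ik.
  move: h; rewrite /frame_arrays !inE in aF *.
  by move: aF; do 6?[case/orP]; move=> /eqP-> /=; rewrite ?andbF ?orbF // => /negbTE->.
Qed.

Lemma push2_spec c k (w : V) b b1 s : nmem c aKP 0 = k.+1 -> nmem c fW k.+1 = w ->
  nmem c fB k.+1 = b -> nmem c fB1 k.+1 = b1 -> repr c (nmem c aRet 0) s ->
  let c' := den push2P c in
  [/\ calls k w (b - b1) s c', heap_ext c c', nmem c' fSt k.+1 = 1
  & forall a i, a \in frame_arrays -> k < i -> (i != k.+1) || (a != fSt) ->
      nmem c' a i = nmem c a i].
Proof.
move=> kE wE bE b1E sR; split.
- by rewrite /push2P /LSeqs !denE; split;
    rewrite /= /update /= ?kE ?subn1 /= ?wE ?bE ?b1E ?eqxx.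
- by apply: heap_ext_eq; rewrite nmem_den.
- by rewrite /push2P /LSeqs !denE /= /update /= kE eqxx.
- move=> a i aF ki h; have ik : (i == k) = false by rewrite gtn_eqF.
  rewrite /push2P /LSeqs !denE /= /update /= kE subn1 /= ik.
  move: h; rewrite /frame_arrays !inE in aF *.
  by move: aF; do 6?[case/orP]; move=> /eqP-> /=; rewrite ?andbF ?orbF // => /negbTE->.
Qed.

Variables (B Q : nat).
Hypothesis QB : 4 * (n * B.+1) < Q.

(* The pairs [(w', b')] enumerated before [(w1, b1)]. *)
Definition before (w1 b1 w' b' : nat) := (w' < w1) || (w' == w1) && (b' < b1).

(** The specification [greedy] restricted to the pairs tried so far; at [(n, 0)] these are all
    pairs. *)
Definition explored k (w : V) b s best w1 b1 :=
  [/\ best = s \/ exists w' b' s1, [/\ b' <= b, greedy es ce T k w' b' s s1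
                    & greedy es ce T k w (b - b') s1 best],
    gvalue T w s <= gvalue T w best
  & forall (w' : V) b', b' <= b -> before w1 b1 w' b' -> exists s1 s2,
      [/\ greedy es ce T k w' b' s s1, greedy es ce T k w (b - b') s1 s2
        & gvalue T w s2 <= gvalue T w best]].

Definition opened k (w : V) b s best (w1 : V) b1 c :=
  [/\ calls k w1 b1 s c, nmem c fSt k.+1 = 0, nmem c fW k.+1 = w, nmem c fB k.+1 = b
    & [/\ nmem c fW1 k.+1 = w1, nmem c fB1 k.+1 = b1, repr c (nmem c fS k.+1) s
        & repr c (nmem c fBest k.+1) best]].

Lemma explored_next k w b s best best' (w1 : V) b1 s1 s2 x y :
  explored k w b s best w1 b1 -> b1 <= b ->
  greedy es ce T k w1 b1 s s1 -> greedy es ce T k w (b - b1) s1 s2 ->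
  best' = (if gvalue T w best < gvalue T w s2 then s2 else best) ->
  (forall (w' : V) b', b' <= b -> before x y w' b' ->
     before w1 b1 w' b' \/ (w' = w1 /\ b' = b1)) ->
  explored k w b s best' x y.
Proof.
move=> [h1 h2 h3] b1b g1 g2 -> sub; split.
- by case: ifP => _ //; right; exists w1, b1, s1.
- by case: ifP => // /ltnW; apply: leq_trans.
move=> w' b' b'b /sub-/(_ b'b)[/(h3 _ _ b'b)[s3 [s4 [g3 g4 le]]]|[-> ->]].
  exists s3, s4; split=> //; case: ifP => // /ltnW; exact: leq_trans.
by exists s1, s2; split=> //; case: ltnP.
Qed.

Definition extends k c c' := heap_ext c c' /\
  forall a i, a \in frame_arrays -> k < i -> nmem c' a i = nmem c a i.

Lemma extends_trans k c1 c2 c3 : extends k c1 c2 -> extends k c2 c3 -> extends k c1 c3.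
Proof.
move=> [h12 f12] [h23 f23]; split; first exact: heap_ext_trans h23.
by move=> a i aF ki; rewrite f23 // f12.
Qed.

Lemma returns_extends k c1 c2 c3 s : extends k c1 c2 -> returns k c2 c3 s -> returns k c1 c3 s.
Proof.
move=> e12 [kp ph rs hx fr]; have [hx' fr'] := extends_trans e12 (conj hx fr).
by split.
Qed.

Lemma push1_opened c k (w w1 : V) b b1 s best : nmem c aKP 0 = k.+1 ->
  nmem c fW k.+1 = w -> nmem c fB k.+1 = b -> nmem c fW1 k.+1 = w1 ->
  nmem c fB1 k.+1 = b1 -> repr c (nmem c fS k.+1) s -> repr c (nmem c fBest k.+1) best ->
  opened k w b s best w1 b1 (den push1P c) /\ extends k.+1 c (den push1P c).
Proof.
move=> kE wE bE w1E b1E sR bR.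
have [cl hx st _ fr] := push1_spec kE w1E b1E sR.
have F a : a \in frame_arrays -> a != fSt -> nmem (den push1P c) a k.+1 = nmem c a k.+1.
  by move=> aF aS; rewrite fr // aS orbT.
split; last first.
  split=> // a i aF ki; rewrite fr //; first exact: ltnW.
  by rewrite gtn_eqF.
by split=> //; rewrite ?F //; split; rewrite ?F //; apply: (repr_ext hx).
Qed.

Lemma open_spec c k (w w1 : V) b s : calls k.+1 w b s c -> w1 = 0 :> nat ->
  opened k w b s s w1 0 (den openP c) /\ extends k.+1 c (den openP c).
Proof.
case=> kE ph wE bE sR w10; rewrite /openP /LSeqs -/push1P !(den_seq (LN _ _ _)).
set c1 := den (LN fBest _ _) _.
have F a : a \notin [:: fW1; fB1; fBest] -> nmem c1 a = nmem c a.
  by rewrite !inE !negb_or => /and3P[? ? ?]; rewrite !nmem_den // inE.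
have hx : heap_ext c c1 by apply: heap_ext_eq; rewrite F.
have e1 : extends k.+1 c c1.
  split=> // a i _ ki; rewrite /c1 !denE /= /update /= kE.
  by rewrite (gtn_eqF ki) !andbF.
have kE1 : nmem c1 aKP 0 = k.+1 by rewrite F.
have w11 : nmem c1 fW1 k.+1 = w1 by rewrite /c1 !denE /= /update /= kE eqxx.
have b11 : nmem c1 fB1 k.+1 = 0 by rewrite /c1 !denE /= /update /= kE eqxx.
have sR1 : repr c1 (nmem c1 fS k.+1) s by rewrite F //; exact: (repr_ext hx).
have bR1 : repr c1 (nmem c1 fBest k.+1) s.
  by rewrite {2}/c1 !denE /= /update /= kE eqxx; exact: (repr_ext hx).
have wE1 : nmem c1 fW k.+1 = w by rewrite F.
have bE1 : nmem c1 fB k.+1 = b by rewrite F.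
have [opn e] := push1_opened kE1 wE1 bE1 w11 b11 sR1 bR1.
by split=> //; apply: extends_trans e.
Qed.

Lemma next_spec c k (w w1 : V) b b1 s best : graph_ok c -> nmem c aKP 0 = k.+1 ->
  nmem c aPH 0 = 1 ->
  nmem c fW k.+1 = w -> nmem c fB k.+1 = b -> nmem c fW1 k.+1 = w1 ->
  nmem c fB1 k.+1 = b1 -> repr c (nmem c fS k.+1) s -> repr c (nmem c fBest k.+1) best ->
  b1 <= b -> let c' := den nextP c in
  [\/ [/\ b1 < b, opened k w b s best w1 b1.+1 c' & extends k.+1 c c'],
      b1 = b /\ exists w2 : V, [/\ w2 = w1.+1 :> nat, opened k w b s best w2 0 c'
         & extends k.+1 c c']
    | [/\ b1 = b, w1.+1 = n & returns k.+1 c c' best]].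
Proof.
move=> gok kE ph wE bE w1E b1E sR bR b1b; rewrite /nextP den_seq.
set c1 := den (LN _ _ _) _.
have F a : a != fB1 -> nmem c1 a = nmem c a by move=> ?; rewrite nmem_den ?inE.
have b1E1 : nmem c1 fB1 k.+1 = b1.+1 by rewrite /c1 denE /= /update /= kE eqxx b1E addn1.
have e1 : extends k.+1 c c1.
  split; first by apply: heap_ext_eq; rewrite F.
  move=> a i _ ki; rewrite /c1 !denE /= /update /= kE.
  by rewrite (gtn_eqF ki) andbF.
have [lt|ge] := ltnP b1 b.
  rewrite den_ifT; last by rewrite !evalE (F aKP) // kE b1E1 (F fB) // bE.
  have sR1 : repr c1 (nmem c1 fS k.+1) s by rewrite F //; exact: (repr_ext e1.1).
  have bR1 : repr c1 (nmem c1 fBest k.+1) best by rewrite F //; exact: (repr_ext e1.1).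
  have kE1 : nmem c1 aKP 0 = k.+1 by rewrite F.
  have wE1 : nmem c1 fW k.+1 = w by rewrite F.
  have bE1 : nmem c1 fB k.+1 = b by rewrite F.
  have w11 : nmem c1 fW1 k.+1 = w1 by rewrite F.
  have [opn e] := push1_opened kE1 wE1 bE1 w11 b1E1 sR1 bR1.
  by constructor 1; split=> //; apply: extends_trans e.
have bb : b1 = b by apply/eqP; rewrite eqn_leq b1b.
rewrite den_ifF; last by rewrite !evalE (F aKP) // kE b1E1 (F fB) // bE bb -ltnNge.
rewrite /LSeqs !(den_seq (LN _ _ _)); move: (c1) F b1E1 e1 => {}c1 F b1E1 e1.
set c2 := den (LN fW1 _ _) _.
have F2 a : a != fB1 -> a != fW1 -> nmem c2 a = nmem c a.
  by move=> ? ?; rewrite !nmem_den ?inE // F.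
have e2 : extends k.+1 c c2.
  apply: (extends_trans e1); split; first by apply: heap_ext_eq; rewrite !F2 ?F.
  move=> a i _ ki; rewrite /c2 !denE /= /update /= F // kE.
  by rewrite (gtn_eqF ki) !andbF.
have b12 : nmem c2 fB1 k.+1 = 0 by rewrite /c2 !denE /= /update /= F // kE eqxx.
have w12 : nmem c2 fW1 k.+1 = w1.+1.
  by rewrite /c2 !denE /= /update /= !F // kE eqxx w1E addn1.
have nE : nmem c2 0 0 = n by rewrite F2 //; case: gok.
have [lt|ge'] := ltnP w1.+1 n.
  rewrite den_ifT; last by rewrite !evalE (F2 aKP) // kE w12 nE -ltnNge.
  have sR2 : repr c2 (nmem c2 fS k.+1) s by rewrite F2 //; exact: (repr_ext e2.1).
  have bR2 : repr c2 (nmem c2 fBest k.+1) best by rewrite F2 //; exact: (repr_ext e2.1).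
  have kE2 : nmem c2 aKP 0 = k.+1 by rewrite F2.
  have wE2 : nmem c2 fW k.+1 = w by rewrite F2.
  have bE2 : nmem c2 fB k.+1 = b by rewrite F2.
  have [opn e] := push1_opened (w1 := Ordinal lt) kE2 wE2 bE2 w12 b12 sR2 bR2.
  constructor 2; split=> //; exists (Ordinal lt); split=> //; exact: extends_trans e.
rewrite den_ifF; last by rewrite !evalE (F2 aKP) // kE w12 nE negbK.
constructor 3; split=> //; first by apply/eqP; rewrite eqn_leq ltn_ord.
apply: (returns_extends e2).
have kE2 : nmem c2 aKP 0 = k.+1 by rewrite F2.
have ph2 : nmem c2 aPH 0 = 1 by rewrite F2.
have bR2 : repr c2 (nmem c2 fBest k.+1) best by rewrite F2 //; apply: (repr_ext e2.1).
move: (c2) kE2 ph2 bR2 => c3 kE3 ph3 bR3.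
rewrite !denE; split=> //; rewrite /= /update /= ?kE3 ?addn1 //.
by move=> a [|i] // _ _; rewrite !andbF.
Qed.

Section Level.
Variable k : nat.
Hypothesis call_run : forall w b s c, env c -> k <= nmem c aKT 0 -> b <= B ->
  calls k w b s c -> exists t s', [/\ t <= Q ^ k, greedy es ce T k w b s s'
    & returns k c (iter t mstep c) s'].

(** Induction on the number [r] of pairs left. A pair takes two searches of depth [k] and two steps
    of its own: one starts the second search, one compares and moves on. *)
Lemma pairs_run r (w : V) b s best (w1 : V) b1 c : env c -> k.+1 <= nmem c aKT 0 ->
  b <= B -> b1 <= b -> (n - w1) * b.+1 - b1 <= r ->
  opened k w b s best w1 b1 c -> explored k w b s best w1 b1 ->
  exists t s', [/\ t <= r * (2 * Q ^ k).+2, greedy es ce T k.+1 w b s s'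
    & returns k.+1 c (iter t mstep c) s'].
Proof.
elim: r best w1 b1 c => [|r IH] best w1 b1 c ev kKT bB b1b rE [] .
  have := ltn_ord w1; move: rE; nia.
move=> cl st0 fw fb [fw1 fb1 fs fbest] ex.
have [t1 [s1 [t1Q g1 ret1]]] := call_run ev (ltnW kKT) (leq_trans b1b bB) cl.
have [c1 c1E] : exists c1, c1 = iter t1 mstep c by eexists.
have ev1 : env c1 by rewrite c1E; exact: env_iter.
have KT1 : nmem c1 aKT 0 = nmem c aKT 0 by rewrite c1E KT_iter.
rewrite -c1E in ret1; have [kp1 ph1 rs1 hx1 fr1] := ret1.
have F1 a : a \in frame_arrays -> nmem c1 a k.+1 = nmem c a k.+1.
  by move=> aF; apply: fr1.
have m2 : mstep c1 = den push2P c1.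
  by rewrite (mstep_return kp1) ?KT1 // F1 // st0.
have w1E : nmem c1 fW k.+1 = w by rewrite F1.
have b1E : nmem c1 fB k.+1 = b by rewrite F1.
have b11E : nmem c1 fB1 k.+1 = b1 by rewrite F1.
have [cl2 hx2 st2 fr2] := push2_spec kp1 w1E b1E b11E rs1.
rewrite -m2 in cl2 hx2 st2 fr2.
have ev2 : env (mstep c1) by exact: (env_iter 1).
have KT2 : nmem (mstep c1) aKT 0 = nmem c aKT 0 by rewrite -KT1 nmem_den.
have kKT2 : k <= nmem (mstep c1) aKT 0 by rewrite KT2 ltnW.
have [t2 [s2 [t2Q g2 ret2]]] := call_run ev2 kKT2 (leq_trans (leq_subr _ _) bB) cl2.
have [c3 c3E] : exists c3, c3 = iter t2 mstep (mstep c1) by eexists.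
have ev3 : env c3 by rewrite c3E; exact: env_iter.
have KT3 : nmem c3 aKT 0 = nmem c aKT 0 by rewrite c3E KT_iter KT2.
rewrite -c3E in ret2; have [kp3 ph3 rs3 hx3 fr3] := ret2.
have X3 : extends k.+1 c c3.
  split; first by apply: heap_ext_trans hx1 (heap_ext_trans hx2 hx3).
  move=> a i aF ki; rewrite fr3 ?fr2 ?fr1 //; try exact: ltnW.
  by rewrite (gtn_eqF ki).
have F3 a : a \in frame_arrays -> a != fSt -> nmem c3 a k.+1 = nmem c a k.+1.
  by move=> aF aS; rewrite fr3 // fr2 // ?aS ?orbT // F1.
have m3 : mstep c3 = den nextP (den compareP c3).
  by rewrite (mstep_return kp3) ?KT3 // fr3 // st2.
have w3E : nmem c3 fW k.+1 = w by rewrite F3.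
have best3 : repr c3 (nmem c3 fBest k.+1) best by rewrite F3 //; exact: (repr_ext X3.1).
have [bestE bestF] := compare_spec ev3 kp3 w3E best3 rs3.
have f4 a : a \notin writesN compareP -> nmem (den compareP c3) a = nmem c3 a.
  by move=> ?; rewrite nmem_den.
have ev4 : env (den compareP c3) by apply: env_den.
move: (den compareP c3) m3 bestE bestF f4 ev4 => c4 m3 bestE bestF f4 ev4.
have X4 : extends k.+1 c c4.
  apply: (extends_trans X3); split; first by apply: heap_ext_eq; rewrite f4.
  move=> a i aF ki; have [->|aB] := eqVneq a fBest; first by rewrite bestF // gtn_eqF.
  rewrite f4 //; rewrite !inE in aF *; rewrite !negb_or.
  by move: aF aB; do 6?[case/orP]; move=> /eqP->.
set best' := if gvalue T w best < gvalue T w s2 then s2 else best.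
have best4 : repr c4 (nmem c4 fBest k.+1) best'.
  rewrite bestE /best'; have hx4 : heap_ext c3 c4 by apply: heap_ext_eq; rewrite f4.
  by case: ifP => _; exact: (repr_ext hx4).
have kp4 : nmem c4 aKP 0 = k.+1 by rewrite f4.
have ph4 : nmem c4 aPH 0 = 1 by rewrite f4.
have w4 : nmem c4 fW k.+1 = w by rewrite f4.
have b4 : nmem c4 fB k.+1 = b by rewrite f4 // F3.
have w14 : nmem c4 fW1 k.+1 = w1 by rewrite f4 // F3.
have b14 : nmem c4 fB1 k.+1 = b1 by rewrite f4 // F3.
have s4 : repr c4 (nmem c4 fS k.+1) s by rewrite f4 // F3 //; exact: (repr_ext X4.1).
have gok4 : graph_ok c4 by case: ev4.
have ev5 : env (den nextP c4) by apply: env_den.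
have KT5 : nmem (den nextP c4) aKT 0 = nmem c aKT 0 by rewrite nmem_den // f4.
have total : iter (t1 + t2).+2 mstep c = den nextP c4.
  rewrite (_ : (t1 + t2).+2 = (t2.+1 + t1).+1); last by lia.
  by rewrite iterS iterD -c1E iterSr -c3E m3.
have tQ : (t1 + t2).+2 <= (2 * Q ^ k).+2 by lia.
have go w2 b2 : opened k w b s best' w2 b2 (den nextP c4) -> extends k.+1 c4 (den nextP c4) ->
    b2 <= b -> (n - w2) * b.+1 - b2 <= r -> explored k w b s best' w2 b2 ->
    exists t s', [/\ t <= r.+1 * (2 * Q ^ k).+2, greedy es ce T k.+1 w b s s'
    & returns k.+1 c (iter t mstep c) s'].
  move=> opn X5 b2b r2 ex2; rewrite -KT5 in kKT.
  have [t [s' [tr g' ret']]] := IH best' w2 b2 _ ev5 kKT bB b2b r2 opn ex2.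
  exists (t + (t1 + t2).+2), s'; split=> //; first by rewrite mulSn; lia.
  by rewrite iterD total; exact: (returns_extends (extends_trans X4 X5) ret').
have [[lt opn X5]|[bb [w2 [w2E opn X5]]]|[bb wn ret5]] :=
    next_spec gok4 kp4 ph4 w4 b4 w14 b14 s4 best4 b1b.
- apply: (go _ _ opn X5 lt); first by move: rE (ltn_ord w1); nia.
  apply: (explored_next ex b1b g1 g2 erefl) => w' b' _.
  rewrite /before ltnS; case: ltnP => //= _; first by left.
  rewrite leq_eqVlt; case: eqP => [/val_inj->|] //=; case: eqP => [->|_] /=; auto.
- apply: (go _ _ opn X5) => //; first by move: rE (ltn_ord w1); rewrite w2E bb; nia.
  apply: (explored_next ex b1b g1 g2 erefl) => w' b' b'b.
  rewrite /before w2E ltnS ltn0 andbF orbF leq_eqVlt; case: eqP => [/val_inj->|] //=.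
    by move=> _; rewrite -bb leq_eqVlt ltnn in b'b *; case/orP: b'b => [/eqP->|->]; auto.
  by move=> _ ->; left.
have ex' : explored k w b s best' n 0.
  apply: (explored_next ex b1b g1 g2 erefl) => w' b' b'b _.
  have := ltn_ord w'; rewrite -[X in _ < X]wn ltnS /before leq_eqVlt => /orP[/eqP/val_inj->|->].
    by rewrite -bb leq_eqVlt ltnn eqxx in b'b *; case/orP: b'b => [/eqP->|->]; auto.
  by left.
have [h1 h2 h3] := ex'.
exists (t1 + t2).+2, best'; split; last by rewrite total; exact: (returns_extends X4).
  by rewrite mulSn; lia.
by split=> // w' b' b'b; apply: h3; rewrite // /before ltn_ord.
Qed.

Lemma level_run (w : V) b s c : env c -> k.+1 <= nmem c aKT 0 -> b <= B ->
  calls k.+1 w b s c -> exists t s', [/\ t <= Q ^ k.+1, greedy es ce T k.+1 w b s s'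
    & returns k.+1 c (iter t mstep c) s'].
Proof.
move=> ev kKT bB cl; have [kE ph _ _ _] := cl.
have n0 : 0 < n by apply: leq_ltn_trans (ltn_ord w).
have [opn X1] := @open_spec c k w (Ordinal n0) b s cl erefl.
have m1 : mstep c = den openP c by rewrite (mstep_call kE kKT ph).
have ev1 : env (den openP c) by apply: env_den.
have KT1 : k.+1 <= nmem (den openP c) aKT 0 by rewrite nmem_den.
have ex : explored k w b s s (Ordinal n0) 0.
  split=> //; first by left.
  by move=> w' b' _; rewrite /before /= !ltn0 andbF.
have [t [s' [tr g ret]]] := pairs_run ev1 KT1 bB (leq0n b) (leqnn _) opn ex.
exists t.+1, s'; split=> //; last first.
  by rewrite -[t.+1]addn1 iterD /= m1; exact: (returns_extends X1).
have Q0 : 0 < Q ^ k by rewrite expn_gt0 (leq_ltn_trans (leq0n _) QB).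
have le : (n - Ordinal n0) * b.+1 - 0 <= n * B.+1.
  by rewrite subn0 /= subn0 leq_mul2l ltnS bB orbT.
(* One step opens the frame, and each of at most [n * B.+1] pairs takes at most [4 * Q ^ k] steps;
   this is where [QB] comes from. *)
apply: (@leq_trans (n * B.+1 * (2 * Q ^ k).+2).+1).
  by rewrite ltnS; apply: leq_trans tr _; rewrite leq_mul2r le orbT.
rewrite expnS; apply: (@leq_trans ((4 * (n * B.+1)).+1 * Q ^ k)); last by rewrite leq_mul2r QB orbT.
by move: (n * B.+1) (Q ^ k) Q0 => x y; nia.
Qed.

End Level.

Theorem search_run k w b s c : env c -> k <= nmem c aKT 0 -> b <= B ->
  calls k w b s c -> exists t s', [/\ t <= Q ^ k, greedy es ce T k w b s s'
    & returns k c (iter t mstep c) s'].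
Proof.
elim: k w b s c => [|k IH] w b s c ev kKT bB cl; last exact: level_run cl.
have [kE ph wE bE sR] := cl; have [gok tok cok] := ev.
have [s' [at' r' h' ph' kp']] := base_spec gok cok kE sR wE bE.
have m1 : mstep c = den baseP c by rewrite (mstep_call kE kKT ph).
exists 1, s'; split=> //; rewrite /= m1; split=> // a i aF ki.
rewrite nmem_den //; move: aF; rewrite !inE.
by do 6?[case/orP]; move=> /eqP->.
Qed.

End Search.


(** * The oracle: rounding of costs, repeated search, test *)

Section Oracle.
Variables (R : realType) (G : network R).
Local Notation V := 'I_(nv G).
Local Notation n := (nv G).
Local Notation es := (edges G).
Local Notation m := (size (edges G)).
Local Notation rho := (rho G).
Implicit Types (c : config G) (s : gstate V) (T : {set V}).

(* The cost of [e] in units of [x / n], rounded up and cut off at [2 n + 1]. *)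
Definition rcost (x : R) (e : V * V) : nat :=
  iter (n + n + 1) (fun k => if (n%:R * ecost e <= k%:R * x)%R then k else k + 1) 0.

(** A count smaller than the number of rounds means that some round left it unchanged, hence that
    the test held and the rounding is upwards. The last increment happened below the true value, so
    less than one unit is added. *)
Lemma rcostP x e : (0 < ecost e)%R -> (0 < x)%R ->
  (rcost x e <= n + n -> (n%:R * ecost e <= (rcost x e)%:R * x)%R) /\
  ((rcost x e)%:R * x < n%:R * ecost e + x)%R.
Proof.
move=> e0 x0; rewrite /rcost; set g := fun k => _.
have n0 : (0 <= n%:R * ecost e)%R by rewrite mulr_ge0 // ltW.
have H N : (iter N g 0 < N -> (n%:R * ecost e <= (iter N g 0)%:R * x)%R) /\
    ((iter N g 0)%:R * x < n%:R * ecost e + x)%R /\ iter N g 0 <= N.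
  elim: N => [|N [IH1 [IH2 IH3]]] /=; first by split=> //; split=> //; lra.
  set k := iter N g 0 in IH1 IH2 IH3 *.
  have -> : g k = if (n%:R * ecost e <= k%:R * x)%R then k else k + 1 by [].
  case: ifP => [le|/negbT]; first by split=> //; split=> //; exact: leqW.
  rewrite -ltNge => lt; split; last first.
    by split; [rewrite natrD mulrDl mul1r ltrD2r | rewrite addn1].
  rewrite addn1 ltnS => iN; have := IH1 iN; lra.
by have [h1 [h2 _]] := H (n + n + 1); split=> // le; apply: h1; rewrite [X in _ < X]addn1 ltnS.
Qed.

Lemma round_spec c x : graph_ok c -> rmem c rX 0 = x -> cost_ok (den roundP c) (rcost x).
Proof.
move=> gok xE; have [_ _ mE _ eE] := gok.
have nmE : neval c nM = m by [].
pose I k (c' : config G) := forall j, j < k -> nmem c' aCE j = rcost x (edge_at G j).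
suff : I m (den roundP c) by [].
rewrite -nmE; apply: den_for => // k c' km kE fr frR Ik.
rewrite nmE in km; rewrite den_seq; set F := LFor _ _ _; set c1 := den _ c'.
have fr' a : a \notin [:: 65; aCE; 66; aCE] -> nmem c' a = nmem c a by move=> aN; rewrite fr.
have n1 : neval c1 (NAdd (NAdd nN nN) (NLit 1)) = n + n + 1.
  rewrite !evalE /c1 denE /= /update /= (fr' 0) //.
  by case: gok => ->.
pose J i (c2 : config G) := nmem c2 65 0 = k /\ nmem c2 aCE k =
  iter i (fun k' => if (n%:R * ecost (edge_at G k) <= k'%:R * x)%R then k' else k' + 1) 0 /\
  forall j, j < k -> nmem c2 aCE j = rcost x (edge_at G j).
have [j1 [j2 j3]] : J (n + n + 1) (den F c1).
  rewrite -n1; apply: den_for => //.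
    rewrite /J /c1 denE /= /update /= kE eqxx; split=> //; split=> // j jk.
    by rewrite ltn_eqF // Ik.
  move=> i c2 _ _ fr2 frR2 [k2 [i2 o2]].
  have r0 : rmem c2 0 k = ecost (edge_at G k) by rewrite frR2 // rmem_den // frR // eE.
  have rX0 : rmem c2 rX 0 = x by rewrite frR2 // rmem_den // frR // eE.
  have n2 : nmem c2 0 0 = n.
    by rewrite fr2 // nmem_den // fr'//; case: gok.
  rewrite denE !evalE k2 r0 rX0 n2 i2 /J iterS; case: ifP => _ //.
  rewrite denE /= /update /= k2 eqxx i2; split=> //; split=> // j jk.
  by rewrite ltn_eqF // o2.
move=> j; rewrite ltnS leq_eqVlt /= /update /= => /orP[/eqP->|jk].
  by rewrite j2 /rcost.
exact: j3.
Qed.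

Definition start_state : gstate V := ([set rho]%SET, finset.set0).

Lemma start_spec c : graph_ok c -> let c' := den startP c in
  repr c' (nmem c' aState 0) start_state /\ heap_ext c c'.
Proof.
move=> gok; have [nE rE mE _ _] := gok; rewrite /startP /LSeqs !(den_seq (LFor _ _ _)).
set F2 := LFor 68 _ _; set F1 := LFor 67 _ _; set p := nmem c aHP 0.
have [old1 new1] : (forall i, i < p -> nmem (den F1 c) aZ i = nmem c aZ i) /\
    forall i, i < n -> nmem (den F1 c) aZ (p + i) = 0.
  pose I j (c' : config G) := (forall i, i < p -> nmem c' aZ i = nmem c aZ i) /\
    forall i, i < j -> nmem c' aZ (p + i) = 0.
  suff : I n (den F1 c) by [].
  rewrite -nE -[nmem c 0 0]/(neval c nN); apply: den_for => //.
  move=> j c' jn jE fr _ [IHo IHn].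
  split=> i il; rewrite ?denE /= /update /= jE (fr aHP erefl) -/p.
    by rewrite ifN ?IHo//; apply: contraTN il => /eqP->; rewrite -leqNgt leq_addr.
  by move: il; rewrite eqn_add2l ltnS leq_eqVlt; case: eqP => //= _ /IHn.
have m1 : neval (den F1 c) nM = m by rewrite /nM evalE nmem_den.
have h1 : nmem (den F1 c) aHP = nmem c aHP by rewrite nmem_den.
have s1 : nmem (den F1 c) aS = nmem c aS by rewrite nmem_den.
move: (den F1 c) (graph_ok_den (p := F1) (c := c) erefl gok) m1 h1 s1 old1 new1.
move=> c1 gok1 m1 h1 s1 old1 new1.
have [old2 new2] : (forall i, i < p -> nmem (den F2 c1) aS i = nmem c aS i) /\
    forall i, i < m -> nmem (den F2 c1) aS (p + i) = 0.
  pose I j (c' : config G) := (forall i, i < p -> nmem c' aS i = nmem c aS i) /\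
    forall i, i < j -> nmem c' aS (p + i) = 0.
  suff : I m (den F2 c1) by [].
  rewrite -m1; apply: den_for => //; first by split=> // i _; rewrite -[LHS]/(nmem c1 aS i) s1.
  move=> j c' jn jE fr _ [IHo IHn].
  split=> i il; rewrite ?denE /= /update /= jE (fr aHP erefl) /= h1 -/p.
    by rewrite ifN ?IHo//; apply: contraTN il => /eqP->; rewrite -leqNgt leq_addr.
  by move: il; rewrite eqn_add2l ltnS leq_eqVlt; case: eqP => //= _ /IHn.
have z2 : nmem (den F2 c1) aZ = nmem c1 aZ by rewrite nmem_den.
have h2 : nmem (den F2 c1) aHP 0 = p by rewrite nmem_den // h1.
have gok2 : graph_ok (den F2 c1) by apply: graph_ok_den.
move: (den F2 c1) gok2 z2 h2 old2 new2 => c2 [n2 r2 m2 _ _] z2 h2 old2 new2.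
rewrite !denE; split.
  rewrite /= /update /= h2; split.
  - by rewrite /= /update /= n2 m2.
  - move=> v; rewrite /= /update /= ?h2 ?r2 eqn_add2l val_eqE !inE.
    by case: (v == rho) => //; rewrite z2 new1.
  - by move=> j jm; rewrite /= /update /= new2 // inE.
split; rewrite /= /update /= -/p h2; first by rewrite leq_addr.
move=> i ip; rewrite ifN; first by rewrite z2 old1 // old2.
by apply: contraTN ip => /eqP->; rewrite -leqNgt leq_addr.
Qed.

Lemma test_spec c T s : graph_ok c -> term_ok c T -> repr c (nmem c aState 0) s ->
  nmem (den testP c) aOK 0 = (T \subset s.1).
Proof.
move=> gok tok [_ zE _]; rewrite /testP den_seq; set F := LFor _ _ _; set c1 := den _ c.
have nE : neval c1 nN = n by rewrite /nN evalE nmem_den //; case: gok.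
pose I j (c' : config G) := nmem c' aOK 0 = [forall v : V, (v < j) ==> (v \in T) ==> (v \in s.1)].
suff -> : nmem (den F c1) aOK 0 = [forall v : V, (v < n) ==> (v \in T) ==> (v \in s.1)].
  congr nat_of_bool; apply/forallP/fintype.subsetP => H v; last by rewrite ltn_ord /=; apply/implyP => /H.
  by move: (H v); rewrite ltn_ord /= => /implyP.
rewrite -[LHS]/(nmem (den F c1) aOK 0); suff : I n (den F c1) by [].
rewrite -nE; apply: den_for => //.
  rewrite /I /= /update /=; apply/esym/eqP; rewrite eqb1.
  by apply/forallP.
move=> j c' jn jE fr _ Ij; rewrite nE in jn; pose v0 := Ordinal jn.
have f a : a \notin [:: 72; aOK] -> nmem c' a = nmem c a.
  by move=> aN; rewrite fr // nmem_den //; move: aN; rewrite !inE negb_or => /andP[].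
rewrite /I !denE !evalE jE (f aTerm) // (f aZ) // (f aState) //.
rewrite [nmem c _ j](tok v0) [nmem c _ _](zE v0).
have E : [forall v : V, (v < j.+1) ==> (v \in T) ==> (v \in s.1)] =
   ((v0 \in T) ==> (v0 \in s.1)) && [forall v : V, (v < j) ==> (v \in T) ==> (v \in s.1)].
  apply/forallP/andP => [H|[H0 /forallP H] v].
    split; first by have := H v0; rewrite ltnSn.
    by apply/forallP => v; apply/implyP => vj; have := H v; rewrite ltnS ltnW.
  apply/implyP; rewrite ltnS leq_eqVlt => /orP[/eqP vj|vj]; last by have := H v; rewrite vj.
  by rewrite (_ : v = v0) //; apply: val_inj.
rewrite E; move: Ij; rewrite /I; case: (v0 \in T); case: (v0 \in s.1) => //= Ij.
Qed.

Lemma env_setN T ce a v c : a \notin [:: 0; 1; 2; aCE; aTerm] ->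
  env T ce c -> env T ce (setN a 0 v c).
Proof.
rewrite !inE !negb_or => /and5P[? ? ? ? ?] ev.
by apply: (@env_den _ _ _ _ (LN a (NLit 0) (NLit v)) c _ ev); rewrite !inE !(eq_sym _ a); apply/and5P; split=> //; apply/andP.
Qed.

Section Params.
Variables (L h D Q : nat).
Hypothesis nL : n < 2 ^ L.
Hypothesis LD : 4 * L <= h * D.
Hypothesis nQ : 4 * (n * (n + n).+1) < Q.
Local Notation K := (D * 2 ^ h).

Definition params_ok c := [/\ nmem c aL 0 = L, nmem c aD 0 = D, nmem c aKT 0 = K
  & nmem c aBig 0 = Q ^ K].

Lemma mstep_iter_done j c : nmem c aKT 0 < nmem c aKP 0 -> iter j (den mstepP) c = c.
Proof. by move=> h'; elim: j => //= j ->; exact: mstep_done. Qed.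

Lemma call_spec T ce c s : env T ce c -> params_ok c -> repr c (nmem c aState 0) s ->
  let c' := den callP c in exists s', [/\ greedy es ce T K rho (n + n) s s',
    repr c' (nmem c' aState 0) s' & heap_ext c c'].
Proof.
move=> ev [_ _ KTE BE] sR; rewrite /callP /LSeqs.
rewrite 3!(den_seq (Set0 _ _), den_seq (LN _ _ _)) 2!(den_seq (LN _ _ _)).
set c1 := den (LN fS _ _) _; rewrite (den_seq (LFor _ _ _)).
have [gok _ _] := ev.
have ev1 : env T ce (setN 71 0 0 c1).
  exact: env_setN.
have cl : calls K rho (n + n) s (setN 71 0 0 c1).
  have [nE rE _ _ _] := gok.
  rewrite /c1 !denE; split; rewrite /= /update /= ?KTE ?eqxx ?nE ?rE //.
have KT1 : nmem (setN 71 0 0 c1) aKT 0 = K by [].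
have B1 : neval c1 (vN aBig) = Q ^ K by [].
have hx1 : heap_ext c (setN 71 0 0 c1) by [].
have [|t [s' [tQ g ret]]] := search_run nQ ev1 _ (leqnn _) cl; first by rewrite KT1.
set F := LFor _ _ _.
have -> : den F c1 = iter (Q ^ K) (fun c' => bump 71 (den mstepP c')) (setN 71 0 0 c1).
  by rewrite -B1.
have [v ->] := @iter_bump _ _ 71 mstepP (Q ^ K) (setN 71 0 0 c1) erefl erefl.
rewrite -(subnK tQ) iterD mstep_iter_done; last first.
  by rewrite KT_iter KT1; case: ret => ->.
move: (iter t _ _) ret => c2 [kp ph rs hx fr].
exists s'; split=> //; exact: heap_ext_trans hx1 hx.
Qed.

Lemma params_den p c : [&& aL \notin writesN p, aD \notin writesN p,
  aKT \notin writesN p & aBig \notin writesN p] -> params_ok c -> params_ok (den p c).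
Proof. by case/and4P => ? ? ? ?; rewrite /params_ok !nmem_den. Qed.

Lemma rounds_spec T ce c s : env T ce c -> params_ok c -> repr c (nmem c aState 0) s ->
  let c' := den (LFor 69 (vN aL) (LFor 70 (NAdd (vN aD) (NLit 1)) callP)) c in
  exists s', [/\ rounds rho es ce T K (n + n) (L * D.+1) s s',
    repr c' (nmem c' aState 0) s' & heap_ext c c'].
Proof.
move=> ev pok sR.
pose I r (c' : config G) := [/\ env T ce c', params_ok c' &
  exists s', [/\ rounds rho es ce T K (n + n) r s s',
    repr c' (nmem c' aState 0) s' & heap_ext c c']].
have LE : neval c (vN aL) = L by case: pok.
suff [_ _ X] : I (L * D.+1) (den (LFor 69 (vN aL) (LFor 70 (NAdd (vN aD) (NLit 1)) callP)) c).
  exact: X.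
rewrite -LE; apply: (@den_for _ _ (fun j => I (j * D.+1))) => //.
  rewrite mul0n; split=> //.
  by exists s.
move=> l c1 _ _ _ _ [ev1 pok1 [s1 [r1 sR1 hx1]]].
have DE : neval c1 (NAdd (vN aD) (NLit 1)) = D.+1 by rewrite !evalE addn1; case: pok1 => _ ->.
suff [ev2 pok2 X] : I (l.+1 * D.+1) (den (LFor 70 (NAdd (vN aD) (NLit 1)) callP) c1).
  by split.
rewrite mulSn addnC -{2}DE.
apply: (@den_for _ _ (fun j => I (l * D.+1 + j))) => //.
  rewrite addn0; split=> //.
  by exists s1.
move=> d c2 _ _ _ _ [ev2 pok2 [s2 [r2 sR2 hx2]]].
have [s3 [g3 sR3 hx3]] := call_spec ev2 pok2 sR2.
have ev3 : env T ce (den callP c2) by apply: env_den.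
have pok3 : params_ok (den callP c2) by apply: params_den.
move: (den callP c2) ev3 pok3 sR3 hx3 => c3 ev3 pok3 sR3 hx3.
split=> //.
exists s3; split=> //; last exact: (heap_ext_trans hx2 hx3).
by rewrite addnS; exists s2.
Qed.

Lemma edges_gt0 e : e \in es -> (0 < ecost e)%R.
Proof. by rewrite mem_enum => /ecost_gt0. Qed.

Definition edge_cost (F : {set V * V}) : R := (\sum_(e in F) ecost e)%R.
Definition reaches (F : {set V * V}) (v : V) := connect [rel a b | (a, b) \in F] rho v.

(** The factor comes from [L * D.+1] rounds, each with a budget of [2 * n] units of [x / n]. *)
Definition affordable x s := [/\ forall e, e \in s.2 -> e \in es,
  forall v, v \in s.1 -> reaches s.2 v
  & (edge_cost s.2 <= (2 * (L * D.+1))%:R * x)%R].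

Definition tree_of (t : tree V) (F : {set V * V}) T :=
  [/\ uniq (rho :: map snd (tedges rho t)), {subset tedges rho t <= F}
    & {subset T <= rho :: map snd (tedges rho t)}].
Definition tree_cost (t : tree V) : R := (\sum_(e <- tedges rho t) ecost e)%R.

Lemma tree_size t : uniq (rho :: map snd (tedges rho t)) -> tsize t < n.
Proof.
move=> u; rewrite -(size_tedges rho) -(size_map snd) -[X in _ < X]card_ord.
by rewrite -[_.+1]/(size (rho :: _)) -(card_uniqP u) max_card.
Qed.

Lemma oracle_spec c T x : graph_ok c -> term_ok c T -> params_ok c ->
  rmem c rX 0 = x -> (0 < x)%R -> let c' := den oracleP c in exists s,
  [/\ repr c' (nmem c' aState 0) s, heap_ext c c', nmem c' aOK 0 = (T \subset s.1),
    affordable x s & forall t, tree_of t [set e in es] T -> (tree_cost t <= x)%R ->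
      T \subset s.1].
Proof.
move=> gok tok pok xE x0 c'; rewrite {}/c' /oracleP /LSeqs 3!den_seq.
have ev1 : env T (rcost x) (den roundP c).
  split; [exact: graph_ok_den | by move=> v; rewrite nmem_den | exact: round_spec].
have pok1 : params_ok (den roundP c) by apply: params_den.
have hx1 : heap_ext c (den roundP c) by apply: heap_ext_eq; rewrite nmem_den.
move: (den roundP c) ev1 pok1 hx1 => c1 ev1 pok1 hx1.
have [sR2 hx2] : _ /\ _ := start_spec (let: And3 g _ _ := ev1 in g).
have ev2 : env T (rcost x) (den startP c1) by apply: env_den.
have pok2 : params_ok (den startP c1) by apply: params_den.
move: (den startP c1) ev2 pok2 hx2 sR2 => c2 ev2 pok2 hx2 sR2.
have [s [rds sR3 hx3]] := rounds_spec ev2 pok2 sR2.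
set F := LFor _ _ _ in sR3 hx3 *.
have ev3 : env T (rcost x) (den F c2) by apply: env_den.
move: (den F c2) ev3 hx3 sR3 => c3 [gok3 tok3 cok3] hx3 sR3.
have hx4 : heap_ext c3 (den testP c3) by apply: heap_ext_eq; rewrite nmem_den.
have st4 : nmem (den testP c3) aState = nmem c3 aState by rewrite nmem_den.
exists s; split.
- by rewrite st4; exact: (repr_ext hx4).
- by apply: (heap_ext_trans hx1); apply: (heap_ext_trans hx2); exact: (heap_ext_trans hx3).
- exact: test_spec sR3.
- have so : sound rho es (rcost x) (n + n) start_state.
    split=> [|v|e]; rewrite ?inE //= => /eqP->; exact: connect0.
  have [s1 s2 s3] := rounds_sound rds so; have := rounds_cost rds.
  rewrite /= big_set0 add0n => le; split=> //; first by move=> e /s3[].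
  have n0 : (0 < n%:R :> R)%R by rewrite ltr0n (leq_ltn_trans _ (ltn_ord rho)).
  rewrite -(ler_pM2l n0) mulrA /edge_cost mulr_sumr.
  (* Bought edges have rounded cost at most [2 * n], below the cut-off, so that their true cost is
     no larger. *)
  apply: (@le_trans _ _ ((\sum_(e in s.2) rcost x e)%:R * x)%R).
    rewrite natr_sum mulr_suml; apply: ler_sum => e /s3[ein eB].
    by have [h1 _] := rcostP (edges_gt0 ein) x0; apply: h1.
  rewrite ler_pM2r // -natrM ler_nat; apply: leq_trans le _.
  by rewrite addnn -muln2 mulnC -mulnA.
move=> t [u sub cov] tc.
have tE : {subset tedges rho t <= es} by move=> e /sub; rewrite inE.
apply: (rounds_cover tE _ _ _ LD _ _ rds).
(* Rounding adds less than one unit [x / n] to each of fewer than [n] edges, so that a tree of cost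
   at most [x] fits in [2 * n] units. *)
- rewrite /pcost -ltnS -(ltr_nat R) -(ltr_pM2r x0) natr_sum mulr_suml.
  apply: (@le_lt_trans _ _ (\sum_(e <- tedges rho t) (n%:R * ecost e + x))%R).
    rewrite big_seq [leRHS]big_seq; apply: ler_sum => e /tE ein.
    by apply: ltW; have [_ h2] := rcostP (edges_gt0 ein) x0.
  rewrite big_split /= -mulr_sumr big_const_seq count_predT iter_addr_0 size_tedges.
  have := tree_size u; rewrite -(ltr_nat R) => tn.
  have : (n%:R * tree_cost t <= n%:R * x)%R by rewrite ler_wpM2l.
  rewrite -/(tree_cost t) -mulr_natl -addn1 !natrD !mulrDl mul1r => h1.
  have : ((tsize t)%:R * x < n%:R * x)%R by rewrite ltr_pM2r.
  by lra.
- by apply/fintype.subsetP => v /cov; rewrite !inE.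
- by apply: ltn_trans nL; apply: tree_size.
- by rewrite card_ord.
- by rewrite inE.
Qed.

End Params.
End Oracle.


(** * Serving a deadline *)

Section Service.
Variables (R : realType) (G : network R).
Local Notation V := 'I_(nv G).
Local Notation n := (nv G).
Local Notation es := (edges G).
Local Notation m := (size (edges G)).
Local Notation rho := (rho G).
Implicit Types (c : config G) (s : gstate V) (T : {set V}).
Variables (L h D Q : nat).
Hypothesis nL : n < 2 ^ L.
Hypothesis LD : 4 * L <= h * D.
Hypothesis nQ : 4 * (n * (n + n).+1) < Q.
Local Notation params_ok := (@params_ok R G L h D Q).
Local Notation affordable := (@affordable R G L D).
Local Notation tree_of := (@tree_of R G).
Local Notation tree_cost := (@tree_cost R G).
Local Notation ess := [set e in es]%SET.

Lemma clear_spec c : graph_ok c -> forall v : V, nmem (den clearP c) aTerm v = 0.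
Proof.
move=> [nE _ _ _ _].
pose I j (c' : config G) := forall v, v < j -> nmem c' aTerm v = 0.
suff H : I n (den clearP c) by move=> v; apply: H.
rewrite -nE -[nmem c 0 0]/(neval c nN); apply: den_for => // j c' jn jE _ _ Ij v.
rewrite denE /= /update /= jE ltnS leq_eqVlt.
by case: eqP => //= _; apply: Ij.
Qed.

Definition fresh_inv (v : V) c := [/\ graph_ok c, params_ok c, term_ok c [set v]%SET
  & nmem c aFOK 0 = 0 \/ [/\ nmem c aFOK 0 = 1, (0 < rmem c rFX 0)%R & exists s,
      [/\ repr c (nmem c aFS 0) s, v \in s.1 & affordable (rmem c rFX 0) s]]].

Definition tried (v : V) x c := forall t, tree_of t ess [set v]%SET ->
  (tree_cost t <= x)%R -> nmem c aFOK 0 = 1 /\ (rmem c rFX 0 <= x)%R.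

Definition tryP := LSeqs [:: oracleP; When (BNLe (NLit 1) (vN aOK))
        (LIf (BNLe (vN aFOK) (NLit 0)) saveFP
           (When (BRLe (vR rX) (vR rFX)) saveFP))].

Lemma try_spec v c x : fresh_inv v c -> rmem c rX 0 = x -> (0 < x)%R ->
  let c' := den tryP c in [/\ fresh_inv v c', rmem c' rX 0 = x, tried v x c'
    & forall y, tried v y c -> tried v y c'].
Proof.
move=> [gok pok tok inv] xE x0; rewrite /tryP /LSeqs den_seq.
have [s [sR hx okE aff succ]] := oracle_spec nL LD nQ gok tok pok xE x0.
have gok1 : graph_ok (den oracleP c) by apply: graph_ok_den.
have pok1 : params_ok (den oracleP c) by apply: params_den.
have tok1 : term_ok (den oracleP c) [set v]%SET by move=> u; rewrite nmem_den.
have x1 : rmem (den oracleP c) rX 0 = x by rewrite rmem_den.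
have f1 : nmem (den oracleP c) aFOK 0 = nmem c aFOK 0 by rewrite nmem_den.
have fx1 : rmem (den oracleP c) rFX 0 = rmem c rFX 0 by rewrite rmem_den.
have fs1 : nmem (den oracleP c) aFS 0 = nmem c aFS 0 by rewrite nmem_den.
move: (den oracleP c) sR hx okE gok1 pok1 tok1 x1 f1 fx1 fs1.
move=> c1 sR hx okE gok1 pok1 tok1 x1 f1 fx1 fs1.
have inv1 : fresh_inv v c1.
  split=> //; case: inv => [|[]]; rewrite -f1; first by left.
  rewrite -fx1 -fs1 => ? ? [s' [? ? ?]]; right; split=> //.
  by exists s'; split=> //; exact: (repr_ext hx).
rewrite denE !evalE okE; case: (boolP (_ \subset _)) => sub; last first.
  split=> // [t /succ tt /tt|y ty t tt ty']; first by rewrite (negbTE sub).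
  by rewrite /= f1 fx1; apply: ty tt ty'.
have vs : v \in s.1 by rewrite -finset.sub1set.
have saved : [/\ fresh_inv v (den saveFP c1), rmem (den saveFP c1) rX 0 = x,
    nmem (den saveFP c1) aFOK 0 = 1 & rmem (den saveFP c1) rFX 0 = x].
  rewrite /saveFP /LSeqs !denE; split=> //.
  by split=> //; right; split; rewrite /= /update /= ?x1 //; exists s.
move: saveFP saved => q [sv1 sv2 sv3 sv4].
rewrite /= ?denE ?evalE f1 x1 fx1; case: leqP => f0.
  split=> //; first by move=> t _ _; rewrite sv3 sv4.
  by move=> y ty t tt ty'; have [f1'] := ty t tt ty'; rewrite f1' in f0.
case: ifP => [le|/negbT]; last first.
  rewrite -ltNge => lt; split=> //; last first.
    by move=> y ty t tt ty'; rewrite f1 fx1; exact: (ty t tt ty').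
  move=> t _ _; rewrite f1 fx1 ltW //; split=> //.
  by move: f0; case: inv => [->|[->]].
split=> //; first by move=> t _ _; rewrite sv3 sv4.
move=> y ty t tt ty'; rewrite sv3 sv4; split=> //; apply: le_trans le _.
by have [] := ty t tt ty'.
Qed.

Lemma tree_cost_ge0 t T : tree_of t ess T -> (0 <= tree_cost t)%R.
Proof.
case=> _ sub _; rewrite /tree_cost big_seq; apply: sumr_ge0 => e /sub.
by rewrite inE => /edges_gt0/ltW.
Qed.

(* The largest edge cost [a] of the tree satisfies [a <= C <= n a], so that the
   least multiple of [a] above the total cost [C] is below [2 C]. *)
Lemma tree_cost_grid t (v : V) : v != rho -> tree_of t ess [set v]%SET ->
  exists i j, [/\ i < m, j < n, (tree_cost t <= j.+1%:R * ecost (edge_at G i))%R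
    & (j.+1%:R * ecost (edge_at G i) <= 2 * tree_cost t)%R].
Proof.
move=> vr [u sub cov]; set ts := tedges rho t in u sub cov.
have c0 e : e \in ts -> (0 < ecost e)%R by move/sub; rewrite inE => /edges_gt0.
have vts : v \in map snd ts.
  by have := cov v; rewrite !inE eqxx => /(_ isT); rewrite (negbTE vr).
have [a [ats amax]] : exists a, a \in ts /\ forall e, e \in ts -> (ecost e <= ecost a)%R.
  case: (ts) vts => [//|e0 ts' _]; elim: ts' e0 => [|e1 ts' IH] e0.
    by exists e0; rewrite inE eqxx; split=> // e; rewrite inE => /eqP->.
  have [a [ain amax]] := IH e1; have [le|lt] := leP (ecost e0) (ecost a).
    exists a; split; first by rewrite inE ain orbT.
    by move=> e; rewrite inE => /orP[/eqP->//|/amax].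
  exists e0; rewrite inE eqxx; split=> // e; rewrite inE => /orP[/eqP->//|/amax].
  by move/le_trans; apply; apply: ltW.
have a0 := c0 _ ats.
have Cle : (tree_cost t <= (tsize t)%:R * ecost a)%R.
  rewrite -(size_tedges rho) /tree_cost mulr_natl -[X in (_ <= X)%R]/(_ *+ size ts)%R.
  rewrite -(iter_addr_0 (size ts)) -(count_predT ts) -big_const_seq.
  by rewrite big_seq [leRHS]big_seq; apply: ler_sum => e /amax.
have Cge : (ecost a <= tree_cost t)%R.
  rewrite /tree_cost (big_rem a) //= lerDl big_seq; apply: sumr_ge0 => e er.
  by apply/ltW/c0/(mem_rem er).
have ex : exists k, (tree_cost t <= k%:R * ecost a)%R by exists (tsize t).
have jmin := ex_minnP ex; case: jmin => j jC jmin.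
have jt := jmin _ Cle; have tn := tree_size u.
have j0 : 0 < j.
  by rewrite lt0n; apply/eqP => j0; move: jC; rewrite j0 mul0r leNgt (lt_le_trans a0 Cge).
have [i im iE] : exists2 i, i < m & edge_at G i = a.
  by apply: edge_atP; have := sub _ ats; rewrite inE.
exists i, j.-1; rewrite iE prednK //; split=> //; first exact: leq_trans jt (ltnW tn).
have : (j.-1%:R * ecost a < tree_cost t)%R.
  by rewrite ltNge; apply/negP => /jmin; rewrite leqNgt prednK // leqnn.
move=> lt; rewrite -(prednK j0) -addn1 natrD mulrDl mul1r; lra.
Qed.

(** The stored price is at most the grid price of every tree reaching [v], which is at most twice
    the cost of that tree. As [v] is reachable there is such a tree, hence some price has been
    stored. *)
Lemma fresh_spec c (v : V) : graph_ok c -> params_ok c ->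
  nmem c aVert (nmem c aNext 0 - 1) = v -> v != rho -> connect (@edge R G) rho v ->
  let c' := den freshP c in let x := rmem c' rFX 0 in (0 < x)%R /\ exists s,
  [/\ repr c' (nmem c' aFS 0) s, v \in s.1, affordable x s
    & forall t, tree_of t ess [set v]%SET -> (x <= 2 * tree_cost t)%R].
Proof.
move=> gok pok vE vr con; rewrite /freshP /LSeqs !(den_seq (Set0 _ _)) (den_seq clearP).
rewrite (den_seq (LN _ _ _)); set c1 := den (LN _ _ _) _; set F := LFor _ _ _.
have tok1 : term_ok c1 [set v]%SET.
  move=> u; rewrite /c1 denE !evalE !nmem_den // !denE /= /update /= vE.
  rewrite val_eqE inE; case: eqP => // _.
  by rewrite -[RHS]/(false : nat) clear_spec.
have inv1 : fresh_inv v c1.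
  split=> //; first by apply: (graph_ok_den (p := LN _ _ _)) => //; apply: graph_ok_den.
    by apply: (@params_den _ _ _ _ _ _ (LN _ _ _)) => //; apply: params_den.
  by left; rewrite nmem_den // nmem_den.
pose I e c' := fresh_inv v c' /\ forall i j, i < e -> j < n ->
   tried v (j.+1%:R * ecost (edge_at G i))%R c'.
suff [inv tr] : I m (den F c1).
  have Fc : reaches [set e in es]%SET v.
    apply: (connect_sub _ con) => a b ab; apply: connect1.
    by rewrite /= inE mem_enum inE.
  have [t0 [u0 s0 cov0]] := spanning_tree rho [set e in es]%SET.
  have tt0 : tree_of t0 [set e in es]%SET [set v]%SET.
    by split=> // u; rewrite inE => /eqP->; exact: cov0.
  have [i [j [im jn le1 le2]]] := tree_cost_grid vr tt0.
  have [fok _] := tr i j im jn t0 tt0 le1.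
  case: inv => _ _ _ [f0|[_ x0 [s [sR vs aff]]]]; first by rewrite f0 in fok.
  split=> //; exists s; split=> // t tt.
  have [i' [j' [im' jn' le1' le2']]] := tree_cost_grid vr tt.
  have [_ le] := tr i' j' im' jn' t tt le1'.
  exact: le_trans le le2'.
have mE : neval c1 nM = m by rewrite /nM evalE; case: inv1 => -[_ _ ->].
rewrite -mE; apply: den_for => // e c2 em eE _ _ [inv2 tr2]; rewrite mE in em.
rewrite den_seq; set c3 := den (SetR0 _ _) c2; set F2 := LFor _ _ _.
pose J j c' := [/\ fresh_inv v c', rmem c' rX 0 = (j%:R * ecost (edge_at G e))%R,
  nmem c' 74 0 = e,
  forall i j, i < e -> j < n -> tried v (j.+1%:R * ecost (edge_at G i))%R c'
  & forall i, i < j -> tried v (i.+1%:R * ecost (edge_at G e))%R c'].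
suff [inv4 _ _ tr4 tr5] : J n (den F2 c3).
  split=> // i j; rewrite ltnS leq_eqVlt => /orP[/eqP->|ie] jn; last exact: tr4.
  exact: tr5.
have nE : neval c3 nN = n by rewrite /nN evalE; case: inv2 => -[].
rewrite -nE; apply: den_for => //.
  split=> //; by rewrite /= /update /= mul0r.
move=> j c4 jn _ _ _ [inv4 x4 e4 tr4 tr5]; rewrite nE in jn.
have e0 : (0 < ecost (edge_at G e))%R by apply/edges_gt0/edge_at_mem.
set c5 := den (SetR0 rX (RAdd (vR rX) (RGet 0 (vN 74)))) c4.
rewrite -[den _ _]/(den tryP c5).
have inv5 : fresh_inv v c5 by [].
have x5 : rmem c5 rX 0 = (j.+1%:R * ecost (edge_at G e))%R.
  rewrite /c5 denE /= /update /= x4 e4; case: inv4 => -[_ _ _ _ ->] // _ _ _.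
  by rewrite -natr1 mulrDl mul1r.
have x50 : (0 < j.+1%:R * ecost (edge_at G e))%R by rewrite mulr_gt0.
have [inv6 x6 try6 mono6] := try_spec inv5 x5 x50.
have e6 : nmem (den tryP c5) 74 0 = e by rewrite nmem_den.
move: (den tryP c5) inv6 x6 try6 mono6 e6 => c6 inv6 x6 try6 mono6 e6.
split=> //.
- by move=> i i' ie i'n; apply: mono6; exact: (tr4 _ _ ie i'n).
- move=> i; rewrite ltnS leq_eqVlt => /orP[/eqP->//|ij].
  by apply: mono6; exact: tr5.
Qed.

Definition eligible c x j := (0 < nmem c aPend j) && (rmem c rLv j <= x + x)%R.

Definition group c x (N k : nat) : {set V} :=
  [set v : V | [exists j : 'I_N, [&& eligible c x j, (rmem c rDl j <= rmem c rDl k)%R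
     & nmem c aVert j == v]]]%SET.

Definition vert_ok c N := forall j, j < N -> exists v : V, nmem c aVert j = v.

Lemma terms_spec c x k : graph_ok c -> vert_ok c (nmem c aCnt 0) -> nmem c 76 0 = k ->
  rmem c rX2 0 = (x + x)%R -> term_ok (den termsP c) (group c x (nmem c aCnt 0) k).
Proof.
move=> gok vok kE x2; rewrite /termsP den_seq; set F := LFor _ _ _; set c1 := den clearP c.
have z1 : forall v : V, nmem c1 aTerm v = 0 by exact: clear_spec.
have f1 a : a \notin [:: 73; aTerm] -> nmem c1 a = nmem c a by move=> ?; rewrite nmem_den.
have r1 a : rmem c1 a = rmem c a by rewrite rmem_den.
move: (c1) z1 f1 r1 => {}c1 z1 f1 r1.
pose T j v := [exists i : 'I_j, [&& eligible c x i, (rmem c rDl i <= rmem c rDl k)%R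
     & nmem c aVert i == v]].
pose I j (c' : config G) := forall v : V, nmem c' aTerm v = T j v.
have NE : neval c1 (vN aCnt) = nmem c aCnt 0 by rewrite evalE f1.
suff H : I (nmem c aCnt 0) (den F c1) by move=> v; rewrite inE; exact: H.
rewrite -NE; apply: den_for => //.
  by move=> v; rewrite [LHS]z1 /T; case: existsP => // -[[]].
move=> j c' jN jE fr frR Ij; rewrite NE in jN.
have f a : a \notin [:: 77; aTerm; 73] -> nmem c' a = nmem c a.
  rewrite !inE !negb_or => /and3P[h1 h2 h3].
  by rewrite fr ?f1 // !inE ?negb_or ?h1 ?h2 ?h3.
have r a : rmem c' a = rmem c a by rewrite frR // r1.
have TS v : T j.+1 v = T j v || [&& eligible c x j, (rmem c rDl j <= rmem c rDl k)%R
     & nmem c aVert j == v].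
  apply/existsP/orP => [[i]|[/existsP[i ti]|tj]].
  - have := ltn_ord i; rewrite ltnS leq_eqVlt => /orP[/eqP->|ij]; first by right.
    by move=> ti; left; apply/existsP; exists (Ordinal ij).
  - by exists (widen_ord (leqnSn j) i).
  - by exists ord_max.
set q := When _ _.
have -> : den q c' = if eligible c x j && (rmem c rDl j <= rmem c rDl k)%R
    then setN aTerm (nmem c aVert j) 1 c' else c'.
  rewrite !denE !evalE jE !(f aPend, f aVert, f 76) // !r kE x2 /eligible.
  by case: (0 < _); case: (_ <= x + x)%R; case: (_ <= _)%R.
move=> v; rewrite TS; case: ifP => [/andP[el dl]|].
  rewrite /= /update /= el dl /= eq_sym; case: eqP => [_|_]; first by rewrite orbT.
  by rewrite orbF; exact: Ij.
by move=> nf; rewrite andbA nf orbF; exact: Ij.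
Qed.

Definition keepN := [:: aVert; aPend; aCnt; aNext; aFS; aFOK].

Lemma serve_spec c x sF : graph_ok c -> params_ok c -> vert_ok c (nmem c aCnt 0) ->
  x = Order.max (rmem c rFX 0) (rmem c rLv (nmem c aNext 0 - 1)) -> (0 < x)%R ->
  repr c (nmem c aFS 0) sF ->
  let c' := den serveP c in
  [/\ rmem c' rX2 0 = (x + x)%R, repr c' (nmem c' aFS 0) sF,
    nmem c' aQOK 0 = 0 \/ nmem c' aQOK 0 = 1 /\ exists s, [/\ repr c' (nmem c' aQS 0) s,
      affordable x s & forall j (v : V), j < nmem c aCnt 0 -> eligible c x j ->
        (rmem c rDl j <= rmem c' rTh 0)%R -> nmem c aVert j = v -> v \in s.1]
  & forall k, k < nmem c aCnt 0 -> eligible c x k ->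
      (nmem c' aQOK 0 = 1 /\ (rmem c rDl k <= rmem c' rTh 0)%R) \/
      forall t, tree_of t ess (group c x (nmem c aCnt 0) k) -> (x < tree_cost t)%R].
Proof.
move=> gok pok vok xE x0 sF0; rewrite /serveP /LSeqs !(den_seq (SetR0 _ _)).
rewrite (den_seq (When _ _)) !(den_seq (SetR0 _ _)) (den_seq (Set0 _ _)).
set c1 := den (Set0 aQOK _) _; set F := LFor _ _ _; set N := nmem c aCnt 0.
have [n1 r1 rx1] : [/\ forall a, a != aQOK -> nmem c1 a = nmem c a,
    forall a, a \notin [:: rX; rX2] -> rmem c1 a = rmem c a
    & rmem c1 rX 0 = x /\ rmem c1 rX2 0 = (x + x)%R].
  split.
  - by move=> a aq; rewrite /c1 !nmem_den // inE.
  - by move=> a; rewrite !inE negb_or => /andP[? ?]; rewrite /c1 !rmem_den // inE.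
  rewrite /c1 !denE !evalE xE /= /update /= maxEle.
  by case: (_ <= _)%R.
have qok1 : nmem c1 aQOK 0 = 0 by [].
have gok1 : graph_ok c1 by case: gok => *; split; move=> *; rewrite ?n1 ?r1 //; auto.
have pok1 : params_ok c1 by case: pok => *; split; rewrite n1.
have repr1 : repr c1 (nmem c1 aFS 0) sF.
  by rewrite n1 //; apply: (repr_ext _ sF0); apply: heap_ext_eq; rewrite n1.
move: (c1) n1 r1 rx1 qok1 gok1 pok1 repr1 => {}c1 n1 r1 [rx1 rx2] qok1 gok1 pok1 repr1.
pose I k c' := [/\ graph_ok c' /\ params_ok c', rmem c' rX 0 = x /\ rmem c' rX2 0 = (x + x)%R,
  repr c' (nmem c' aFS 0) sF,
    nmem c' aQOK 0 = 0 \/ nmem c' aQOK 0 = 1 /\ exists s, [/\ repr c' (nmem c' aQS 0) s,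
      affordable x s & forall j (v : V), j < N -> eligible c x j ->
        (rmem c rDl j <= rmem c' rTh 0)%R -> nmem c aVert j = v -> v \in s.1]
  & forall i, i < k -> eligible c x i ->
      (nmem c' aQOK 0 = 1 /\ (rmem c rDl i <= rmem c' rTh 0)%R) \/
      forall t, tree_of t ess (group c x N i) -> (x < tree_cost t)%R].
suff [_ [_ ?] ? ? ?] : I N (den F c1) by [].
have NE : neval c1 (vN aCnt) = N by rewrite evalE n1.
rewrite -NE; apply: den_for => //; first by split=> //; left.
move=> k c2 kN kE fr frR [[gok2 pok2] [x2 xx2] repr2 q2 f2]; rewrite NE in kN.
have n2 a : a \in keepN -> nmem c2 a = nmem c a.
  move=> ak; rewrite fr ?n1 //; first by apply: contraTneq ak => ->.
  by move: ak; rewrite !inE => /or3P[/eqP->|/eqP->|/or4P[/eqP->|/eqP->|/eqP->|/eqP->]].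
have r2 a : a \in [:: rDl; rLv] -> rmem c2 a = rmem c a.
  move=> ak; rewrite frR ?r1 //; first by apply: contraL ak; rewrite !inE => /orP[]/eqP->.
  by move: ak; rewrite !inE => /orP[]/eqP->.
set W := LSeq termsP _.
have -> : den (When (BNLe (NLit 1) (NGet aPend (vN 76)))
    (When (BRLe (RGet rLv (vN 76)) (vR rX2)) W)) c2 =
    if eligible c x k then den W c2 else c2.
  by rewrite den_when2 !evalE kE n2 // r2 // xx2.
case: ifP => el; last first.
  split=> // i; rewrite ltnS leq_eqVlt => /orP[/eqP->|ik]; last exact: f2.
  by rewrite el.
rewrite {}/W !(den_seq termsP) !(den_seq oracleP).
have vok2 : vert_ok c2 (nmem c2 aCnt 0) by rewrite /vert_ok !n2.
have gE : group c2 x (nmem c2 aCnt 0) k = group c x N k.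
  by rewrite n2 //; apply/setP => v; rewrite !inE; apply: eq_existsb => j;
    rewrite /eligible !n2 // !r2.
have tok3 := terms_spec gok2 vok2 kE xx2; rewrite gE in tok3.
have gok3 : graph_ok (den termsP c2) by apply: graph_ok_den.
have pok3 : params_ok (den termsP c2) by apply: params_den.
have x3 : rmem (den termsP c2) rX 0 = x by rewrite rmem_den.
have f3 a : a \notin writesN termsP -> nmem (den termsP c2) a = nmem c2 a.
  by move=> ?; rewrite nmem_den.
have fr3 a : rmem (den termsP c2) a = rmem c2 a by rewrite rmem_den.
have hx3 : heap_ext c2 (den termsP c2) by apply: heap_ext_eq; rewrite f3.
move: (den termsP c2) tok3 gok3 pok3 x3 f3 fr3 hx3.
move=> c3 tok3 gok3 pok3 x3 f3 fr3 hx3.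
have [s [sR hx4 okE aff succ]] := oracle_spec nL LD nQ gok3 tok3 pok3 x3 x0.
have gok4 : graph_ok (den oracleP c3) by apply: graph_ok_den.
have pok4 : params_ok (den oracleP c3) by apply: params_den.
have f4 a : a \in [:: 76; aQOK; aQS; aFS] -> nmem (den oracleP c3) a = nmem c2 a.
  by rewrite !inE => /or4P[]/eqP->; rewrite nmem_den // f3.
have r4 a : rmem (den oracleP c3) a = rmem c2 a by rewrite rmem_den // fr3.
have hx5 := heap_ext_trans hx3 hx4.
move: (den oracleP c3) sR okE gok4 pok4 f4 r4 hx5 => c4 sR okE gok4 pok4 f4 r4 hx5.
have repr4 : repr c4 (nmem c4 aFS 0) sF by rewrite f4 //; exact: (repr_ext hx5).
have q4 : nmem c4 aQOK 0 = 0 \/ nmem c4 aQOK 0 = 1 /\ exists s, [/\ repr c4 (nmem c4 aQS 0) s,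
      affordable x s & forall j (v : V), j < N -> eligible c x j ->
        (rmem c rDl j <= rmem c4 rTh 0)%R -> nmem c aVert j = v -> v \in s.1].
  rewrite !f4 // r4; case: q2 => [|[q2 [s' [sR' aff' cov']]]]; [by left | right].
  by split=> //; exists s'; split=> //; exact: (repr_ext hx5).
have keep : ((nmem c4 aQOK 0 = 1 /\ (rmem c rDl k <= rmem c4 rTh 0)%R) \/
      forall t, tree_of t ess (group c x N k) -> (x < tree_cost t)%R) -> I k.+1 c4.
  move=> hk; have xx4 : rmem c4 rX 0 = x /\ rmem c4 rX2 0 = (x + x)%R by rewrite !r4.
  split=> // i; rewrite ltnS leq_eqVlt => /orP[/eqP->//|ik] eli.
  by have := f2 i ik eli; rewrite !f4 // r4.
rewrite denE !evalE okE; case: (boolP (_ \subset _)) => sub /=; last first.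
  by apply: keep; right => t /succ tt; rewrite ltNge; apply: contra sub => /tt.
(* The threshold never decreases, so that requests below the old one stay below the new one. *)
have saved : (forall i, i < k -> eligible c x i -> nmem c4 aQOK 0 = 1 ->
    (rmem c4 rTh 0 <= rmem c rDl k)%R) -> I k.+1 (den saveQP c4).
  move=> mono; rewrite /saveQP /LSeqs !denE.
  have k4 : nmem c4 76 0 = k by rewrite f4.
  have d4 : rmem c4 rDl k = rmem c rDl k by rewrite r4 r2.
  have xx4 : rmem c4 rX 0 = x /\ rmem c4 rX2 0 = (x + x)%R by rewrite !r4.
  split=> //.
    right; split=> //; exists s; split=> // j v jN elj le vj.
    apply: (fintype.subsetP sub); rewrite inE; apply/existsP; exists (Ordinal jN).
    rewrite elj /= vj eqxx andbT; move: le; rewrite /= /update /= k4.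
    by rewrite d4.
  move=> i; rewrite /= /update /= k4 d4 ltnS leq_eqVlt => /orP[/eqP->|ik] eli.
    by left.
  have := f2 i ik eli; rewrite -(f4 aQOK) // -(r4 rTh) => -[[qq le]|]; last by right.
  by left; split=> //; apply: (le_trans le); apply: mono ik eli qq.
have th4 : rmem c4 rDl (nmem c4 76 0) = rmem c rDl k by rewrite f4 // r4 r2 // kE.
move: (saveQP) saved => q saved; rewrite ?denE !evalE ?th4; case: leqP => f0.
  by apply: saved => i _ _ qq; rewrite qq in f0.
case: ifP => [le|/negbT]; first by apply: saved.
rewrite -ltNge => lt; apply: keep; left; split; last exact: ltW.
by move: f0; case: q4 => [->|[->]].
Qed.

End Service.


(* A tree on [k] vertices splits in depth [4 * logn2 k], which is at most
   [paramH k * paramD k]; the search has depth [paramD k * 2 ^ paramH k]. *)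
Definition logn2 (k : nat) := (trunc_log 2 k).+1.
Definition paramH (k : nat) := logn2 (logn2 k).
Definition paramD (k : nat) := (4 * logn2 k + (paramH k).-1) %/ paramH k.
(* The running time of the search is multiplied by at most [paramQ k] per level
   of the recursion. *)
Definition paramQ (k : nat) := 1 + 12 * (k * k).

Lemma logn2_gt k : k < 2 ^ logn2 k. Proof. exact: trunc_log_ltn. Qed.

Lemma paramD_geq k : 4 * logn2 k <= paramH k * paramD k.
Proof.
rewrite /paramD /paramH; set a := 4 * _; set b := logn2 _.
have b0 : 0 < b by [].
by have := divn_eq (a + b.-1) b; have := ltn_pmod (a + b.-1) b0; nia.
Qed.

Lemma paramQ_gt k : 4 * (k * (k + k).+1) < paramQ k.
Proof. by rewrite /paramQ; nia. Qed.

(** * Parameters and bookkeeping of an alarm *)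

Section AlarmSteps.
Variables (R : realType) (G : network R).
Local Notation V := 'I_(nv G).
Local Notation n := (nv G).
Local Notation es := (edges G).
Local Notation m := (size (edges G)).
Local Notation rho := (rho G).
Implicit Types (c : config G) (s : gstate V).

Lemma n_gt0 : 0 < n. Proof. exact: leq_ltn_trans (ltn_ord rho). Qed.

Lemma log_loop c i a b e : i \notin [:: a; b] -> a != b ->
  a \notin reads e -> b \notin reads e -> i \notin reads e -> 0 < neval c e ->
  let c' := den (LSeqs [:: Set0 a (NLit 1); Set0 b (NLit 0); LFor i e
    (When (BNLe (vN a) e) (LSeq (Incr a (vN a)) (Incr b (NLit 1))))]) c in
  nmem c' b 0 = logn2 (neval c e) /\ nmem c' a 0 = 2 ^ logn2 (neval c e).
Proof.
rewrite !inE negb_or => /andP[ia ib] ab ae be ie e0 c'; rewrite {}/c' /LSeqs !(den_seq (Set0 _ _)).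
set N := neval c e in e0 *; set F := LFor _ _ _; set c1 := den _ (den _ c).
have NE : neval c1 e = N by rewrite /c1 !denE !neval_setN.
(* Either every round so far has doubled, or the power exceeds [N] and nothing changes any more; the
   last clause makes [l] minimal. *)
pose I j (c' : config G) := exists l, [/\ nmem c' b 0 = l, nmem c' a 0 = 2 ^ l,
  l <= j, (l == j) || (N < 2 ^ l) & (l == 0) || (2 ^ l.-1 <= N)].
suff [l [-> -> lN h1 h2]] : I N (den F c1).
  have lt : N < 2 ^ l by case/orP: h1 => // /eqP->; apply: ltn_expl.
  case: l lN h1 h2 lt => [|l] _ _ h2 lt; first by move: lt; rewrite expn0; case: (N) e0.
  by rewrite /logn2 (trunc_log_eq (n := l)) //; apply/andP.
rewrite -NE; apply: den_for => //.
- by rewrite /= !inE negb_or ia ib.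
- exists 0; rewrite /c1 !denE /= /update /= !eqxx (negbTE ab).
  by rewrite !(eq_sym _ i) (negbTE ia) (negbTE ib) //=.
move=> j c' jN jE fr _ [l [bl al lj h1 h2]]; rewrite NE in jN.
have eE : neval c' e = N.
  rewrite -NE; apply: neval_reads => x xe; apply: fr; rewrite !inE !negb_or.
  by apply/and3P; split; apply: contraTneq xe => ->.
rewrite denE !evalE eE al; case: leqP => le.
  exists l.+1; rewrite !denE /= /update /= ![_ == i]eq_sym (negbTE ia) (negbTE ib) !eqxx /=.
  rewrite (eq_sym b a) (negbTE ab) /= bl al addn1 addnn expnS mul2n; split=> //.
  case/orP: h1 => [/eqP->|lt]; first by rewrite eqxx.
  by move: lt; rewrite ltnNge le.
exists l; rewrite /= /update /= ![_ == i]eq_sym (negbTE ia) (negbTE ib) /=; split=> //.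
  exact: leqW.
by rewrite le orbT.
Qed.

Lemma params1_spec c : graph_ok c -> let c' := den params1P c in nmem c' aL 0 = logn2 n.
Proof.
move=> [nE _ _ _ _]; have := @log_loop c 81 aP2 aL nN isT isT isT isT isT.
by rewrite /nN evalE /= nE => /(_ n_gt0)[].
Qed.

Lemma params2_spec c : nmem c aL 0 = logn2 n -> let c' := den params2P c in
  nmem c' aH 0 = paramH n /\ nmem c' aA 0 = 2 ^ paramH n.
Proof.
move=> LE; have := @log_loop c 82 aA aH (vN aL) isT isT isT isT isT.
by rewrite evalE LE; apply.
Qed.

Lemma params3_spec c : nmem c aL 0 = logn2 n -> nmem c aH 0 = paramH n ->
  nmem (den params3P c) aD 0 = paramD n.
Proof.
move=> LE HE; rewrite /params3P /LSeqs !(den_seq (Set0 _ _)).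
set F := LFor _ _ _; set c1 := den _ (den _ c).
have four c' : nmem c' aL = nmem c aL -> neval c' fourL = 4 * logn2 n.
  by move=> e; rewrite /fourL !evalE e LE; lia.
pose I j (c' : config G) := exists d, [/\ nmem c' aD 0 = d, nmem c' aSum 0 = paramH n * d,
  d <= j, (d == j) || (4 * logn2 n <= paramH n * d) & (d == 0) || (paramH n * d.-1 < 4 * logn2 n)].
have h0 : 0 < paramH n by [].
have HE1 : nmem c1 aH 0 = paramH n by [].
have [d [-> _ dj h1 h2]] : I (4 * logn2 n) (den F c1).
  rewrite -{1}(four c1) //; apply: den_for => //.
    by exists 0; rewrite muln0.
  move=> j c' jN jE fr _ [d [dE sE dj h1 h2]]; rewrite (four c1) // in jN.
  rewrite denE (_ : beval c' _ = (nmem c' aSum 0 < 4 * logn2 n)); last first.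
    by rewrite ltnNge -(four c') // fr.
  rewrite sE; case: ltnP => lt.
    exists d.+1; rewrite !denE /= /update /= dE sE (fr aH) // HE1 addn1 mulnS addnC; split=> //.
    case/orP: h1 => [/eqP->|]; first by rewrite eqxx.
    by rewrite leqNgt lt.
  by exists d; rewrite /= /update /=; split=> //; [exact: leqW | rewrite lt orbT].
have lo : 4 * logn2 n <= paramH n * d.
  by case/orP: h1 => // /eqP->; rewrite leq_pmull.
have hi : paramH n * d < 4 * logn2 n + paramH n.
  by case/orP: h2 => [/eqP->|]; [rewrite muln0 addn_gt0 h0 orbT | case: (d) => [|d'] /=; rewrite ?mulnS; lia].
rewrite /paramD; apply/eqP; rewrite eqn_leq; apply/andP; split.
  by rewrite leq_divRL // mulnC; lia.
by rewrite -ltnS ltn_divLR // mulSn mulnC; lia.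
Qed.

Lemma params4_spec c : nmem c aD 0 = paramD n -> nmem c aA 0 = 2 ^ paramH n ->
  nmem (den params4P c) aKT 0 = paramD n * 2 ^ paramH n.
Proof.
move=> DE AE; rewrite /params4P den_seq; set F := LFor _ _ _; set c1 := den _ c.
pose I j (c' : config G) := nmem c' aKT 0 = j * 2 ^ paramH n.
have NE : neval c1 (vN aD) = paramD n by [].
have AE1 : nmem c1 aA 0 = 2 ^ paramH n by [].
rewrite -[nmem _ _ _]/(nmem (den F c1) aKT 0); suff : I (paramD n) (den F c1) by [].
rewrite -NE; apply: den_for => // j c' _ _ fr _ Ij.
by rewrite /I denE /= /update /= Ij (fr aA) // AE1 mulSn addnC.
Qed.

Lemma params5_spec c : graph_ok c -> nmem (den params5P c) aQ 0 = paramQ n.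
Proof.
move=> [nE _ _ _ _]; rewrite /params5P den_seq; set F := LFor _ _ _; set c1 := den _ c.
have NE : neval c1 nN = n by [].
pose I j (c' : config G) := nmem c' aQ 0 = 1 + 12 * (j * n).
suff : I n (den F c1) by [].
rewrite -{1}NE; apply: den_for => // j c' _ _ fr _ Ij.
have NE' : neval c' nN = n by rewrite /nN evalE fr.
pose J i (c' : config G) := nmem c' aQ 0 = 1 + 12 * (j * n + i).
suff JE : J n (den (LFor 86 nN (Incr aQ (NLit 12))) c').
  by rewrite /I /= /update /= JE (mulSnr j).
rewrite -{1}NE'; apply: den_for => //; first by rewrite /J addn0.
by move=> i c'' _ _ _ _ Ji; rewrite /J denE /= /update /= Ji; lia.
Qed.

Lemma params6_spec c : nmem (den params6P c) aBig 0 = nmem c aQ 0 ^ nmem c aKT 0.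
Proof.
rewrite /params6P den_seq; set F := LFor _ _ _; set c1 := den _ c.
pose I j (c' : config G) := nmem c' aBig 0 = nmem c aQ 0 ^ j.
have NE : neval c1 (vN aKT) = nmem c aKT 0 by [].
suff : I (nmem c aKT 0) (den F c1) by [].
rewrite -NE; apply: den_for => // j c' _ _ fr _ Ij.
rewrite /LSeqs !den_seq; set c2 := den (Set0 aTmp _) c'; set F2 := LFor _ _ _.
have NE' : neval c2 (vN aQ) = nmem c aQ 0 by rewrite evalE nmem_den // fr.
pose J i (c' : config G) := nmem c' aTmp 0 = i * nmem c aQ 0 ^ j /\ nmem c' aBig 0 = nmem c aQ 0 ^ j.
have [j1 j2] : J (nmem c aQ 0) (den F2 c2).
  rewrite -{1}NE'; apply: (@den_for _ _ J) => //.
  move=> i c'' _ _ _ _ [J1 J2]; rewrite denE /J /= /update /= J1 J2.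
  by split=> //; rewrite mulSn addnC.
by move: (den F2 c2) j1 j2 => c3 j1 j2; rewrite denE /I /= /update /= j1 expnS.
Qed.

Lemma den_mark c e e' : onth es (neval c e) = Some e' ->
  den (LMark e) c = set_marked (e' |: marked c)%SET c.
Proof. by move=> on; rewrite -[LHS]/(if onth es (neval c e) is Some e' then _ else _) on. Qed.

Lemma mark_spec c (X : pred nat) : graph_ok c ->
  (forall j, j < m -> X j = (0 < nmem c aS (nmem c aFS 0 + j)) ||
    (0 < nmem c aQOK 0) && (0 < nmem c aS (nmem c aQS 0 + j))) ->
  let c' := den markP c in [/\ sent c' = sent c, alarm c' = alarm c
    & marked c' = (marked c :|: [set e | (e \in es) && X (index e es)])%SET].
Proof.
move=> gok XE c'; have mE : neval c nM = m by case: gok.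
pose I k (c' : config G) := [/\ sent c' = sent c, alarm c' = alarm c & marked c' =
  (marked c :|: [set e | [&& e \in es, index e es < k & X (index e es)]])%SET].
have [-> -> ->] : I m c'.
  rewrite -mE; apply: den_for => //.
    by split=> //; apply/setP => e; rewrite !inE ltn0 andbF orbF.
  move=> k c1 km kE fr _ [s1 a1 m1]; rewrite mE in km.
  have on : onth es k = Some (edge_at G k) by rewrite onthE (nth_map (rho, rho)).
  have f a : a \notin [:: 78] -> nmem c1 a = nmem c a by move=> aN; apply: fr.
  rewrite den_seq; set q := When _ _; set p := When _ _.
  pose addk (b : bool) (c2 : config G) := if b then set_marked (edge_at G k |: marked c2)%SET c2 else c2.
  have pE : den p c1 = addk (0 < nmem c aS (nmem c aFS 0 + k)) c1.
    rewrite /p denE !evalE kE !f // /addk; case: ifP => // _.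
    by rewrite (den_mark (e' := edge_at G k)) // evalE kE.
  have qE : den q (den p c1) = addk ((0 < nmem c aQOK 0) && (0 < nmem c aS (nmem c aQS 0 + k))) (den p c1).
    rewrite /q den_when2 !evalE !(nmem_den, kE) // !f // /addk; case: ifP => // _.
    by rewrite (den_mark (e' := edge_at G k)) // evalE nmem_den // kE.
  rewrite qE pE; have -> : forall b b' (c2 : config G), addk b' (addk b c2) = addk (b || b') c2.
    case=> [] [] c2 //; rewrite /addk /= /set_marked /=; congr Config.
    by apply/setP => e; rewrite !inE; case: (e == _).
  rewrite -XE // /addk; case: ifP => Xk; split=> //; rewrite /= m1; apply/setP => e; rewrite !inE.
    have [->|ek] := eqVneq e (edge_at G k).
      by rewrite edge_at_mem // /edge_at index_uniq ?enum_uniq // ltnSn Xk orbT.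
    case: (boolP (e \in es)) => //= ein; congr (_ || (_ && _)); rewrite [RHS]ltnS [RHS]leq_eqVlt.
    by case: eqP => [ik|] //=; case/eqP: ek; rewrite -(nth_index (rho, rho) ein) ik.
  case: (boolP (e \in es)) => //= ein; congr (_ || _); rewrite ltnS [in RHS]leq_eqVlt.
  by case: eqP => [->|] //=; rewrite Xk andbF.
split=> //; congr (_ :|: _)%SET; apply/setP => e; rewrite !inE.
by case: (boolP (e \in es)) => //= ein; rewrite index_mem ein.
Qed.

Definition dropped c x j := [&& eligible c x j, 0 < nmem c aQOK 0
  & (rmem c rDl j <= rmem c rTh 0)%R].

Lemma update_spec c x : rmem c rX2 0 = (x + x)%R -> let c' := den updateP c in
  forall j, j < nmem c aCnt 0 ->
    nmem c' aPend j = (if (j == nmem c aNext 0 - 1) || dropped c x j then 0 else nmem c aPend j) /\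
    rmem c' rLv j = (if eligible c x j then (x + x) + (x + x) else rmem c rLv j)%R.
Proof.
move=> xE; rewrite /updateP den_seq; set F := LFor _ _ _; set N := nmem c aCnt 0.
pose I (k : nat) (c' : config G) := forall j : nat,
    nmem c' aPend j = (if (j < k) && dropped c x j then 0 else nmem c aPend j) /\
    rmem c' rLv j = (if (j < k)%N && eligible c x j then (x + x) + (x + x) else rmem c rLv j)%R.
have H : I N (den F c).
  rewrite -[N]/(neval c (vN aCnt)); apply: den_for => // k c1 _ kE fr frR Ik.
  have f a : a \notin [:: 79; aPend] -> nmem c1 a = nmem c a by move=> ?; apply: fr.
  have r a : a \notin [:: rLv] -> rmem c1 a = rmem c a by move=> ?; apply: frR.
  have [pk lk] := Ik k; rewrite ltnn /= in pk lk.
  rewrite den_when2 !evalE kE pk lk r // xE -/(eligible c x k).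
  have step_j (P : nat -> bool) j : (j < k.+1) && P j = if j == k then P k else (j < k) && P j.
    by rewrite ltnS leq_eqVlt; case: eqP => [->|].
  case: (boolP (eligible c x k)) => el; last first.
    move=> j; have [pj lj] := Ik j; rewrite -[nmem _ _ _]/(nmem c1 aPend j) -[rmem (bump _ _) _ _]/(rmem c1 rLv j).
    rewrite pj lj !step_j {2}/dropped (negbTE el).
    by case: eqP => [->|]//; rewrite ltnn.
  rewrite den_seq; set c2 := den (LR _ _ _) c1.
  have p2 j : nmem c2 aPend j = nmem c1 aPend j by [].
  have l2 j : rmem c2 rLv j = if j == k then ((x + x) + (x + x))%R else rmem c1 rLv j.
    by rewrite /c2 denE /= /update /= kE r // xE.
  have k2 : nmem c2 79 0 = k by [].
  have r2 a : a != rLv -> rmem c2 a = rmem c a.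
    by move=> aL; rewrite /c2 denE /= update_neq // r // inE.
  have f2 a : a \notin [:: 79; aPend] -> nmem c2 a = nmem c a by exact: f.
  move: (c2) p2 l2 k2 r2 f2 => {}c2 p2 l2 k2 r2 f2.
  rewrite den_when2 !evalE k2 !r2 // f2 //.
  have drE : dropped c x k = (0 < nmem c aQOK 0) && (rmem c rDl k <= rmem c rTh 0)%R.
    by rewrite /dropped el.
  rewrite -drE => j; have [pj lj] := Ik j; rewrite !step_j el; split; last first.
    have -> : rmem (bump 79 (if dropped c x k then den (LN aPend (vN 79) (NLit 0)) c2 else c2)) rLv j
       = rmem c2 rLv j by case: ifP.
    by rewrite l2 lj; case: ifP.
  case: ifP => dr /=; rewrite ?denE /= /update /= ?k2 ?p2 ?pj.
    by case: eqP.
  by case: eqP => // ->; rewrite ltnn.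
have f a : a \notin [:: 79; aPend] -> nmem (den F c) a = nmem c a by move=> ?; rewrite nmem_den.
move: (den F c) H f => c1 H f j jN; have [pj lj] := H j; rewrite jN /= in pj lj.
rewrite denE /= /update /= f // lj pj; split=> //.
by case: eqP => //=.
Qed.

Lemma alarm_spec c : let c' := den alarmP c in let N := nmem c aCnt 0 in
  [/\ sent c' = sent c, marked c' = marked c
   & (nmem c' aNext 0 = 0 /\ alarm c' = alarm c /\ forall j, j < N -> nmem c aPend j = 0) \/
     exists k, [/\ nmem c' aNext 0 = k.+1, k < N, 0 < nmem c aPend k,
       alarm c' = Some (rmem c rDl k)
       & forall j, j < N -> 0 < nmem c aPend j -> (rmem c rDl k <= rmem c rDl j)%R]].
Proof.
move=> c' N; rewrite {}/c' /alarmP /LSeqs !den_seq; set F := LFor _ _ _; set c1 := den _ c.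
pose I (i : nat) (c' : config G) := outputs c' = outputs c /\
 ((nmem c' aNext 0 = 0 /\ forall j, j < i -> nmem c aPend j = 0) \/
     exists k, [/\ nmem c' aNext 0 = k.+1, k < i, 0 < nmem c aPend k
       & forall j, j < i -> 0 < nmem c aPend j -> (rmem c rDl k <= rmem c rDl j)%R]).
have [ou H] : I N (den F c1).
  rewrite -[N]/(neval c1 (vN aCnt)); apply: den_for => //; first by split=> //; left.
  move=> i c2 _ iE fr frR [ou2 H2].
  have f a : a \notin [:: 80; aNext] -> nmem c2 a = nmem c a.
    rewrite !inE negb_or => /andP[h1 h2].
    by rewrite fr ?nmem_den // !inE ?negb_or ?h1 ?h2.
  have r a : rmem c2 a = rmem c a by rewrite frR.
  have set_ : nmem (den setNextP c2) aNext 0 = i.+1 /\ outputs (den setNextP c2) = outputs c2.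
    by rewrite /setNextP denE /= /update /= iE addn1.
  have pk : forall p, outputs (bump 80 p) = outputs p by [].
  rewrite denE !evalE iE f //; case: posnP => [p0|p0].
    split=> //; case: H2 => [[n0 z]|[k [n0 ki pkk mn]]]; [left | right].
      by split=> // j; rewrite ltnS leq_eqVlt => /orP[/eqP->|/z].
    exists k; split=> //; first exact: leqW.
    by move=> j; rewrite ltnS leq_eqVlt => /orP[/eqP->|/mn//]; rewrite p0.
  move: setNextP set_ => q [q1 q2]; rewrite ?denE !evalE.
  case: H2 => [[n0 z]|[k [n0 ki pkk mn]]]; rewrite n0 /=.
    split; first by rewrite pk q2.
    right; exists i; split=> //.
    by move=> j; rewrite ltnS leq_eqVlt => /orP[/eqP->|/z->].
  rewrite subn1 iE !r /=; case: ifP => [le|/negbT].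
    split; first by rewrite pk q2.
    right; exists i; split=> //.
    move=> j; rewrite ltnS leq_eqVlt => /orP[/eqP->//|ji] pj.
    by apply: le_trans le _; apply: mn.
  rewrite -ltNge => /ltW lt; split=> //; right; exists k; split=> //; first exact: leqW.
  by move=> j; rewrite ltnS leq_eqVlt => /orP[/eqP->|/mn].
have r a : rmem (den F c1) a = rmem c a by rewrite rmem_den.
move: (den F c1) ou H r => c2 [a2 m2 s2] H r.
rewrite denE !evalE; case: H => [[n0 z]|[k [n0 ki pk mn]]]; rewrite n0 /=.
  by split=> //; left.
rewrite n0 subn1 r.
by split=> //; right; exists k.
Qed.

End AlarmSteps.

Local Open Scope ring_scope.

(** * Charging the offline solution *)

Section Weights.
Variable R : realType.

(* The part of the cost [c] of an edge that pays for a service of level [x] in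
   a network on [n] vertices. *)
Definition weight (n : nat) (x c : R) : R := if x < (8 * n)%:R * c then Num.min c x else 0.

Lemma weight_ge0 n x c : 0 <= c -> 0 <= x -> 0 <= weight n x c.
Proof. by move=> c0 x0; rewrite /weight; case: ifP => // _; rewrite le_min c0. Qed.

Lemma sum_halving (x : R) xs : pairwise (fun a b => 2 * b <= a) (x :: xs) ->
  all (fun a => 0 < a) (x :: xs) -> \sum_(a <- x :: xs) a <= 2 * x.
Proof.
elim: xs x => [|y xs IH] x; first by rewrite big_seq1 /= => _ /andP[]; lra.
move=> /= /andP[/andP[xy _] pw] /andP[x0 pos]; rewrite big_cons.
by have := IH y pw pos; lra.
Qed.

(** Each of the [M] doublings from [c] up to [2 ^+ M * c] holds at most one element, which
    contributes at most [c]; the elements below [c] form a geometric sum of at most [2 * c]. *)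
Lemma sum_min_halving M (c : R) xs : 0 < c -> pairwise (fun a b => 2 * b <= a) xs ->
  all (fun a => 0 < a) xs -> all (fun a => a < 2 ^+ M * c) xs ->
  \sum_(a <- xs) Num.min c a <= M.+2%:R * c.
Proof.
move=> c0; elim: M xs => [|M IH] xs pw pos le.
  apply: (@le_trans _ _ (\sum_(a <- xs) a)).
    by apply: ler_sum => a _; rewrite ge_min lexx orbT.
  case: xs pw pos le => [|x xs] pw pos; first by rewrite big_nil mulr_ge0 // ltW.
  move=> /= /andP[]; rewrite expr0 mul1r => xc _.
  by apply: le_trans (sum_halving pw pos) _; lra.
case: xs pw pos le => [|x xs]; first by rewrite big_nil mulr_ge0 // ltW.
move=> /= /andP[/allP hx pw] /andP[x0 pos] /andP[xc _].
rewrite big_cons -natr1 mulrDl mul1r addrC lerD // ?ge_min ?lexx //.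
apply: IH => //; apply/allP => a axs; have := hx a axs.
by move: xc; rewrite exprS -mulrA; lra.
Qed.

Lemma sum_weight_halving n M (c : R) xs : 0 < c -> (8 * n <= 2 ^ M)%N ->
  pairwise (fun a b => 2 * b <= a) xs -> all (fun a => 0 < a) xs ->
  \sum_(x <- xs) weight n x c <= M.+2%:R * c.
Proof.
move=> c0 nM; elim: xs => [|x xs IH]; first by rewrite big_nil mulr_ge0 // ltW.
move=> pwx posx; have /andP[/allP hx pw] := pwx; have /andP[x0 pos] := posx.
have nMR : (8 * n)%:R * c <= 2 ^+ M * c.
  by rewrite ler_pM2r // -natrX ler_nat.
have [big|small] := leP ((8 * n)%:R * c) x.
  by rewrite big_cons {1}/weight ltNge big add0r; apply: IH.
have le : \sum_(a <- x :: xs) weight n a c <= \sum_(a <- x :: xs) Num.min c a.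
  rewrite big_seq [leRHS]big_seq; apply: ler_sum => a axs.
  by have /allP/(_ a axs) a0 := posx; rewrite /weight; case: ifP; rewrite // le_min !ltW.
apply: le_trans le _; apply: sum_min_halving => //.
apply/allP => a; rewrite inE => /orP[/eqP->|axs]; first exact: lt_le_trans nMR.
have := hx a axs; have /allP/(_ a axs) := pos; move: small nMR; lra.
Qed.

End Weights.

Section Charging.
Variables (R : realType) (G : network R).
Local Notation V := 'I_(nv G).
Local Notation n := (nv G).
Local Notation es := (edges G).
Local Notation rho := (rho G).
Local Notation ess := [set e in es]%SET.

Definition set_weight (x : R) (F : {set V * V}) := \sum_(e in F) weight n x (ecost e).

(* A service of level [x] in the network costs at least a constant fraction of
   [x] for the offline solution, even when only [weight] is accounted for. *)
Definition certified (x : R) (T : {set V}) := forall F : {set V * V}, F \subset ess ->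
  (forall v, v \in T -> reaches F v) -> x <= 8 * set_weight x F.

(** A spanning tree of [F] costs at least [x / 4]. If one of its edges costs at least [x], that edge
    alone weighs [x]. Otherwise only edges of cost at most [x / (8 * n)] lose their weight; there
    are fewer than [n] edges, so at most [x / 8] is lost and [x / 8] remains. *)
Lemma certifiedP x T : 0 < x ->
  (forall t, tree_of t ess T -> x <= 4 * @tree_cost R G t) -> certified x T.
Proof.
move=> x0 H F Fe Fr; have [t [u sub cov]] := spanning_tree rho F.
have tF : tree_of t F T by split=> // v /Fr; apply: cov.
have C : x <= 4 * tree_cost t.
  by apply: H; split=> //; [move=> e /sub; apply: (fintype.subsetP Fe) | case: tF].
have c0 e : e \in F -> 0 < ecost e.
  by move/(fintype.subsetP Fe); rewrite inE; apply: edges_gt0.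
have uts : uniq (tedges rho t) by move: u => /= /andP[_ /map_uniq].
have le : \sum_(e <- tedges rho t) weight n x (ecost e) <= set_weight x F.
  rewrite /set_weight big_uniq //= [leRHS](bigID (mem (tedges rho t))) /=.
  rewrite (eq_bigl (fun e => (e \in F) && (e \in tedges rho t))); last first.
    by move=> e /=; case: (boolP (e \in tedges rho t)) => [/sub->|]; rewrite ?andbF.
  rewrite lerDl; apply: sumr_ge0 => e /andP[eF _].
  by apply: weight_ge0; rewrite ltW // c0.
suff : x <= 8 * \sum_(e <- tedges rho t) weight n x (ecost e) by move: le; lra.
have n0 : 0 < n%:R :> R by rewrite ltr0n n_gt0.
have n1 : 1 <= n%:R :> R by rewrite ler1n n_gt0.
have w0 e : e \in tedges rho t -> 0 <= weight n x (ecost e).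
  by move/sub/c0 => e0; apply: weight_ge0; rewrite ltW.
have [/hasP[e et xe]|/hasPn small] := boolP (has (fun e => x <= ecost e) (tedges rho t)).
  have wE : weight n x (ecost e) = x.
    rewrite /weight ifT ?min_r // natrM; move: (c0 _ (sub _ et)) => e0.
    have : 1 * ecost e <= n%:R * ecost e by rewrite ler_pM2r.
    by rewrite mul1r -mulrA; lra.
  rewrite (big_rem e) //= wE.
  have : 0 <= \sum_(y <- rem e (tedges rho t)) weight n x (ecost y).
    by rewrite big_seq; apply: sumr_ge0 => y /mem_rem; apply: w0.
  lra.
have wge e : e \in tedges rho t -> ecost e - x / (8 * n%:R) <= weight n x (ecost e).
  move=> et; have := small e et; rewrite -ltNge /weight => ex.
  have x8 : 0 <= x / (8 * n%:R) by rewrite divr_ge0 ?mulr_ge0 // ltW.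
  case: ifP => [_|/negbT]; first by rewrite (min_l (ltW ex)) gerBl.
  rewrite -leNgt natrM => le8; rewrite subr_le0 ler_pdivlMr ?mulr_gt0 //.
  by rewrite mulrC.
have : \sum_(e <- tedges rho t) (ecost e - x / (8 * n%:R)) <=
    \sum_(e <- tedges rho t) weight n x (ecost e).
  by rewrite big_seq [leRHS]big_seq; apply: ler_sum => e; apply: wge.
rewrite sumrB -/(tree_cost t) big_const_seq count_predT iter_addr_0 size_tedges.
have tn : (tsize t)%:R <= n%:R :> R by rewrite ler_nat ltnW // tree_size.
have : (x / (8 * n%:R)) *+ tsize t <= x / 8.
  rewrite -mulr_natr invfM mulrA -mulrA ler_piMr ?divr_ge0 ?(ltW x0) //.
  by rewrite mulrC ler_pdivrMr // mul1r.
by move: C; rewrite -/(tree_cost t); lra.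
Qed.

(* Time, level, and the requests that certify the level. *)
Definition service := (R * R * seq (request R n))%type.
Definition stime (l : service) := l.1.1.
Definition slevel (l : service) := l.1.2.
Definition sreqs (l : service) := l.2.
Definition vertices (Q : seq (request R n)) : {set V} :=
  [set v | has (fun q => rvertex q == v) Q]%SET.

Definition service_ok (rs : seq (request R n)) (l : service) :=
  [/\ 0 < slevel l, {subset sreqs l <= rs},
    (forall q, q \in sreqs l -> deadline q <= stime l)
  & certified (slevel l) (vertices (sreqs l))].

(* [l] comes after [l']. *)
Definition separated (l l' : service) :=
  all (fun q => (release q <= stime l') ==> (2 * slevel l' < slevel l)) (sreqs l).

(** The certifying requests expire by [stime l], so a transmission outside this window serves none
    of them. *)
Definition sees (l : service) (tr : R * {set V * V}) :=
  has (fun q => release q <= tr.1) (sreqs l) && (tr.1 <= stime l).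

(* The services that see a transmission have levels that more than double, and an
   edge of cost [c] only counts for levels below [8 n c]: the levels up to [c]
   contribute a geometric sum, the O(log n) others [c] each. *)
Lemma charging (log : seq service) rs S M : (8 * n <= 2 ^ M)%N -> feasible rs S ->
  {in log, forall l, service_ok rs l} -> pairwise separated log ->
  \sum_(l <- log) slevel l <= (8 * M.+2)%:R * schedule_cost S.
Proof.
move=> nM [Sedges Sserved] ok pw.
have c0 tr e : tr \in S -> e \in tr.2 -> 0 < ecost e.
  by case: tr => t E' trS eE; apply: ecost_gt0; apply: Sedges trS eE.
have step1 l : l \in log -> slevel l <= 8 * \sum_(tr <- S | sees l tr) set_weight (slevel l) tr.2.
  move=> ll; have [x0 Qrs Qd cert] := ok l ll.
  (* Offline, every certifying request is served by a transmission that [l] sees, so the union of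
     these transmissions reaches all certifying vertices. *)
  pose F := [set e | has (fun tr => sees l tr && (e \in tr.2)) S]%SET.
  have Fess : F \subset ess.
    apply/fintype.subsetP => e; rewrite !inE => /hasP[[t E'] trS /andP[_ eE]].
    by rewrite mem_enum inE; apply: Sedges trS eE.
  have Fr v : v \in vertices (sreqs l) -> reaches F v.
    rewrite inE => /hasP[q qQ /eqP<-].
    have [t [E' [trS rt td con]]] := Sserved q (Qrs q qQ).
    apply: (connect_sub _ con) => a b /= ab; apply: connect1; rewrite /= inE.
    apply/hasP; exists (t, E') => //=; rewrite ab andbT /sees /=.
    rewrite (le_trans td (Qd q qQ)) andbT; apply/hasP; exists q => //.
  have := cert F Fess Fr.
  suff : set_weight (slevel l) F <= \sum_(tr <- S | sees l tr) set_weight (slevel l) tr.2 by lra.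
  pose W (e : V * V) := weight n (slevel l) (ecost e).
  have W0 tr e : tr \in S -> e \in tr.2 -> 0 <= W e.
    by move=> trS eE; apply: weight_ge0; rewrite ltW // (c0 tr).
  apply: (@le_trans _ _ (\sum_(e in F) \sum_(tr <- S | sees l tr && (e \in tr.2)) W e)).
    apply: ler_sum => e; rewrite inE => /hasP[tr trS sE].
    rewrite (big_rem tr) //= sE lerDl big_seq_cond; apply: sumr_ge0 => tr' /and3P[tr'S _ eE].
    exact: (W0 tr' _ (mem_rem tr'S)).
  rewrite (exchange_big_dep (sees l)) /=; last by move=> e tr _ /andP[].
  rewrite big_seq_cond [leRHS]big_seq_cond; apply: ler_sum => tr /andP[trS sl].
  rewrite [leRHS](bigID (mem F)) /= (eq_bigl (fun e => (e \in tr.2) && (e \in F))).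
    by rewrite lerDl; apply: sumr_ge0 => e /andP[eE _]; exact: (W0 tr).
  by move=> e; rewrite sl andbC.
apply: (@le_trans _ _ (\sum_(l <- log) 8 * \sum_(tr <- S | sees l tr) set_weight (slevel l) tr.2)).
  by rewrite big_seq [leRHS]big_seq; apply: ler_sum => l ll; exact: step1.
rewrite -mulr_sumr natrM -mulrA ler_pM2l //.
rewrite (exchange_big_dep xpredT) //= /schedule_cost mulr_sumr.
rewrite big_seq [leRHS]big_seq; apply: ler_sum => tr trS.
rewrite /set_weight exchange_big /= mulr_sumr; apply: ler_sum => e eE.
have e0 := c0 tr e trS eE.
rewrite -(big_filter log) -[\sum_(i <- _) _](big_map slevel xpredT (fun x => weight n x (ecost e))).
apply: sum_weight_halving => //; last first.
  by apply/allP => x /mapP[l]; rewrite mem_filter => /andP[_ ll] ->; have [] := ok l ll.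
(* If both services see [tr], some certifying request of the later one is released by [tr.1], thus
   by the time of the earlier one, and [separated] applies. *)
rewrite pairwise_map; apply: sub_in_pairwise (filter_all _ _) (pairwise_filter (sees^~ tr) pw).
move=> l l' /andP[/hasP[q qQ rt] _] /andP[_ tl'] /allP/(_ q qQ)/implyP lt.
by apply/ltW/lt/(le_trans rt).
Qed.

End Charging.


(** * The online invariant *)

Lemma ltn_count_in (T : eqType) (x : T) (a b : pred T) s : x \in s ->
  {in s, subpred a b} -> b x -> ~~ a x -> (count a s < count b s)%N.
Proof.
move=> /splitPr[s1 s2] ab bx ax; rewrite !count_cat /= bx (negbTE ax) add0n add1n addnS ltnS.
have le s' : {subset s' <= s1 ++ x :: s2} -> (count a s' <= count b s')%N.
  elim: s' => //= y s' IH sub; apply: leq_add; last first.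
    by apply: IH => z zs; apply: sub; rewrite inE zs orbT.
  by have := ab y (sub y (mem_head _ _)); case: (a y) => // ->.
by apply: leq_add; apply: le => y ys; rewrite mem_cat ?inE ys ?orbT.
Qed.

Section Online.
Variables (R : realType) (G : network R) (rs : seq (request R (nv G))).
Hypothesis rs_ok : valid_input rs.
Local Notation V := 'I_(nv G).
Local Notation n := (nv G).
Local Notation es := (edges G).
Local Notation m := (size (edges G)).
Local Notation rho := (rho G).
Local Notation ess := [set e in es]%SET.
Local Notation request := (request R n).
Implicit Types (c : config G) (arr : seq request) (log : seq (service G)).

Definition req arr (j : nat) : request := nth (rho, (0, 0)) arr j.
Definition pending c (j : nat) : bool := (0 < nmem c aPend j)%N.
(** Cost of a service per unit of its level: two oracle solutions of twice [logn2 n * (paramD n).+1]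
    each. *)
Definition gammaN : nat := (4 * (logn2 n * (paramD n).+1))%N.

(** Entry [j] of the request arrays describes the [j]-th released request. The services in [log],
    latest first, exist in the proof only. [inv_cert] attaches to a nonzero level requests that
    expire no later than its owner, so that a service at that level, run at the deadline of the
    owner, inherits them as its certificate; its last clause and [inv_level] make the next service
    [separated] from the former ones. [inv_past] settles the requests still to come. [inv_count]
    holds because every service ends at least one pending request; it bounds the number of
    services. *)
Record base c arr log : Prop := Base {
  inv_todo : todo c = [::];
  inv_marked : marked c = finset.set0;
  inv_rs : rs = arr ++ upcoming c;
  inv_graph : graph_ok c;
  inv_cnt : nmem c aCnt 0 = size arr;
  inv_vert : forall j, (j < size arr)%N -> nmem c aVert j = rvertex (req arr j);
  inv_dl : forall j, (j < size arr)%N -> rmem c rDl j = deadline (req arr j);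
  inv_pend : forall j, (j < size arr)%N -> pending c j ->
    [/\ rvertex (req arr j) != rho, release (req arr j) <= now c
      & now c <= deadline (req arr j)];
  inv_log : {in log, forall l, service_ok rs l};
  inv_sep : pairwise (@separated R G) log;
  inv_past : forall l q, l \in log -> q \in upcoming c -> stime l < release q;
  inv_level : forall j l, (j < size arr)%N -> pending c j -> l \in log ->
    release (req arr j) <= stime l -> 2 * slevel l < rmem c rLv j;
  inv_cert : forall j, (j < size arr)%N -> pending c j -> rmem c rLv j != 0 ->
    0 < rmem c rLv j /\ exists Q : seq request, [/\ {subset Q <= rs},
      forall q, q \in Q -> deadline q <= deadline (req arr j),
      certified (rmem c rLv j) (vertices Q)
      & forall l q, l \in log -> q \in Q -> release q <= stime l ->
          2 * slevel l < rmem c rLv j];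
  inv_served : forall j, (j < size arr)%N -> ~~ pending c j -> served (sent c) (req arr j);
  inv_edges : forall t E' e, (t, E') \in sent c -> e \in E' -> edge e.1 e.2;
  inv_cost : schedule_cost (sent c) <= gammaN%:R * \sum_(l <- log) slevel l;
  inv_count : (size log + count (pending c) (iota 0 (size arr)) <= size arr)%N }.

Definition alarm_ok c (N : nat) :=
  (nmem c aNext 0 = 0%N /\ alarm c = None /\
      forall j, (j < N)%N -> nmem c aPend j = 0%N) \/
    exists k, [/\ nmem c aNext 0 = k.+1, (k < N)%N, pending c k,
      alarm c = Some (rmem c rDl k)
      & forall j, (j < N)%N -> pending c j -> rmem c rDl k <= rmem c rDl j].

Definition inv c arr log := base c arr log /\ alarm_ok c (size arr).

Lemma served_rcons (S : schedule G) tr q : served S q -> served (rcons S tr) q.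
Proof.
by case=> t [E' [tS rt td con]]; exists t, E'; split=> //; rewrite mem_rcons inE tS orbT.
Qed.

Lemma cost_rcons (S : schedule G) (t : R) E' :
  schedule_cost (rcons S (t, E')) = schedule_cost S + edge_cost E'.
Proof. by rewrite /schedule_cost -cats1 big_cat big_seq1. Qed.

Lemma req_mem arr q2 j : rs = arr ++ q2 -> (j < size arr)%N -> req arr j \in rs.
Proof. by move=> -> jN; rewrite mem_cat mem_nth. Qed.

Lemma release_sorted arr q2 j q : rs = arr ++ q2 -> (j < size arr)%N -> q \in q2 ->
  release (req arr j) <= release q.
Proof.
move=> rsE jN qq; case: rs_ok => so _ _; move: so; rewrite rsE.
rewrite sorted_pairwise; last by move=> a b d; apply: le_trans.
rewrite pairwise_cat => /and3P[/allrelP H _ _]; apply: H => //; exact: mem_nth.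
Qed.

Lemma todo_den p c : todo (den p c) = todo c.
Proof. by have /(congr1 (@todo R G)) := den_todo p (todo c) c; case: c. Qed.

Lemma req_rcons arr q j : req (rcons arr q) j = if j == size arr then q else req arr j.
Proof. by rewrite /req nth_rcons; case: ltngtP => // lt; rewrite nth_default // ltnW. Qed.

(** [alarmP] does not switch off an old alarm; the second premise excludes an alarm left over
    without pending requests. *)
Lemma alarm_step c arr log : base c arr log ->
  (alarm c = None \/ exists2 k, (k < size arr)%N & pending c k) ->
  inv (den alarmP c) arr log.
Proof.
move=> [td mk rsE gok cnt vert dl pd lg sep past lev cert srv edg cst num] al.
have [s2 m2 A2] := alarm_spec c.
have [w2 u2] : now (den alarmP c) = now c /\ upcoming (den alarmP c) = upcoming c.
  by case: (clock_den alarmP c).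
have f2 a : a \notin [:: aNext; 80] -> nmem (den alarmP c) a = nmem c a.
  by rewrite !inE negb_or => /andP[h1 h2]; rewrite nmem_den // !inE !negb_or h1 h2.
have r2 a : rmem (den alarmP c) a = rmem c a by rewrite rmem_den.
have t2 := todo_den alarmP c; have g2 := graph_ok_den (p := alarmP) isT gok.
move: (den alarmP c) s2 m2 A2 w2 u2 f2 r2 t2 g2 => c2 s2 m2 A2 w2 u2 f2 r2 t2 g2.
have p2 j : pending c2 j = pending c j by rewrite /pending f2.
rewrite cnt in A2; split.
  split; rewrite ?t2 ?m2 ?u2 ?w2 ?s2 ?f2 ?r2 //.
  - by move=> j jN; rewrite p2; exact: pd.
  - by move=> j l jN; rewrite p2; exact: lev.
  - by move=> j jN; rewrite p2; exact: cert.
  - by move=> j jN; rewrite p2; exact: srv.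
  - by rewrite (eq_count p2).
case: A2 => [[n0 [aE z]]|[k [n0 kN pk aE mn]]].
  left; split=> //; split; last by move=> j jN; rewrite f2 // z.
  rewrite aE; case: al => // -[k kN]; rewrite /pending (z k kN) //.
right; exists k; split=> //; rewrite ?p2 ?r2 // => j jN; rewrite p2 ?r2; exact: mn.
Qed.

Definition arrived q c := set_todo [::] (arrive dst_algorithm q (behead (upcoming c)) c).

Lemma arrive_step c arr log q us : inv c arr log -> upcoming c = q :: us ->
  (forall t, alarm c = Some t -> release q <= Num.max (now c) t) ->
  inv (den on_requestP (arrived q c)) (rcons arr q) log.
Proof.
move=> [I al] uE tle; have := I => -[td mk rsE gok cnt vert dl pd lg sep past lev cert srv edg cst num].
have qrs : q \in rs by rewrite rsE uE mem_cat inE eqxx orbT.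
have qu : q \in upcoming c by rewrite uE inE eqxx.
have [so dlok con] := rs_ok.
rewrite /on_requestP den_seq; set c1 := den storeP _; set N := size arr in cnt *.
have w1 : clock c1 = (release q, us).
  by rewrite clock_den /clock /= uE.
have f1 a : a \notin [:: 0; aVert; aPend; aCnt] -> nmem c1 a = nmem c a.
  move=> aN; rewrite nmem_den /=; last by move: aN; rewrite !inE !negb_or; case/and4P => ? -> -> ->.
  by rewrite update_neq //; move: aN; rewrite inE negb_or => /andP[].
have r1 a : a \notin [:: 1; rDl; rLv] -> rmem c1 a = rmem c a.
  move=> aN; rewrite rmem_den /=; last by move: aN; rewrite !inE !negb_or; case/and3P => ? -> ->.
  by rewrite !update_neq //; move: aN; rewrite inE negb_or => /andP[].
have [m1 s1 a1] : [/\ marked c1 = finset.set0, sent c1 = rcons (sent c) (release q, finset.set0)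
    & alarm c1 = alarm c].
  by rewrite /c1 /storeP /LSeqs !den_seq den_eq; case: ifP => _; rewrite /= mk.
have [cnt1 vert1 dl1 lv1 pd1] : [/\ nmem c1 aCnt 0 = N.+1,
    forall j, nmem c1 aVert j = if j == N then (rvertex q : nat) else nmem c aVert j,
    forall j, rmem c1 rDl j = if j == N then deadline q else rmem c rDl j,
    forall j, rmem c1 rLv j = if j == N then 0 else rmem c rLv j
  & forall j, nmem c1 aPend j = if j == N then nat_of_bool (rvertex q != rho) else nmem c aPend j].
  have [_ rE _ _ _] := gok.
  rewrite /c1 /storeP /LSeqs !den_seq den_eq !evalE !denE /= /update /= cnt rE.
  rewrite -val_eqE /=; case: eqP => _ /=; rewrite /update /= cnt addn1; split=> // j;
   by case: (j == N).
have t1 : todo c1 = [::] by rewrite todo_den.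
have g1 : graph_ok c1 by apply: graph_ok_den.
move: (c1) t1 g1 w1 f1 r1 m1 s1 a1 cnt1 vert1 dl1 lv1 pd1 => {}c1 t1 g1 w1 f1 r1 m1 s1 a1 cnt1 vert1 dl1 lv1 pd1.
have p1 j : (j < N)%N -> pending c1 j = pending c j.
  by move=> jN; rewrite /pending pd1 ltn_eqF.
have pN : pending c1 N = (rvertex q != rho) by rewrite /pending pd1 eqxx; case: eqP.
(* The release does not come after the alarm, which rings at the least pending deadline. *)
have later j : pending c j -> (j < N)%N -> release q <= deadline (req arr j).
  move=> pj jN; have [_ _ nd] := pd j jN pj.
  case: al => [[_ [_ z]]|[k [_ kN pk aE mn]]]; first by rewrite /pending z in pj.
  apply: le_trans (tle _ aE) _; rewrite ge_max nd -dl //; exact: mn.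
case: w1 => w1 u1.
have [rE pst] : rs = rcons arr q ++ upcoming c1 /\ size (rcons arr q) = N.+1.
  by rewrite u1 rsE uE cat_rcons size_rcons.
have split_j (P : nat -> Prop) : (forall j, (j < N)%N -> P j) -> P N ->
    forall j, (j < size (rcons arr q))%N -> P j.
  by move=> h1 h2 j; rewrite pst ltnS leq_eqVlt => /orP[/eqP->|/h1].
have rqN : req (rcons arr q) N = q by rewrite req_rcons eqxx.
have rqj j : (j < N)%N -> req (rcons arr q) j = req arr j by move=> jN; rewrite req_rcons ltn_eqF.
apply: alarm_step; last first.
  rewrite a1; case: al => [[_ [-> _]]|[k [_ kN pk aE mn]]]; first by left.
  by right; exists k; [rewrite pst ltnW | rewrite p1].
split=> //; rewrite ?w1 ?s1.
- by rewrite cnt1 pst.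
- by apply: split_j => [j jN|]; rewrite vert1 ?eqxx ?rqN // ltn_eqF // rqj // vert.
- by apply: split_j => [j jN|]; rewrite dl1 ?eqxx ?rqN // ltn_eqF // rqj // dl.
- apply: split_j => [j jN|]; last first.
    by rewrite pN rqN => ?; split=> //; apply: dlok.
  rewrite p1 // rqj // => pj; have [h1 h2 h3] := pd j jN pj; split=> //; last exact: later.
  exact: release_sorted rsE jN qu.
- by move=> l q' ll q'u; apply: past => //; rewrite uE inE u1 in q'u *; rewrite q'u orbT.
- move=> j l jN; move: j jN l; apply: split_j => [j jN l|l].
    by rewrite p1 // rqj // lv1 ltn_eqF // => pj; exact: lev.
  move=> _ ll le; rewrite rqN in le; by have := past l q ll qu; rewrite ltNge le.
- apply: split_j => [j jN|]; last by rewrite lv1 !eqxx.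
  by rewrite p1 // rqj // lv1 ltn_eqF // => pj; exact: cert.
- apply: split_j => [j jN|].
    by rewrite p1 // rqj // => pj; apply: served_rcons; exact: srv.
  rewrite pN rqN negbK => /eqP vq; exists (release q), finset.set0; split=> //.
  - by rewrite mem_rcons inE eqxx.
  - exact: dlok.
  - by rewrite vq connect0.
- move=> t E' e; rewrite mem_rcons inE => /orP[/eqP[_ ->]|]; [by rewrite inE|exact: edg].
- by rewrite cost_rcons /edge_cost big_set0 addr0.
- rewrite pst -addn1 iotaD count_cat add0n -/N /= addn0 addnA leq_add ?leq_b1 //.
  rewrite (@eq_in_count _ _ (pending c)) // => j; rewrite mem_iota => /andP[_]; exact: p1.
Qed.

Lemma base_frame c c' arr log : base c arr log -> graph_ok c' -> todo c' = [::] ->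
  upcoming c' = upcoming c -> marked c' = marked c -> sent c' = sent c ->
  (forall a, a \in [:: aVert; aPend; aCnt] -> nmem c' a = nmem c a) ->
  (forall a, a \in [:: rDl; rLv] -> rmem c' a = rmem c a) -> now c <= now c' ->
  (forall j, (j < size arr)%N -> pending c j -> now c' <= rmem c rDl j) ->
  base c' arr log.
Proof.
move=> [td mk rsE gok cnt vert dl pd lg sep past lev cert srv edg cst num] gok' td' u' mk' s' f r nle nd.
have pE j : pending c' j = pending c j by rewrite /pending f.
split; rewrite ?u' ?mk' ?s' // ?f // ?r //.
- move=> j jN; rewrite pE => pj; have [h1 h2 h3] := pd j jN pj.
  split=> //; first exact: le_trans h2 nle.
  by rewrite -dl //; apply: nd.
- by move=> j l; rewrite pE; exact: lev.
- by move=> j; rewrite pE; exact: cert.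
- by move=> j; rewrite pE; exact: srv.
- by rewrite (eq_count pE).
Qed.

Lemma den_seqs ps c : den (LSeqs ps) c = foldl (fun c' p => den p c') c ps.
Proof. by elim: ps c => [|p [|q ps] IH] c //; rewrite -[RHS]IH. Qed.

(** Natural arrays numbered below 20 hold the input and the requests, those from 20 on are working
    storage. *)
Definition quiet p := [&& pure p, all (leq 20) (writesN p) & nilp (writesR p)].

Lemma quiet_den p c : quiet p -> graph_ok c -> [/\ graph_ok (den p c),
    outputs (den p c) = outputs c, clock (den p c) = clock c,
    (forall a, (a < 20)%N -> nmem (den p c) a = nmem c a) & forall a, rmem (den p c) a = rmem c a].
Proof.
move=> /and3P[pp /allP wn /nilP wr] g.
have f a : (a < 20)%N -> nmem (den p c) a = nmem c a.
  by move=> aN; rewrite nmem_den //; apply/negP => /wn; rewrite leqNgt aN.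
have r a : rmem (den p c) a = rmem c a by rewrite rmem_den // wr.
have [h1 h2 h3 h4 h5] := g; split=> //; first by split; rewrite ?f // r.
- exact: outputs_den.
- exact: clock_den.
Qed.

Lemma params_spec c : graph_ok c -> params_ok (logn2 n) (paramH n) (paramD n) (paramQ n)
  (den params6P (den params5P (den params4P (den params3P (den params2P (den params1P c)))))).
Proof.
move=> g1; have := params1_spec g1; have := @quiet_den params1P c isT g1.
move: (den params1P c) => c1 [{}g1 _ _ _ _] L1.
have := params2_spec L1; have := @quiet_den params2P c1 isT g1.
have L2 : nmem (den params2P c1) aL 0 = logn2 n by rewrite nmem_den.
move: (den params2P c1) L2 => c2 L2 [{}g1 _ _ _ _] [H2 A2].
have := params3_spec L2 H2; have := @quiet_den params3P c2 isT g1.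
have L3 : nmem (den params3P c2) aL 0 = logn2 n by rewrite nmem_den.
have A3 : nmem (den params3P c2) aA 0 = (2 ^ paramH n)%N by rewrite nmem_den.
move: (den params3P c2) L3 A3 => c3 L3 A3 [{}g1 _ _ _ _] D3.
have := params4_spec D3 A3; have := @quiet_den params4P c3 isT g1.
have L4 : nmem (den params4P c3) aL 0 = logn2 n by rewrite nmem_den.
have D4 : nmem (den params4P c3) aD 0 = paramD n by rewrite nmem_den.
move: (den params4P c3) L4 D4 => c4 L4 D4 [{}g1 _ _ _ _] K4.
have := params5_spec g1.
have L5 : nmem (den params5P c4) aL 0 = logn2 n by rewrite nmem_den.
have D5 : nmem (den params5P c4) aD 0 = paramD n by rewrite nmem_den.
have K5 : nmem (den params5P c4) aKT 0 = (paramD n * 2 ^ paramH n)%N by rewrite nmem_den.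
move: (den params5P c4) L5 D5 K5 => c5 L5 D5 K5 Q5.
by split; rewrite ?params6_spec ?Q5 ?K5 // nmem_den.
Qed.

Definition raised c x j : R := if eligible c x j then (x + x) + (x + x) else rmem c rLv j.

(** What the invariant needs to know of a service, freed of the program: [x] is the level, [F] the
    transmitted set, and [gone] marks the requests up to the latest deadline for which the oracle
    succeeded. *)
Lemma service_step c k (v : V) : graph_ok c -> params_ok (logn2 n) (paramH n) (paramD n) (paramQ n) c ->
  vert_ok c (nmem c aCnt 0) -> nmem c aNext 0 = k.+1 -> nmem c aVert k = v -> v != rho ->
  connect (@edge R G) rho v -> marked c = finset.set0 ->
  let c' := den updateP (den LTransmit (den markP (den serveP (den freshP c)))) in
  exists x (F : {set V * V}) (gone : pred nat),
  [/\ [/\ 0 < x, rmem c rLv k <= x, F \subset ess, edge_cost F <= gammaN%:R * x & reaches F v],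
    x = rmem c rLv k \/ (forall t, tree_of t ess [set v]%SET -> x <= 2 * tree_cost t),
    [/\ graph_ok c', clock c' = clock c & outputs c' = (alarm c, finset.set0, rcons (sent c) (now c, F))],
    [/\ forall a, a \in [:: aVert; aCnt] -> nmem c' a = nmem c a, rmem c' rDl = rmem c rDl &
     forall j, (j < nmem c aCnt 0)%N ->
     nmem c' aPend j = (if (j == k) || eligible c x j && gone j then 0%N else nmem c aPend j) /\
     rmem c' rLv j = raised c x j] &
    forall j, (j < nmem c aCnt 0)%N -> eligible c x j ->
      if gone j then forall w, nmem c aVert j = val w -> reaches F w
      else forall t, tree_of t ess (group c x (nmem c aCnt 0) j) -> x < tree_cost t].
Proof.
move=> gok pok vok nE vE vr vc mk.
have kNx : (nmem c aNext 0 - 1)%N = k by rewrite nE subn1.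
have := @fresh_spec _ G _ _ _ _ (logn2_gt n) (paramD_geq n) (paramQ_gt n) c v gok pok.
rewrite kNx vE => /(_ erefl vr vc) [].
have f1 a : a \in [:: aVert; aPend; aCnt; aNext] -> nmem (den freshP c) a = nmem c a.
  by move=> aI; rewrite nmem_den //; move: aI; rewrite !inE => /or4P[]/eqP->.
have r1 a : a \in [:: rDl; rLv] -> rmem (den freshP c) a = rmem c a.
  by move=> aI; rewrite rmem_den //; move: aI; rewrite !inE => /orP[]/eqP->.
have o1 : outputs (den freshP c) = outputs c by rewrite outputs_den.
have w1 := clock_den freshP c.
have g1 := @graph_ok_den _ _ freshP c isT gok; have p1 := @params_den _ _ _ _ _ _ freshP c isT pok.
move: (den freshP c) f1 r1 o1 w1 g1 p1 => c1 f1 r1 o1 w1 g1 p1.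
set x0 := rmem c1 rFX 0 => x00 [sF [reF vF affF treeF]].
pose x := Num.max x0 (rmem c rLv k).
have kN1 : (nmem c1 aNext 0 - 1)%N = k by rewrite f1.
have xE : x = Num.max (rmem c1 rFX 0) (rmem c1 rLv (nmem c1 aNext 0 - 1)) by rewrite kN1 (r1 rLv).
have x_gt0 : 0 < x by rewrite lt_max x00.
have vok1 : vert_ok c1 (nmem c1 aCnt 0) by rewrite /vert_ok !f1.
have [] := @serve_spec _ G _ _ _ _ (logn2_gt n) (paramD_geq n) (paramQ_gt n) c1 x sF g1 p1 vok1 xE x_gt0 reF.
have f2 a : a \in [:: aVert; aPend; aCnt; aNext] -> nmem (den serveP c1) a = nmem c a.
  move=> aI; rewrite -f1 // nmem_den //.
  by move: aI; rewrite !inE => /or4P[]/eqP->; vm_compute.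
have r2 a : a \in [:: rDl; rLv] -> rmem (den serveP c1) a = rmem c a.
  move=> aI; rewrite -r1 // rmem_den //.
  by move: aI; rewrite !inE => /orP[]/eqP->; vm_compute.
have o2 : outputs (den serveP c1) = outputs c by rewrite outputs_den.
have w2 := clock_den serveP c1; rewrite {}w1 in w2.
have g2 := @graph_ok_den _ _ serveP c1 isT g1.
have elE y j : eligible c1 y j = eligible c y j by rewrite /eligible f1 // r1.
have grE y N j : group c1 y N j = group c y N j.
  by apply/setP => w; rewrite !inE; apply: eq_existsb => i; rewrite elE f1 // r1.
rewrite f1 // r1 //.
move: (den serveP c1) f2 r2 o2 w2 g2 => c2 f2 r2 o2 w2 g2 x2 reF2 qok dec.
have x0x : x0 <= x by rewrite le_max lexx.
have [_ [Fes Freach Fcost]] := (tt, affF).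
have [FQ [Qes Qcost Qreach QX]] : exists FQ : {set V * V}, [/\ forall e, e \in FQ -> e \in es,
    edge_cost FQ <= (2 * (logn2 n * (paramD n).+1))%:R * x,
    forall j w, (j < nmem c aCnt 0)%N -> eligible c x j ->
      (0 < nmem c2 aQOK 0)%N -> rmem c rDl j <= rmem c2 rTh 0 -> nmem c aVert j = val w -> reaches FQ w
  & forall j, (j < m)%N -> (0 < nmem c2 aQOK 0)%N && (0 < nmem c2 aS (nmem c2 aQS 0 + j))%N = (edge_at G j \in FQ)].
  case: qok => [->|[-> [sQ [[_ _ reQ] [Qes Qr Qc] cov]]]].
    exists finset.set0; split=> //; first by move=> e; rewrite inE.
    - by rewrite /edge_cost big_set0 mulr_ge0 // ltW.
    - by move=> j _; rewrite inE.
  exists sQ.2; split=> // [j w jN el _ le vw|j jm].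
    by apply/Qr/(cov j) => //; rewrite ?elE ?f1.
  by rewrite reQ //; case: (_ \in _).
pose F := (sF.2 :|: FQ)%SET.
have XE j : (j < m)%N -> (edge_at G j \in F) = (0 < nmem c2 aS (nmem c2 aFS 0 + j))%N ||
    (0 < nmem c2 aQOK 0)%N && (0 < nmem c2 aS (nmem c2 aQS 0 + j))%N.
  by move=> jm; rewrite QX // inE; case: reF2 => _ _ ->//; case: (_ \in sF.2).
have [s3 a3 m3] := mark_spec g2 XE.
have f3 a : a != 78 -> nmem (den markP c2) a = nmem c2 a.
  by move=> a78; rewrite nmem_den // !inE.
have r3 a : rmem (den markP c2) a = rmem c2 a by rewrite rmem_den.
have w3 := clock_den markP c2; rewrite w2 in w3.
have g3 := @graph_ok_den _ _ markP c2 isT g2.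
case: o2 => a2 m2 s2.
have {}m3 : marked (den markP c2) = F.
  rewrite m3 m2 mk finset.set0U; apply/setP => e; rewrite inE.
  case: (boolP (e \in es)) => /= [ein|en]; first by rewrite /edge_at nth_index.
  by symmetry; apply/negbTE; apply: contra en; rewrite inE => /orP[/Fes|/Qes].
move: (den markP c2) s3 a3 m3 f3 r3 w3 g3 => c3 s3 a3 m3 f3 r3 w3 g3.
set c4 := den LTransmit c3.
have n4 : nmem c4 = nmem c3 by []. have r4 : rmem c4 = rmem c3 by [].
have w4 : clock c4 = clock c by [].
have o4 : outputs c4 = (alarm c, finset.set0, rcons (sent c) (now c, F)).
  by rewrite -[LHS]/(alarm c3, finset.set0, rcons (sent c3) (now c3, marked c3)) a3 a2 s3 s2 m3; case: w3 => ->.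
have g4 : graph_ok c4 by apply: graph_ok_den.
move: (c4) n4 r4 w4 o4 g4 => {}c4 n4 r4 w4 o4 g4.
have x4 : rmem c4 rX2 0 = x + x by rewrite r4 r3.
have up := update_spec x4.
have f5 a : a \in [:: aVert; aCnt] -> nmem (den updateP c4) a = nmem c a.
  move=> aI; have -> : nmem c a = nmem c4 a.
    rewrite n4 f3; last by apply: contraTneq aI => ->.
    by rewrite f2 // !inE; move: aI; rewrite !inE => /orP[]/eqP->.
  by rewrite nmem_den //; move: aI; rewrite !inE => /orP[]/eqP->.
have r5 : rmem (den updateP c4) rDl = rmem c rDl by rewrite rmem_den // r4 r3 r2.
have o5 : outputs (den updateP c4) = outputs c4 by rewrite outputs_den.
have w5 := clock_den updateP c4; rewrite w4 in w5.
have g5 := @graph_ok_den _ _ updateP c4 isT g4.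
move: (den updateP c4) up f5 r5 o5 w5 g5 => c5 up f5 r5 o5 w5 g5 /=.
have el4 j : eligible c4 x j = eligible c x j by rewrite /eligible n4 r4 r3 f3 // f2 // r2.
pose gone (j : nat) := (0 < nmem c2 aQOK 0)%N && (rmem c rDl j <= rmem c2 rTh 0).
have dr4 j : dropped c4 x j = eligible c x j && gone j.
  by rewrite /dropped el4 n4 f3 // r4 !r3 r2.
have subF (f : {set V * V}) w : f \subset F -> reaches f w -> reaches F w.
  move=> /fintype.subsetP fF; apply: connect_sub => a b /= ab; apply: connect1; exact: fF.
exists x, F, gone; split.
- split=> //.
  + by rewrite le_max lexx orbT.
  + by apply/fintype.subsetP => e; rewrite !inE => /orP[/Fes|/Qes].
  + apply: (@le_trans _ _ (edge_cost sF.2 + edge_cost FQ)).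
      rewrite /edge_cost (bigID (mem sF.2)) /= lerD //.
        rewrite le_eqVlt; apply/orP; left; apply/eqP; apply: eq_bigl => e.
        by rewrite !inE; case: (_ \in sF.2); rewrite ?andbF.
      rewrite [leRHS](bigID (mem sF.2)) /= addrC ler_wpDr //.
        by apply: sumr_ge0 => e /andP[eF _]; rewrite ltW // edges_gt0 // Qes.
      rewrite le_eqVlt; apply/orP; left; apply/eqP; apply: eq_bigl => e.
      by rewrite !inE; case: (_ \in sF.2); rewrite ?andbF ?andbT.
    have h : edge_cost sF.2 <= (2 * (logn2 n * (paramD n).+1))%:R * x.
      by apply: le_trans Fcost _; rewrite ler_wpM2l.
    have -> : gammaN%:R = 2 * (2 * (logn2 n * (paramD n).+1))%:R :> R.
      by rewrite -natrM mulnA.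
    by move: h Qcost; lra.
  + exact: (subF sF.2 _ (finset.subsetUl _ _) (Freach _ vF)).
- have [le|lt] := leP (rmem c rLv k) x0; last by left; rewrite /x max_r // ltW.
  by right; rewrite /x max_l.
- by rewrite o5 o4.
- split=> // j jN; have := up j; rewrite n4 f3 // f2 // => /(_ jN).
  by rewrite f3 // f2 // nE subn1 dr4 el4 r4 r3 r2 // f3 // f2 //.
move=> j jN el; case: ifP => [/andP[q0 le] w vw|/negbT ng].
  exact: (subF FQ _ (finset.subsetUr _ _) (Qreach j w jN el q0 le vw)).
have el1 : eligible c1 x j by rewrite elE.
case: (dec j jN el1) => [[q1 le]|h t].
  by case/negP: ng; rewrite /gone q1 /=.
by rewrite -grE; exact: h.
Qed.

Lemma main_step c arr log k : base c arr log -> alarm c = None ->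
  params_ok (logn2 n) (paramH n) (paramD n) (paramQ n) c ->
  nmem c aNext 0 = k.+1 -> (k < size arr)%N -> pending c k ->
  (forall j, (j < size arr)%N -> pending c j -> rmem c rDl k <= rmem c rDl j) ->
  now c = rmem c rDl k -> (forall q, q \in upcoming c -> now c < release q) ->
  exists l, inv (den mainP c) arr (l :: log).
Proof.
move=> I ac pok nE kN pk mn nowE fut; have := I.
move=> [td mk rsE gok cnt vert dl pd lg sep past lev cert srv edg cst num].
have [so dlok con] := rs_ok; rewrite /mainP den_seqs [foldl _ _ _]/=.
set v := rvertex (req arr k); have [vr rk _] := pd k kN pk.
have vok : vert_ok c (nmem c aCnt 0).
  by move=> j; rewrite cnt => jN; exists (rvertex (req arr j)); exact: vert.
have := service_step gok pok vok nE (vert k kN) vr (con _ (req_mem rsE kN)) mk.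
have td1 : todo (den updateP (den LTransmit (den markP (den serveP (den freshP c))))) = [::].
  by rewrite !todo_den.
rewrite cnt; move: (den updateP _) td1 => c1 td1 [x [F [gone]]].
move=> [[x0 lvx Fes Fcost Fv] xcase [g1 w1 o1] [f1 r1 up] dec].
case: w1 => now1 up1; case: o1 => al1 mk1 s1.
pose q0 := req arr k.
have q0rs : q0 \in rs := req_mem rsE kN.
have nowdl : now c = deadline q0 by rewrite nowE dl.
(* A level inherited from the request comes with the certificate of [inv_cert]; a fresh price is
   certified by the request alone, since every tree reaching it costs at least half that price. *)
have [Q [Qrs Qdl Qcert Qsep]] : exists Q, [/\ {subset Q <= rs},
    forall q, q \in Q -> deadline q <= now c, certified x (vertices Q)
  & forall l q, l \in log -> q \in Q -> release q <= stime l -> 2 * slevel l < x].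
  have [lv0|lv0] := eqVneq x (rmem c rLv k).
    rewrite lv0; have lv_neq0 : rmem c rLv k != 0 by rewrite -lv0 gt_eqF.
    by have [_ [Q [h1 h2 h3 h4]]] := cert k kN pk lv_neq0; exists Q; split=> //; rewrite nowdl.
  case: xcase => [/eqP|tr]; first by rewrite (negbTE lv0).
  exists [:: q0]; split=> [q|q||l q ll].
  - by rewrite inE => /eqP->.
  - by rewrite inE => /eqP->; rewrite nowdl.
  - have -> : vertices [:: q0] = [set v]%SET.
      by apply/setP => w; rewrite !inE /= orbF eq_sym.
    by apply: certifiedP => // t tt; have := tr t tt; have := tree_cost_ge0 tt; lra.
  - rewrite inE => /eqP-> le; apply: lt_le_trans lvx; exact: lev le.
exists (now c, x, Q).
have pd1 j : (j < size arr)%N -> pending c1 j = [&& pending c j, j != k & ~~ (eligible c x j && gone j)].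
  move=> jN; rewrite /pending; have [-> _] := up j jN.
  by case: eqP => //= _; rewrite ?andbF //; case: (_ && _); rewrite ?andbF ?andbT.
have rz j : (j < size arr)%N -> rmem c1 rLv j = raised c x j by move=> jN; have [] := up j jN.
(* Eligible requests move to [4 * x]; the others were ineligible because their level exceeds
   [2 * x]. *)
have raised_gt j : (j < size arr)%N -> pending c j -> 2 * x < raised c x j.
  move=> jN pj; rewrite /raised; case: ifP => [_|]; first by lra.
  by rewrite /eligible -/(pending c j) pj /= => /negbT; rewrite -ltNge; lra.
have raised_ge j : rmem c rLv j <= raised c x j.
  by rewrite /raised; case: ifP => // /andP[_ le]; move: le x0; lra.
apply: alarm_step; last by left; rewrite al1.
split=> //; rewrite ?up1 ?now1 ?f1 ?r1 ?s1 //.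
- move=> j jN; rewrite pd1 // => /and3P[pj _ _]; have [h1 h2 h3] := pd j jN pj; split=> //.
- by move=> l; rewrite inE => /orP[/eqP->|/lg].
- rewrite /= sep andbT; apply/allP => l ll; apply/allP => q qQ; apply/implyP.
  exact: Qsep.
- by move=> l q; rewrite inE => /orP[/eqP-> /fut|]; [|exact: past].
- move=> j l jN; rewrite pd1 // rz // => /and3P[pj _ _]; rewrite inE => /orP[/eqP->|ll] le.
    exact: raised_gt.
  apply: lt_le_trans (raised_ge j); exact: lev le.
- move=> j jN; rewrite pd1 // rz // => /and3P[pj jk ng] lv0.
  have rg := raised_gt j jN pj; split; first by lra.
  case: (boolP (eligible c x j)) => el; last first.
    move: lv0 rg; rewrite /raised (negbTE el) => lv0 rg.
    have [_ [Qj [h1 h2 h3 h4]]] := cert j jN pj lv0; exists Qj; split=> //.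
    by move=> l q; rewrite inE => /orP[/eqP-> //|ll]; exact: h4.
  (* The failed oracle call certifies the raised level by the eligible requests with deadlines up to
     that of [j]: their trees cost more than [x], a quarter of [4 * x], as [certifiedP] asks. *)
  pose ind := [seq i <- iota 0 (size arr) | eligible c x i && (rmem c rDl i <= rmem c rDl j)].
  have indP i : i \in ind -> [/\ (i < size arr)%N, eligible c x i & rmem c rDl i <= rmem c rDl j].
    by rewrite mem_filter mem_iota => /andP[/andP[h1 h2] h3].
  exists [seq req arr i | i <- ind]; split.
  - by move=> q /mapP[i /indP[iN _ _] ->]; exact: (req_mem rsE iN).
  - by move=> q /mapP[i /indP[iN _ le] ->]; rewrite -!dl.
  - have := dec j jN el; move: ng; rewrite el /= => /negbTE-> tr.
    have -> : vertices [seq req arr i | i <- ind] = group c x (size arr) j.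
      apply/setP => w; rewrite !inE has_map; apply/hasP/existsP => [[i /indP[iN el' le]]|[i]].
        by move=> /= /eqP vw; exists (Ordinal iN); rewrite el' le vert //= vw eqxx.
      move=> /and3P[el' le /eqP vw]; exists (i : nat).
        by rewrite mem_filter el' le mem_iota /=.
      by rewrite /= -val_eqE /= -vert // vw.
    apply: certifiedP => [|t tt]; first by lra.
    by have := tr t tt; rewrite /raised el; lra.
  (* For a former service [l], [2 * slevel l] is below the level of the certifying request, which is
     at most [2 * x] by eligibility. *)
  - move=> l q; rewrite inE => /orP[/eqP-> //|ll] /mapP[i /indP[iN eli _] ->] le.
    have /andP[pi li] := eli; have := lev i l iN pi ll le.
    by rewrite /raised el; lra.
- move=> j jN; rewrite pd1 //.
  case: (boolP (pending c j)) => [/= pj|np _]; last by apply: served_rcons; exact: srv.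
  rewrite negb_and !negbK => gj; exists (now c), F; have [h1 h2 h3] := pd j jN pj; split=> //.
  + by rewrite mem_rcons inE eqxx.
  + case/orP: gj => [/eqP->//|/andP[el gj]].
    by have := dec j jN el; rewrite gj; apply; exact: vert.
- move=> t E' e; rewrite mem_rcons inE => /orP[/eqP[_ ->]|]; last exact: edg.
  by move/(fintype.subsetP Fes); rewrite inE mem_enum.
- rewrite cost_rcons big_cons mulrDr addrC lerD //.
- rewrite /= addSn -addnS; apply: leq_trans num; rewrite leq_add2l.
  apply: (ltn_count_in (x := k)) => [|j||]; rewrite ?mem_iota //; last first.
    by rewrite pd1 // eqxx andbF.
  by move=> /andP[_ jN]; rewrite pd1 // => /andP[].
Qed.
End Online.


(** * Complete runs: events, halting, feasibility *)

Section Run.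
Variables (R : realType) (G : network R) (rs : seq (request R (nv G))).
Hypothesis rs_ok : valid_input rs.
Local Notation V := 'I_(nv G).
Local Notation n := (nv G).
Local Notation es := (edges G).
Local Notation m := (size (edges G)).
Local Notation rho := (rho G).
Local Notation ess := [set e in es]%SET.
Local Notation request := (request R n).
Local Notation inv := (inv rs).
Implicit Types (c : config G) (arr : seq request) (log : seq (service G)).

Definition rung t c := set_todo [::] (ring_alarm dst_algorithm t c).

Lemma ring_step c arr log t : inv c arr log -> alarm c = Some t ->
  let t' := Num.max (now c) t in (forall q, q \in upcoming c -> t' < release q) ->
  exists l, inv (den on_alarmP (rung t' c)) arr (l :: log).
Proof.
move=> [I al] at_ t' fut.
case: al => [[_ [aN _]]|[k [nE kN pk aE mn]]]; first by rewrite aN in at_.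
have [td mk rsE gok cnt vert dl pd lg sep past lev cert srv edg cst num] := I.
move: at_; rewrite aE => -[tE].
(* No pending deadline has passed, so the alarm rings exactly at the least one. *)
have t'E : t' = rmem c rDl k.
  by rewrite /t' -tE; apply/max_r; have [_ _] := pd k kN pk; rewrite dl.
set c1 := rung t' c.
have r1 a : a != 1%N -> rmem c1 a = rmem c a by move=> a1; rewrite -[LHS]/(update _ _ _ _ a) update_neq.
have g1 : graph_ok c1.
  by have [h1 h2 h3 h4 h5] := gok; split.
rewrite /on_alarmP den_seqs [foldl _ _ _]/=.
have P := params_spec g1.
have [g2 o2 w2 f2 r2] := @quiet_den _ _ (LSeqs [:: params1P; params2P; params3P; params4P; params5P; params6P]) c1 isT g1.
have t2 := todo_den (LSeqs [:: params1P; params2P; params3P; params4P; params5P; params6P]) c1.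
rewrite den_seqs [foldl _ _ _]/= in g2 o2 w2 f2 r2 t2.
move: (den params6P _) P g2 o2 w2 f2 r2 t2 => c2 P g2 [a2 m2 s2] [n2 u2] f2 r2 t2.
apply: (main_step rs_ok (k := k)) => //.
- apply: (base_frame I) => // [a|a||j jN pj].
  + by rewrite !inE => /or3P[]/eqP->; rewrite f2.
  + by rewrite !inE => /orP[]/eqP->; rewrite r2 r1.
  + by rewrite n2 /= le_max lexx.
  + by rewrite n2 /= t'E; exact: mn.
- by rewrite f2.
- by rewrite /pending f2.
- by move=> j jN; rewrite /pending f2 // r2 r1 //; exact: mn.
- by rewrite n2 r2 r1.
- by rewrite n2 u2.
Qed.

Lemma init_inv : inv (init rs) [::] [::].
Proof.
split; last by left.
split=> //; last by rewrite /schedule_cost !big_nil mulr0.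
split=> // j jm; rewrite /= /edge_at; last by rewrite (nth_map (rho, rho)).
by rewrite !(nth_map (rho, rho)).
Qed.

Lemma halted_feasible c arr log : inv c arr log -> halted c ->
  feasible rs (sent c).
Proof.
move=> [[td mk rsE gok cnt vert dl pd lg sep past lev cert srv edg cst num] al].
case/and3P=> _ /nilP u0 /negbTE aN; rewrite u0 cats0 in rsE; split=> // q.
rewrite rsE => /(nthP (rho, (0, 0)))[j jN <-]; apply: srv => //.
case: al => [[_ [_ z]]|[k [_ _ _ aE _]]]; last by rewrite aE in aN.
by rewrite /pending z.
Qed.

Variable B : nat.
Hypothesis tm_request : forall c, (nmem c aCnt 0 < size rs)%N -> (tm on_requestP c <= B)%N.
Hypothesis tm_alarm : forall c, graph_ok c -> (nmem c aCnt 0 <= size rs)%N -> (tm on_alarmP c <= B)%N.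

Lemma event_run p c c0 : loops_ok p -> (tm p c0 <= B)%N -> todo c0 = [::] ->
  (forall tape, step dst_algorithm tape c = set_todo [:: compile p] c0) ->
  exists2 j, (j <= B.+1)%N & forall tape, iter j (step dst_algorithm tape) c = den p c0.
Proof.
move=> pok le t0 st; exists (tm p c0).+1 => // tape.
rewrite iterSr st exec_compile // -den_todo; congr den.
by case: (c0) t0 => /= ? ? ? ? ? ? ? ? ? ->.
Qed.

Lemma event c arr log : inv c arr log -> ~~ halted c ->
  exists c' arr' log', [/\ inv c' arr' log', (size arr' + size log' = (size arr + size log).+1)%N
  & exists2 j, (j <= B.+1)%N & forall tape, iter j (step dst_algorithm tape) c = c'].
Proof.
move=> I nh; have [[td mk rsE gok cnt vert dl pd lg sep past lev cert srv edg cst num] al] := I.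
have [ok1 ok2] : loops_ok on_requestP /\ loops_ok on_alarmP by apply/andP; exact: loops_checks.
have cntN : (nmem c aCnt 0 + size (upcoming c) = size rs)%N by rewrite cnt [in RHS]rsE size_cat.
have request_next q us : upcoming c = q :: us ->
    (forall t, alarm c = Some t -> release q <= Num.max (now c) t) ->
    (forall tape, step dst_algorithm tape c = arrive dst_algorithm q us c) ->
    exists c' arr' log', [/\ inv c' arr' log', (size arr' + size log' = (size arr + size log).+1)%N
    & exists2 j, (j <= B.+1)%N & forall tape, iter j (step dst_algorithm tape) c = c'].
  move=> uE tle st; exists (den on_requestP (arrived q c)), (rcons arr q), log; split.
  - exact: (arrive_step rs_ok I uE tle).
  - by rewrite size_rcons addSn.
  - apply: event_run => // [|tape]; last by rewrite st /arrived uE.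
    by apply: tm_request; rewrite -cntN uE /= addnS ltnS leq_addr.
have alarm_next t : alarm c = Some t -> 
    (forall q, q \in upcoming c -> Num.max (now c) t < release q) ->
    (forall tape, step dst_algorithm tape c = ring_alarm dst_algorithm (Num.max (now c) t) c) ->
    exists c' arr' log', [/\ inv c' arr' log', (size arr' + size log' = (size arr + size log).+1)%N
    & exists2 j, (j <= B.+1)%N & forall tape, iter j (step dst_algorithm tape) c = c'].
  move=> aE fut st; have [l Il] := ring_step I aE fut.
  exists (den on_alarmP (rung (Num.max (now c) t) c)), arr, (l :: log); split=> //.
    by rewrite /= addnS.
  apply: event_run => //; apply: tm_alarm; last by rewrite -cntN leq_addr.
  by have [h1 h2 h3 h4 h5] := gok; split.
have stE tape : step dst_algorithm tape c = next_event dst_algorithm c by rewrite /step td.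
case uE : (upcoming c) => [|q us]; case aE : (alarm c) => [t|].
- by apply: (alarm_next t aE) => [q|tape]; rewrite ?stE /next_event uE ?aE.
- by move: nh; rewrite /halted td uE aE.
- have [le|lt] := leP (release q) (Num.max (now c) t).
    by apply: (request_next q us) => // [t'|tape]; rewrite ?stE /next_event ?uE aE ?le // => -[<-].
  apply: (alarm_next t aE) => [q'|tape]; last by rewrite stE /next_event uE aE leNgt lt.
  move=> q'u; apply: lt_le_trans lt _; move: q'u; rewrite uE inE => /orP[/eqP->//|q'us].
  have [so _ _] := rs_ok; move: so; rewrite rsE uE sorted_pairwise; last by move=> a b d; apply: le_trans.
  by rewrite pairwise_cat /= => /and3P[_ _ /andP[/allP/(_ _ q'us)]].
- by apply: (request_next q us) => // [t'|tape]; rewrite ?stE /next_event ?uE aE.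
Qed.

Lemma halted_fix tape c : halted c -> step dst_algorithm tape c = c.
Proof.
case/and3P=> /nilP t0 /nilP u0; rewrite /step t0 /next_event u0.
by case: (alarm c).
Qed.

(** Every event adds a request to [arr] or a service to [log]. Both have at most [size rs] elements,
    the latter by [inv_count], so there are at most [2 * size rs] events. *)
Lemma halting : exists c arr log, [/\ inv c arr log, halted c &
  forall k, (2 * size rs * B.+1 <= k)%N -> forall tape, run dst_algorithm rs tape k = c].
Proof.
suff H K c arr log : inv c arr log -> (2 * size rs <= K + (size arr + size log))%N ->
    exists c' arr' log', [/\ inv c' arr' log', halted c' & exists2 j, (j <= K * B.+1)%N &
      forall tape, iter j (step dst_algorithm tape) c = c'].
  have [|c [arr [log [I hc [j jK it]]]]] := H (2 * size rs)%N _ _ _ init_inv; first by rewrite addn0.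
  exists c, arr, log; split=> // k kle tape; rewrite /run.
  rewrite -(subnK (leq_trans jK kle)) iterD it.
  by elim: (k - j)%N => //= i ->; exact: halted_fix.
elim: K c arr log => [|K IH] c arr log I le; have [hc|nh] := boolP (halted c).
- by exists c, arr, log; split=> //; exists 0%N.
- have [c' [arr' [log' [[I' _] sz _]]]] := event I nh.
  have := inv_count I'; have := congr1 size (inv_rs I'); rewrite size_cat.
  move: sz le; rewrite add0n; set a := size arr; set b := size arr'; set p := count _ _; set d := size _ ; lia.
- by exists c, arr, log; split=> //; exists 0%N.
have [c' [arr' [log' [I' sz [j jB it]]]]] := event I nh.
have [|c2 [arr2 [log2 [I2 h2 [j2 j2B it2]]]]] := IH c' arr' log' I'; first by rewrite sz addnS.
exists c2, arr2, log2; split=> //; exists (j2 + j)%N; first by rewrite mulSn addnC leq_add.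
by move=> tape; rewrite iterD it.
Qed.

End Run.

Local Open Scope nat_scope.

(** * Running time *)

Lemma logn2_mono a b : a <= b -> logn2 a <= logn2 b.
Proof. by move=> ab; rewrite /logn2 ltnS leq_trunc_log. Qed.

Lemma expn_logn2 k : 0 < k -> 2 ^ logn2 k <= 2 * k.
Proof. by move=> k0; rewrite /logn2 expnS leq_mul2l /= trunc_logP. Qed.

Lemma paramD_leq k : paramD k <= 4 * logn2 k.
Proof.
rewrite /paramD -ltnS ltn_divLR //; set L := logn2 k; set H := paramH k.
have : 0 < H by []. have : 0 < L by []. by nia.
Qed.

Lemma paramKT_leq k : paramD k * 2 ^ paramH k <= 8 * (logn2 k * logn2 k).
Proof.
apply: (@leq_trans ((4 * logn2 k) * (2 * logn2 k))); last by lia.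
by rewrite leq_mul ?paramD_leq // expn_logn2.
Qed.

Lemma paramQ_leq k : paramQ k <= 2 ^ (2 * logn2 k + 4).
Proof.
have := logn2_gt k; set x := 2 ^ logn2 k => kx.
have -> : 2 ^ (2 * logn2 k + 4) = 16 * (x * x) by rewrite expnD mul2n -addnn expnD mulnC.
rewrite /paramQ; nia.
Qed.

(* The longest loop is that of the search, of [paramQ k ^ (paramD k * 2 ^ paramH k)]
   rounds; with [L = logn2 k] the base is at most [2 ^ (2 * L + 4)] and the
   exponent at most [8 * L ^ 2]. *)
Definition loop_bound (k : nat) := 2 ^ (48 * logn2 k ^ 3).

Lemma paramBig_leq k : paramQ k ^ (paramD k * 2 ^ paramH k) <= loop_bound k.
Proof.
apply: (@leq_trans ((2 ^ (2 * logn2 k + 4)) ^ (8 * (logn2 k * logn2 k)))).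
  apply: (@leq_trans ((2 ^ (2 * logn2 k + 4)) ^ (paramD k * 2 ^ paramH k))).
    have [->|e0] := posnP (paramD k * 2 ^ paramH k); first by rewrite !expn0.
    by rewrite leq_exp2r // paramQ_leq.
  by rewrite leq_pexp2l ?expn_gt0 // paramKT_leq.
rewrite -expnM leq_pexp2l // -[3]/(1 + 2) expnD expn1 expnS expn1.
by have : 0 < logn2 k by []; nia.
Qed.

Lemma exp_loop_bound a k : a <= 48 * logn2 k ^ 3 -> 2 ^ a <= loop_bound k.
Proof. by move=> h; rewrite leq_pexp2l. Qed.

Lemma loop_bound_mono a b : a <= b -> loop_bound a <= loop_bound b.
Proof.
by move=> ab; rewrite leq_pexp2l // leq_mul2l /= leq_exp2r // logn2_mono.
Qed.

(** Dominates all loop bounds other than that of the search: vertices, edges, requests, rounding,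
    and the computation of the parameters. *)
Lemma quadratic_loop_bound k : 12 * (k * k) + k + k + 1 + 8 * (logn2 k * logn2 k) + 16 * logn2 k <= loop_bound k.
Proof.
have := logn2_gt k; set L := logn2 k => kx.
apply: (@leq_trans (2 ^ (6 * L + 6))); last first.
  by apply: exp_loop_bound; rewrite -/L expnS expnS expn1; have : 0 < L by []; nia.
have Lx : L < 2 ^ L by exact: ltn_expl.
have -> : 2 ^ (6 * L + 6) = 64 * (2 ^ L) ^ 6 by rewrite expnD mulnC -expnM (mulnC 6).
move: (2 ^ L) kx Lx => x kx Lx; have x2 : 12 * (k * k) + k + k + 1 + 8 * (L * L) + 16 * L <= 64 * (x * x) by nia.
apply: leq_trans x2 _; by rewrite leq_mul2l -[x * x]/(x ^ 2) leq_pexp2l //; lia.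
Qed.

Section Time.
Variables (R : realType) (G : network R).
Local Notation n := (nv G).
Local Notation es := (edges G).
Local Notation m := (size (edges G)).
Implicit Types (c : config G).

Lemma edges_leq : m <= n * n.
Proof.
by rewrite -cardE; apply: leq_trans (max_card _) _; rewrite card_prod card_ord.
Qed.

(** [1000] exceeds the size of every stage. It is used with [d = 6], the deepest nesting: edges,
    multiples, two loops of rounds, search steps, and a loop inside a step. *)
Definition stage_bound d (K : nat) := 1000 * K.+1 ^ d.

Lemma tm_stage p d K c : bounds_ok p -> all (fun e => neval c e <= K) (bounds p) ->
  lsize p <= 1000 -> depth p <= d -> tm p c <= stage_bound d K.
Proof.
move=> bp ap sp dp; apply: leq_trans (tm_tbound bp ap) _.
apply: leq_trans (tbound_leq _ _) _; apply: leq_mul => //.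
exact: leq_pexp2l.
Qed.

Lemma tm_seqs p q ps c :
  tm (LSeqs [:: p, q & ps]) c = (tm p c + tm (LSeqs (q :: ps)) (den p c)).+1.
Proof. by []. Qed.

Lemma tm_main N c : graph_ok c -> params_ok (logn2 n) (paramH n) (paramD n) (paramQ n) c ->
  n <= N -> nmem c aCnt 0 <= N -> tm mainP c <= stage_bound 6 (loop_bound N).
Proof.
move=> [n0 _ m0 _ _] [L0 D0 _ Big0] nN cN.
have /and5P[_ _ _ _ /and4P[_ _ bm _]] := bounds_checks.
have le := leq_trans (quadratic_loop_bound n) (loop_bound_mono nN).
have := leq_trans (paramBig_leq n) (loop_bound_mono nN); rewrite -Big0.
have cK : nmem c aCnt 0 <= loop_bound N.
  by apply: leq_trans cN _; have := quadratic_loop_bound N; lia.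
have mn := edges_leq; have DL := paramD_leq n.
move: (loop_bound N) le cK => K le cK BK.
apply: tm_stage => //; first by set bs := bounds mainP; vm_compute in bs; rewrite {}/bs /= n0 m0 L0 D0 BK cK !andbT; repeat (apply/andP; split); lia.
Qed.

(** An alarm has seven stages; the eighth share absorbs the steps between them. *)
Definition event_bound (N : nat) := 8 * stage_bound 6 (loop_bound N).

Lemma tm_alarm N c : graph_ok c -> n <= N -> nmem c aCnt 0 <= N ->
  tm on_alarmP c <= event_bound N.
Proof.
move=> g1 nN; have := tm_main (N := N); have := params_spec g1.
have /and5P[b1 b2 b3 b4 /and4P[b5 b6 _ _]] := bounds_checks.
have le := leq_trans (quadratic_loop_bound n) (loop_bound_mono nN).
rewrite /event_bound /on_alarmP (tm_seqs params1P params2P) (tm_seqs params2P) (tm_seqs params3P) (tm_seqs params4P)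
  (tm_seqs params5P) (tm_seqs params6P); set K := loop_bound N in le *.
have H p c' : bounds_ok p -> all (fun e => neval c' e <= K) (bounds p) ->
   (lsize p <= 1000) && (depth p <= 6) -> tm p c' <= stage_bound 6 K.
  by move=> bp ap /andP[sp dp]; exact: tm_stage.
have KT := paramKT_leq n.
have q1 : tm params1P c <= stage_bound 6 K.
  by apply: H => //=; case: g1 => -> *; lia.
have := params1_spec g1; have := @quiet_den _ _ params1P c isT g1.
move: (den params1P c) => c1 [{}g1 _ _ f1 _] L1.
have q2 : tm params2P c1 <= stage_bound 6 K by apply: H => //=; rewrite L1; lia.
have := params2_spec L1; have := @quiet_den _ _ params2P c1 isT g1.
have L2 : nmem (den params2P c1) aL 0 = logn2 n by rewrite nmem_den.
move: (den params2P c1) L2 => c2 L2 [{}g1 _ _ f2 _] [H2 A2].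
have q3 : tm params3P c2 <= stage_bound 6 K by apply: H => //=; rewrite L2; lia.
have := params3_spec L2 H2; have := @quiet_den _ _ params3P c2 isT g1.
have A3 : nmem (den params3P c2) aA 0 = (2 ^ paramH n)%N by rewrite nmem_den.
move: (den params3P c2) A3 => c3 A3 [{}g1 _ _ f3 _] D3.
have q4 : tm params4P c3 <= stage_bound 6 K.
  by apply: H => //=; rewrite D3; have := paramD_leq n; lia.
have := params4_spec D3 A3; have := @quiet_den _ _ params4P c3 isT g1.
move: (den params4P c3) => c4 [{}g1 _ _ f4 _] K4.
have q5 : tm params5P c4 <= stage_bound 6 K.
  by apply: H => //=; case: g1 => -> *; lia.
have := params5_spec g1; have := @quiet_den _ _ params5P c4 isT g1.
have K5 : nmem (den params5P c4) aKT 0 = paramD n * 2 ^ paramH n by rewrite nmem_den.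
move: (den params5P c4) K5 => c5 K5 [{}g1 _ _ f5 _] Q5.
have q6 : tm params6P c5 <= stage_bound 6 K.
  by apply: H => //=; rewrite K5 Q5 /paramQ; lia.
have := @quiet_den _ _ params6P c5 isT g1.
move: (den params6P c5) => c6 [{}g1 _ _ f6 _] pok mn cN.
have q7 : tm mainP c6 <= stage_bound 6 K.
  by apply: mn => //; rewrite f6 // f5 // f4 // f3 // f2 // f1.
rewrite -[LSeqs [:: mainP]]/mainP.
have : 1000 <= stage_bound 6 K by rewrite leq_pmulr // expn_gt0.
move: (stage_bound 6 K) q1 q2 q3 q4 q5 q6 q7 => *.
lia.
Qed.

Lemma tm_request N c : nmem c aCnt 0 < N -> tm on_requestP c <= event_bound N.
Proof.
move=> cN; have /and5P[_ _ _ _ /and4P[_ _ _ ba]] := bounds_checks.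
rewrite /event_bound /on_requestP -[LSeq _ _]/(LSeqs [:: storeP; alarmP]) (tm_seqs storeP).
have le := quadratic_loop_bound N; set K := loop_bound N in le *.
have q1 : tm storeP c <= stage_bound 6 K by exact: tm_stage.
have q2 : tm (LSeqs [:: alarmP]) (den storeP c) <= stage_bound 6 K.
  have : nmem (den storeP c) aCnt 0 = (nmem c aCnt 0).+1.
    by rewrite /storeP den_seqs [foldl _ _ _]/= den_eq; case: ifP => _; rewrite denE /= /update /= addn1.
  by move: (den storeP c) => c1 c1E; apply: tm_stage => //=; rewrite c1E; lia.
have : 1000 <= stage_bound 6 K by rewrite leq_pmulr // expn_gt0.
lia.
Qed.

End Time.

(** The sixth power of [loop_bound] accounts for 6 times 48, that is 288, in the exponent; the
    surplus absorbs the constants and the number of events. *)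
Definition total_time (N : nat) := 2 ^ (400 * logn2 N ^ 3).

Lemma total_timeP N : 2 * N * (event_bound N).+1 <= total_time N.
Proof.
have := logn2_gt N; rewrite /event_bound /stage_bound /loop_bound /total_time.
set L := logn2 N => NL.
have L0 : 0 < L ^ 3 by rewrite expn_gt0.
have L1 : L <= L ^ 3 by rewrite -{1}[L]expn1 leq_pexp2l.
set x := 2 ^ (48 * L ^ 3).
have x0 : 0 < x by rewrite expn_gt0.
have : (8 * (1000 * x.+1 ^ 6)).+1 <= 2 ^ 19 * x ^ 6.
  have : x.+1 ^ 6 <= (2 * x) ^ 6 by rewrite leq_exp2r //; lia.
  rewrite expnMn -[19]/(13 + 6) expnD -mulnA => le6.
  have a0 : 0 < x.+1 ^ 6 by rewrite expn_gt0.
  have u : 8 * 1000 + 1 <= 2 ^ 13 by [].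
  by apply: leq_trans (leq_mul u le6); move: (x.+1 ^ 6) a0 => a a0; lia.
rewrite /x -expnM -expnD => le.
apply: (@leq_trans (2 ^ (1 + L) * 2 ^ (19 + 48 * L ^ 3 * 6))).
  by apply: leq_mul => //; rewrite expnD expn1 leq_mul2l /= ltnW.
rewrite -expnD leq_pexp2l //; lia.
Qed.

Local Open Scope ring_scope.

(** [gammaN] times the loss of the charging, [8 * M.+2] for [M = logn2 k + 3], the exponent that
    makes [2 ^ M] exceed [8 * k]. *)
Definition ratio (k : nat) := (4 * (logn2 k * (paramD k).+1) * (8 * (logn2 k + 5)))%N.

Lemma expected_cost_const (R : realType) (G : network R) A rs k (c : config G) :
  (forall tape, run A rs tape k = c) -> expected_cost A rs k = schedule_cost (sent c).
Proof.
move=> H; rewrite /expected_cost (eq_bigr (fun=> schedule_cost (sent c))) => [|w _]; last by rewrite H.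
rewrite sumr_const card_tuple card_bool -[_ *+ (2 ^ k)]mulr_natr natrX mulfK //.
Qed.

Lemma run_result (R : realType) (G : network R) (rs : seq (request R (nv G))) : valid_input rs ->
  exists c, [/\ halted c, forall tape, run dst_algorithm rs tape (total_time (nv G + size rs)) = c,
    feasible rs (sent c) & forall S, feasible rs S ->
      schedule_cost (sent c) <= (ratio (nv G))%:R * schedule_cost S].
Proof.
move=> rs_ok; set N := (nv G + size rs)%N; have rN : (size rs <= N)%N by rewrite leq_addl.
have [|c' g' cN|c [arr [log [I hc fin]]]] := @halting R G rs rs_ok (event_bound N).
- by move=> c' cN; apply: tm_request; apply: leq_trans rN.
- by apply: tm_alarm => //; [rewrite leq_addr | apply: leq_trans rN].
exists c; split=> //.
- move=> tape; apply: fin; apply: leq_trans (total_timeP N).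
  by rewrite leq_mul2r leq_mul2l rN orbT.
- exact: halted_feasible I hc.
move=> S fS; have := I => -[b _]; apply: le_trans (inv_cost b) _.
rewrite /ratio natrM -mulrA; apply: ler_wpM2l; first by rewrite ler0n.
have nM : (8 * nv G <= 2 ^ (logn2 (nv G) + 3))%N.
  by rewrite expnD mulnC leq_mul2r ltnW ?orbT // logn2_gt.
apply: le_trans (charging nM fS (inv_log b) (inv_sep b)) _.
by rewrite -!addnS.
Qed.

Lemma dst_competitive (R : realType) : competitive dst_algorithm (fun k => (ratio k)%:R : R).
Proof.
move=> G rs rs_ok; have [c [hc fin fc cost]] := run_result rs_ok.
exists (total_time (nv G + size rs)); split.
- by move=> tape; rewrite fin.
- by move=> tape; rewrite fin.
rewrite (expected_cost_const fin).
have r0 : 0 < (ratio (nv G))%:R :> R by rewrite ltr0n.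
(* The schedule of the run is itself feasible, so the infimum is over a nonempty set. *)
rewrite mulrC -ler_pdivrMr //; apply: lb_le_inf; first by exists (schedule_cost (sent c)), (sent c).
by move=> _ [S fS <-]; rewrite ler_pdivrMr // mulrC; exact: cost.
Qed.

Lemma dst_time (R : realType) (G : network R) (rs : seq (request R (nv G))) : valid_input rs ->
  halts_within dst_algorithm rs (total_time (nv G + size rs)).
Proof. by move=> rs_ok tape; have [c [hc -> _ _]] := run_result rs_ok. Qed.

Local Open Scope classical_set_scope.

(** * Asymptotics of the ratio and of the running time *)

Section Asymptotics.
Variable R : realType.

Lemma bigO_nat (f g : nat -> R) (C : R) n0 : 0 < C ->
  (forall k, (n0 <= k)%N -> `|f k| <= C * `|g k|) ->
  (f : nat -> R^o) =O_\oo (g : nat -> R^o).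
Proof.
move=> C0 H; apply/eqO_exP; exists C => //.
by exists n0 => // k /= /H.
Qed.

Lemma ln2_bounds : 1 / 2 <= ln 2 :> R /\ ln 2 <= 1 :> R.
Proof.
have lnV2 : ln (2^-1) = - ln 2 :> R by rewrite lnV // posrE.
split.
  have : ln (1 + - 2^-1) <= - 2^-1 :> R by apply: le_ln1Dx; lra.
  by rewrite (_ : 1 + - 2^-1 = 2^-1); [rewrite lnV2; lra | lra].
by have : ln (1 + 1) <= 1 :> R by apply: le_ln1Dx; lra.
Qed.

Lemma logn2_le_ln k : (2 <= k)%N -> (logn2 k)%:R <= 4 * ln k%:R :> R.
Proof.
move=> k2; have [l2 _] := ln2_bounds.
have k0 : (0 < k)%N by exact: ltnW.
have t1 : (1 <= trunc_log 2 k)%N by rewrite -(@trunc_expnK 2 1) // leq_trunc_log.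
have : ln ((2 : R) ^+ trunc_log 2 k) <= ln k%:R.
  by rewrite ler_ln ?posrE ?exprn_gt0 ?ltr0n // -natrX ler_nat trunc_logP.
rewrite lnXn // -[_ *+ trunc_log 2 k]mulr_natr /logn2 -[_.+1%:R]natr1.
have : 1 <= (trunc_log 2 k)%:R :> R by rewrite ler1n.
set t := _%:R => t1' le; have : t * (1 / 2) <= t * ln 2 by rewrite ler_wpM2l //; lra.
by move: le; rewrite mulrC; lra.
Qed.

Lemma ln_le_logn2 k : (0 < k)%N -> ln k%:R <= (logn2 k)%:R :> R.
Proof.
move=> k0; have [_ l2] := ln2_bounds.
have : ln k%:R <= ln ((2 : R) ^+ logn2 k).
  by rewrite ler_ln ?posrE ?exprn_gt0 ?ltr0n // -natrX ler_nat ltnW // logn2_gt.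
move=> le; apply: le_trans le _; rewrite lnXn // -[_ *+ logn2 k]mulr_natr ler_piMl ?ler0n //.
Qed.

Lemma total_time_quasipolynomial : quasipolynomial R total_time.
Proof.
exists 3%N; apply: (@bigO_nat _ _ (400 * 64) 2) => [|k k2]; first by rewrite mulr_gt0 ?ltr0n.
have [l2 l2'] := ln2_bounds.
have lk : 0 <= ln k%:R :> R by apply: ln_ge0; rewrite ler1n ltnW.
have L0 : 0 <= (logn2 k)%:R :> R by rewrite ler0n.
have L4 := logn2_le_ln k2.
rewrite (ger0_norm (exprn_ge0 _ lk)) /total_time natrX lnXn // -[_ *+ (400 * _)]mulr_natr natrM natrX.
rewrite ger0_norm; last first.
  by apply: mulr_ge0; [lra | apply: mulr_ge0 (ler0n _ _) (exprn_ge0 _ L0)].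
have c3 : (logn2 k)%:R ^+ 3 <= 64 * ln k%:R ^+ 3 :> R.
  have -> : 64 * ln k%:R ^+ 3 = (4 * ln k%:R) ^+ 3 :> R by ring.
  by rewrite lerXn2r // nnegrE // mulr_ge0.
move: c3 (exprn_ge0 3 L0); set a := _ ^+ 3; set b := _ ^+ 3 => c3 a0.
have : a * ln 2 <= a by rewrite ler_piMr.
by lra.
Qed.

(** Rounding the quotient up and the additional unit cost at most [paramH k] each, and
    [paramH k <= logn2 k]. *)
Lemma paramD_le k : (paramH k * (paramD k).+1 <= 6 * logn2 k)%N.
Proof.
have := leq_trunc_div (4 * logn2 k + (paramH k).-1) (paramH k); rewrite -/(paramD k).
have HL : (paramH k <= logn2 k)%N.
  exact: leq_trans (ltn_expl (trunc_log 2 (logn2 k)) (isT : 1 < 2)%N) (trunc_logP _ _).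
have : (0 < paramH k)%N by []. 
move: HL; move: (paramH k) (paramD k) (logn2 k) => H D L; nia.
Qed.

Lemma ratio_bigO :
  (fun k => (ratio k)%:R : R^o) =O_\oo (fun k => ln k%:R ^+ 3 / ln (ln k%:R) : R^o).
Proof.
(* With [L = logn2 k], 1152 is 32 times 6 from [L + 5 <= 6 * L] times 6 from [paramD_le], and 64 is
   the cube of the 4 in [L <= 4 * ln k]. From 16 on, [ln k] is at least 2 and the iterated logarithm
   positive. *)
apply: (@bigO_nat _ _ (1152 * 64) 16) => [|k k16]; first by rewrite mulr_gt0 ?ltr0n.
have [l2 l2'] := ln2_bounds.
have k0 : (0 < k)%N by exact: leq_trans k16.
have lk : 2 <= ln k%:R :> R.
  have : ln ((2 : R) ^+ 4) <= ln k%:R.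
    by rewrite ler_ln ?posrE ?exprn_gt0 ?ltr0n // -natrX ler_nat.
  by rewrite lnXn //; lra.
have lk0 : 0 <= ln k%:R :> R by lra.
have llk : 0 < ln (ln k%:R) :> R by apply: ln_gt0; lra.
have llH : ln (ln k%:R) <= (paramH k)%:R :> R.
  apply: le_trans (ln_le_logn2 (isT : (0 < logn2 k)%N)).
  by rewrite ler_ln ?posrE ?ltr0n //; [exact: ln_le_logn2 | lra].
have H0 : 0 < (paramH k)%:R :> R by rewrite ltr0n.
have L4 := logn2_le_ln (leq_trans (isT : (2 <= 16)%N) k16).
have L0 : 0 <= (logn2 k)%:R :> R by rewrite ler0n.
have c3 : (logn2 k)%:R ^+ 3 <= 64 * ln k%:R ^+ 3 :> R.
  have -> : 64 * ln k%:R ^+ 3 = (4 * ln k%:R) ^+ 3 :> R by ring.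
  by rewrite lerXn2r // nnegrE // mulr_ge0.
have rH : (ratio k)%:R * (paramH k)%:R <= 1152 * (logn2 k)%:R ^+ 3 :> R.
  rewrite -natrM -natrX -natrM ler_nat /ratio.
  have := paramD_le k; have : (0 < logn2 k)%N by [].
  rewrite !expnS expn0 muln1; move: (logn2 k) (paramH k) (paramD k).+1 => L H D L1 le.
  have : (L * (L + 5) * (H * D) <= (L * (6 * L)) * (6 * L))%N by apply: leq_mul => //; rewrite leq_mul2l; lia.
  by lia.
rewrite ger0_norm ?ler0n // ger0_norm; last by rewrite divr_ge0 ?exprn_ge0 // ltW.
rewrite mulrA ler_pdivlMr //; apply: (@le_trans _ _ ((ratio k)%:R * (paramH k)%:R)).
  by rewrite ler_wpM2l.
by move: rH c3; lra.
Qed.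

End Asymptotics.

Theorem theorem3p7 (R : realType) :
  exists A : algorithm,
    (exists2 alpha : nat -> R,
       (fun n => alpha n : R^o) =O_\oo (fun n => ln n%:R ^+ 3 / ln (ln n%:R) : R^o)
       & competitive A alpha)
    /\ quasipolynomial_time R A.
Proof.
exists dst_algorithm; split.
  by exists (fun k => (ratio k)%:R); [exact: ratio_bigO | exact: dst_competitive].
by exists total_time; [exact: total_time_quasipolynomial | exact: dst_time].
Qed.
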